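(* Assume $E[\xi_1^4]<\infty$ and that for every $T>0$ the set $\mathcal N(T)=\{l\in S_F: c_l<Tq_l\}$ is finite. Let $\gamma\in(0,1)$, let $m=n-\lfloor\sqrt n\rfloor$, and let $T_{n,\gamma}$ be a sequence of positive numbers such that, as $n\to\infty$, $$\Big(\frac{m(m-1)}{2}\sum_{l\in\mathcal L}(T_{n,\gamma}q_l-c_l)_+^2\Big)^{1/2}=\Big(\sum_{l\in\mathcal L}c_l(T_{n,\gamma}q_l-c_l)_+\Big)\big(2z_{1-\gamma/2}+o(1)\big).$$ Define $$r_{n,\gamma}^*=\Big\{\frac{\sum_{l\in\mathcal L}q_l(T_{n,\gamma}q_l-c_l)_+}{\sum_{l\in\mathcal L}c_l(T_{n,\gamma}q_l-c_l)_+}\Big\}^{1/2}.$$ Assume the following conditions. [C1] For some constant $C_1>0$, $|\mathcal N(T_{n,\gamma})|\max_{l\in\mathcal N(T_{n,\gamma})}q_l^2\le C_1\sum_{l\in\mathcal N(T_{n,\gamma})}\big(q_l-\frac{c_l}{T_{n,\gamma}}\big)^2$. [C2] As $n\to\infty$, $\sum_{l\in\mathcal N(T_{n,\gamma})}q_l^2=o\big(n^2\min_{l\in\mathcal N(T_{n,\gamma})}q_l^2\big)$. [C3] For some constant $C_3>0$, $\sup_{\mathbf t\in\Delta}\sum_{l\in\mathcal N(T_{n,\gamma})}\varphi_l^2(\mathbf t)\le C_3|\mathcal N(T_{n,\gamma})|$. [C4] As $n\to\infty$, $|\mathcal N(T_{n,\gamma})|\to\infty$ and $|\mathcal N(T_{n,\gamma})|=o(n)$.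 [C5] As $n\to\infty$, $T_{n,\gamma}\inf_{l\in S_F}q_l\to+\infty$. [C6] As $n\to\infty$, $\sup_{f\in\Sigma}E_f[\|\Pi f-\widehat{\Pi f}_n\|_4^4]=o(1)$. [C7] For some $p>4$, $\sup_{f\in\Sigma}\|\Pi_{S_F}f\|_p<\infty$. Let $\widehat\phi_n^*=\mathbf 1_{\{U_n>z_{1-\gamma/2}\}}$, where $U_n$ is the U-statistic (defined in the context) based on the weights $$\widehat w_{l,n}^*=\frac{(T_{n,\gamma}q_l-c_l)_+}{\big[\sum_{l'\in\mathcal L}(T_{n,\gamma}q_{l'}-c_{l'})_+^2\big]^{1/2}},\qquad l\in\mathcal L .$$ Then $\gamma_n(\mathcal F_0,\mathcal F_1(r_{n,\gamma}^* ),\widehat\phi_n^* )\le\gamma+o(1)$ as $n\to\infty$.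
   Context: Model: $\Delta=[0,1]^d$; one observes $(x_i,\mathbf t_i)$, $i=1,\dots,n$, with $x_i=f(\mathbf t_i)+\xi_i$, where the $\mathbf t_i$ are i.i.d. uniform on $\Delta$ and, conditionally on $\mathbf t_1,\dots,\mathbf t_n$, the $\xi_i$ are i.i.d. with mean $0$ and variance $1$. $P_f,E_f$ denote the law of the data and its expectation. $\|\cdot\|_q$ is the $L_q(\Delta)$ norm. All regression functions are centered ($\int_\Delta f=0$); $\{\varphi_l\}_{l\in\mathcal L}$ ($\mathcal L$ countable) is an orthonormal basis of the subspace of centered functions of $L_2(\Delta)$, and $\theta_l[f]=\int_\Delta f\varphi_l$. Arrays $\mathbf c=(c_l)$ and $\mathbf q=(q_l)$ with $c_l\ge0$, $q_l\ge0$ are given; $\Sigma$ is a given subset of $\{f=\sum_l\theta_l[f]\varphi_l:\sum_l c_l\theta_l[f]^2\le1\}$; $Q[f]=\sum_l q_l\theta_l[f]^2$; $S_F=\{l:q_l\ne0\}$. $\mathcal F_0=\{f\in\Sigma:Q[f]=0\}$, $\mathcal F_1(\rho)=\{f\in\Sigma:|Q[f]|\ge\rho^2\}$. For a test $\phi_n$ (a $\{0,1\}$-valued measurable function of the data), $\gamma_n(\mathcal F_0,\mathcal F_1,\phi_n)=\sup_{f\in\mathcal F_0}P_f(\phi_n=1)+\sup_{f\in\mathcal F_1}P_f(\phi_n=0)$. $\Pi_{S_F}f$ and $\Pi f$ are the $L_2$-orthogonal projections of $f$ onto the closed spans of $\{\varphi_l\}_{l\in S_F}$ and of $\{\varphi_l\}_{l\notin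 S_F}$, respectively. With $m=n-\lfloor\sqrt n\rfloor$, a pilot estimator $\widehat{\Pi f}_n$ of $\Pi f$ is built from the last $n-m$ observations $(x_i,\mathbf t_i)_{m<i\le n}$ and takes values in the closed span of $\{\varphi_l\}_{l\notin S_F}$. Put $\tilde x_i=x_i-\widehat{\Pi f}_n(\mathbf t_i)$. For an array $\mathbf w_n=(w_{l,n})_{l\in S_F}$ with finitely many nonzero entries and $\sum_l w_{l,n}^2=1$, $$U_n=\Big(\frac{2}{m(m-1)}\Big)^{1/2}\sum_{1\le i<j\le m}\tilde x_i\tilde x_j\sum_{l\in S_F}w_{l,n}\varphi_l(\mathbf t_i)\varphi_l(\mathbf t_j).$$ $z_\alpha$ is the $\alpha$-quantile of $\mathcal N(0,1)$; $a_+=\max(a,0)$; $|A|$ is the cardinality of a set $A$. *)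

(* Defs.v *)
From HB Require Import structures.
From mathcomp Require Import all_boot all_order all_algebra finmap.
From mathcomp Require Import all_classical all_reals all_analysis.

Set Implicit Arguments.
Unset Strict Implicit.
Unset Printing Implicit Defensive.

Import Order.TTheory GRing.Theory Num.Theory.
Import numFieldNormedType.Exports.
Local Open Scope classical_set_scope.
Local Open Scope ring_scope.

(* Supremum in [0, +oo] of a set of nonnegative values: the supremum over an
   empty class is 0, whereas ereal_sup set0 = -oo. *)
Definition sup_ge0 {R : realType} (A : set (\bar R)) : \bar R :=
  ereal_sup (0%E |` A).

Definition gauss_quantile {R : realType} (a : R) : R :=
  inf [set x : R | (a%:E <= normal_prob 0 1 `]-oo, x])%E].

Section iid_law.
Context d (T : measurableType d) (R : realType) (P : probability T R).

Definition cons_tuple n (p : T * n.-tuple T) : n.+1.-tuple T :=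
  [tuple of p.1 :: p.2].

Lemma measurable_cons_tuple n : measurable_fun setT (@cons_tuple n).
Proof. exact: measurable_cons. Qed.

HB.instance Definition _ n :=
  isMeasurableFun.Build _ _ _ _ (@cons_tuple n) (@measurable_cons_tuple n).

Fixpoint iid_law n : probability (n.-tuple T) R :=
  if n is k.+1 then distribution (P \x iid_law k)%E (@cons_tuple k)
  else dirac [tuple].

End iid_law.

(* Functions on the cube [0, 1]^d are represented by functions on R^d; only
   their values on the cube matter, since unif_cube is carried by it. *)
Notation site R d := (d.-tuple (measurableTypeR R)).

Notation regfun R d := {mfun site R d >-> measurableTypeR R}.

(* An observation is a pair (x_i, t_i). *)
Notation obs R d := (measurableTypeR R * site R d)%type.

Definition cube (R : realType) (d : nat) : set (site R d) :=
  [set t | forall i, 0 <= tnth t i <= 1].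
Arguments cube : clear implicits.

Definition unif_cube (R : realType) (d : nat) : probability (site R d) R :=
  iid_law (uniform_prob (@ltr01 R)) d.

Section regression_model.
Context (R : realType) (d : nat).

Definition observe (f : site R d -> R)
    (p : site R d * measurableTypeR R) : obs R d := (f p.1 + p.2, p.1).

Lemma measurable_observe (f : regfun R d) : measurable_fun setT (observe f).
Proof.
apply: measurable_fun_pair; last exact: measurable_fst.
apply: measurable_realfun.measurable_funD; last exact: measurable_snd.
by apply: (measurableT_comp (f := f)) => //; exact: measurable_fst.
Qed.

HB.instance Definition _ (f : regfun R d) :=
  isMeasurableFun.Build _ _ _ _ (observe f) (@measurable_observe f).

(* P_f for the sample of size n: the pairs (f(t_i) + xi_i, t_i) are i.i.d. with
   t_i uniform on the cube and xi_i of law nu, independent of t_i. *)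
Definition data_law (nu : probability (measurableTypeR R) R) (f : regfun R d)
    (n : nat) : probability (n.-tuple (obs R d)) R :=
  iid_law (distribution (unif_cube R d \x nu)%E (observe f)) n.

(* The two suprema are added, not maximized; true stands for rejection. *)
Definition total_error (nu : probability (measurableTypeR R) R) (n : nat)
    (F0 F1 : set (regfun R d)) (phi : n.-tuple (obs R d) -> bool) : \bar R :=
  (sup_ge0 [set data_law nu f n [set D | phi D] | f in F0] +
   sup_ge0 [set data_law nu f n [set D | ~~ phi D] | f in F1])%E.

End regression_model.

Section basis.
Context (R : realType) (d : nat) (L : countType).
Implicit Types (phi : L -> site R d -> R) (f g h : site R d -> R).

Definition cube_norm (p : R) g : \bar R :=
  ('N[unif_cube R d]_(p%:E)[EFin \o g])%E.
Arguments cube_norm p%_R g%_R.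

Definition in_L2 g : Prop := g \in Lfun (unif_cube R d) 2%:E.

Definition dot f g : R := \int[unif_cube R d]_t (f t * g t).

Definition centered g : Prop := \int[unif_cube R d]_t g t = 0.

Definition coef phi f (l : L) : R := dot f (phi l).

Definition lincomb phi (a : L -> R) (F : {fset L}) (t : site R d) : R :=
  \sum_(l <- F) a l * phi l t.

(* The closure is taken in L_2. *)
Definition closed_span phi (A : set L) g : Prop :=
  in_L2 g /\
  forall e : R, 0 < e -> exists (F : {fset L}) (a : L -> R),
    (forall l, l \in F -> A l) /\
    (cube_norm 2 (g \- lincomb phi a F) < e%:E)%E.

(* f = \sum_l a_l phi_l, with (unconditional) convergence in L_2. *)
Definition expansion phi (a : L -> R) f : Prop :=
  forall e : R, 0 < e -> exists F0 : {fset L}, forall F : {fset L},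
    (F0 `<=` F)%fset -> (cube_norm 2 (f \- lincomb phi a F) < e%:E)%E.

Definition centered_basis phi : Prop :=
  [/\ forall l, in_L2 (phi l) /\ centered (phi l),
      forall k l, dot (phi k) (phi l) = (k == l)%:R &
      forall g, in_L2 g -> centered g -> closed_span phi setT g].

(* g is a version of the orthogonal projection of f; it is determined almost
   everywhere only. *)
Definition is_projection phi (A : set L) f g : Prop :=
  closed_span phi A g /\
  forall h, closed_span phi A h -> dot (f \- g) h = 0.

Definition ellipsoid phi (c : L -> R) : set (regfun R d) :=
  [set f | [/\ in_L2 f, centered f, expansion phi (coef phi f) f &
    (\esum_(l in [set: L]) (c l * coef phi f l ^+ 2)%:E <= 1)%E]].

Definition quad phi (q : L -> R) f : \bar R :=
  \esum_(l in [set: L]) (q l * coef phi f l ^+ 2)%:E.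

Definition supp (q : L -> R) : set L := [set l | q l != 0].

Definition null_class phi q (Sigma : set (regfun R d)) : set (regfun R d) :=
  [set f | Sigma f /\ quad phi q f = 0%E].

Definition alt_class phi q (Sigma : set (regfun R d)) (rho : R) :
    set (regfun R d) :=
  [set f | Sigma f /\ ((rho ^+ 2)%:E <= `|quad phi q f|)%E].

End basis.
Arguments cube_norm {R d} p%_R g%_R.

Section weights.
Context (R : realType) (L : countType) (c q : L -> R).

Definition active (T : R) : set L := [set l | supp q l /\ c l < T * q l].

Definition card_active (T : R) : nat := #|` fset_set (active T)|.

Definition gap (T : R) (l : L) : R := Num.max (T * q l - c l) 0.

(* The sums below have finite support as soon as active T is finite. *)
Definition sum_gap2 (T : R) : R := \sum_(l \in [set: L]) gap T l ^+ 2.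
Definition sum_c_gap (T : R) : R := \sum_(l \in [set: L]) c l * gap T l.
Definition sum_q_gap (T : R) : R := \sum_(l \in [set: L]) q l * gap T l.

Definition crit_radius (T : R) : R := Num.sqrt (sum_q_gap T / sum_c_gap T).

Definition weight (T : R) (l : L) : R := gap T l / Num.sqrt (sum_gap2 T).

End weights.

Section statistic.
Context (R : realType) (d : nat) (L : countType).

Definition main_size (n : nat) : nat :=
  (n - Num.truncn (Num.sqrt n%:R : R))%N.

Definition residual n (h : site R d -> R) (D : n.-tuple (obs R d))
    (i : 'I_n) : R := (tnth D i).1 - h (tnth D i).2.

(* Observations are indexed from 0: the first m of them are those with i < m. *)
Definition Ustat n (m : nat) (phi : L -> site R d -> R) (S : set L)
    (w : L -> R) (h : site R d -> R) (D : n.-tuple (obs R d)) : R :=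
  Num.sqrt (2 / (m%:R * (m%:R - 1))) *
  \sum_(i < n) \sum_(j < n | (i < j < m)%N)
    residual h D i * residual h D j *
    \sum_(l \in S) w l * phi l (tnth D i).2 * phi l (tnth D j).2.

(* A pilot estimator maps the last n - m observations to a function; it is
   measurable jointly in the observations and the point. *)
Definition is_pilot (phi : L -> site R d -> R) (A : set L) n
    (pilot : (n - main_size n).-tuple (obs R d) -> site R d -> R) : Prop :=
  measurable_fun setT
    (fun p : (n - main_size n).-tuple (obs R d) * site R d =>
       pilot p.1 p.2 : measurableTypeR R) /\
  forall D, closed_span phi A (pilot D).

Definition last_obs n (D : n.-tuple (obs R d)) :
    (n - main_size n).-tuple (obs R d) := [tuple of drop (main_size n) D].

End statistic.

(* Main.v *)
(** Given the pilot sample, Hoeffding's decomposition writes the statistic as D + Lin + mu, where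
    D is a degenerate quadratic form in independent vectors, Lin is linear and mu is
    (m (m - 1) / 2)^(1/2) times the weighted sum of the squared coefficients.  A Lindeberg
    argument shows that D is asymptotically standard normal as soon as the signal that is left
    after subtracting the pilot is small in L_4: the observations are exchanged one at a time for
    Gaussian increments inside a C^2 test function, and the error is controlled by the
    fluctuations of the conditional variance and by fourth moments.  Markov's inequality and C6
    make the pilot loss small.  Under the null hypothesis the projection on S_F vanishes and
    Lin = mu = 0.  Under the alternative the choice of T gives mu >= 2 z - o(1).  If mu is very
    large, Chebyshev's inequality suffices.  If mu stays bounded, C2 and C5 force the projection
    on S_F to 0 in L_2, hence in L_4 by C7; then Lin is negligible and the normal approximation
    bounds the second error as well. *)
Require Import Defs.
From mathcomp Require Import all_boot all_order all_algebra finmap.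
From mathcomp Require Import all_classical all_reals all_analysis.
From mathcomp Require Import measurable_realfun ring lra.

Set Implicit Arguments.
Unset Strict Implicit.
Unset Printing Implicit Defensive.

Import Order.TTheory GRing.Theory Num.Theory.
Import numFieldNormedType.Exports.
Local Open Scope classical_set_scope.
Local Open Scope ring_scope.

(** * Integration and i.i.d. samples *)

(** The suprema over [Sigma] stand inside the limit, so every estimate is quantitative:
    [regression_test] fixes its constants before the function, the pilot value and n are given, and
    C1 to C7 serve to meet finitely many numerical thresholds at one n. Two sizes govern them: [om],
    a bound on the weights with om^2 of order 1/N, and [B], a bound of order N on the squared norm
    of the vector of basis functions, where N is the number of active indices. C1 and C3 keep om^2 B
    bounded, C4 makes om^2 and B/m small. The pilot is orthogonal to the span over S_F, so it
    changes neither the signal coefficients nor mu, only the fluctuations. The conditional variance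
    of each new term of D is random, but its centred version is a martingale of small variance, so
    one scalar Gaussian of deterministic variance can replace the term. The factor 2 in 2 z turns
    the second error into the probability that D falls below about -z, which costs gamma/2 like the
    first. *)

Ltac mfun := repeat first
  [ assumption | exact: measurable_cst | exact: measurable_id
  | apply: measurable_realfun.measurable_funD | apply: measurable_realfun.measurable_funB
  | apply: measurable_realfun.measurable_funN
  | apply: measurable_realfun.measurable_funM | apply: measurable_realfun.measurable_funX
  | apply: measurable_sum => ? ].

(** Common core of the finite and the integral Cauchy-Schwarz inequalities. At (b, -c) the form
    equals b (a b - c^2); if b = 0 and c is nonzero, the second test point gives the value -1. *)
Lemma quad_form_discr (R : realFieldType) (a b c : R) :
  (forall s t, 0 <= s ^+ 2 * a + (2 * s * t * c + t ^+ 2 * b)) -> c ^+ 2 <= a * b.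
Proof.
move=> key.
have b0 : 0 <= b by have := key 0 1; rewrite expr0n expr1n mulr0 !mul0r mul1r !add0r.
have [b_eq0|bN0] := eqVneq b 0.
  rewrite b_eq0 mulr0.
  have [->|c0] := eqVneq c 0; first by rewrite expr0n.
  have := key 1 (- (a + 1) / (2 * c)); rewrite b_eq0.
  rewrite (_ : _ + _ = - 1); first by rewrite ler0N1.
  by field.
have bgt : 0 < b by rewrite lt_def bN0 b0.
have := key b (- c).
rewrite (_ : _ + _ = b * (a * b - c ^+ 2)); last by ring.
by rewrite pmulr_rge0// subr_ge0.
Qed.

Lemma sum_cauchy_schwarz (R : realFieldType) (I : Type) (r : seq I) (b x : I -> R) :
  (\sum_(i <- r) b i * x i) ^+ 2 <=
  (\sum_(i <- r) b i ^+ 2) * (\sum_(i <- r) x i ^+ 2).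
Proof.
apply: quad_form_discr => s t.
rewrite !mulr_sumr -!big_split /=; apply: sumr_ge0 => i _.
rewrite (_ : _ + _ = (s * b i + t * x i) ^+ 2) ?sqr_ge0//; ring.
Qed.

Section real_integral.
Context d (T : measurableType d) (R : realType) (mu : {measure set T -> \bar R}).
Implicit Types f g : T -> R.

Definition L1 f := mu.-integrable [set: T] (EFin \o f).

Lemma L1_measurable f : L1 f -> measurable_fun setT f.
Proof. by move=> /measurable_int/measurable_EFinP. Qed.

Lemma L1_le f g : measurable_fun setT f -> L1 g ->
  (forall x, `|f x| <= g x) -> L1 f.
Proof.
move=> mf ig fg; apply: (le_integrable measurableT _ _ ig).
  exact/measurable_EFinP.
move=> x _ /=; rewrite lee_fin; apply: le_trans (fg x) _; exact: ler_norm.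
Qed.

Lemma L1D f g : L1 f -> L1 g -> L1 (fun x => f x + g x).
Proof. by move=> hf hg; exact: (integrableD measurableT hf hg). Qed.

Lemma L1B f g : L1 f -> L1 g -> L1 (fun x => f x - g x).
Proof. by move=> hf hg; exact: (integrableB measurableT hf hg). Qed.

Lemma L1Z (c : R) f : L1 f -> L1 (fun x => c * f x).
Proof. by move=> hf; exact: (integrableZl measurableT c hf). Qed.

Lemma L1_sum (I : Type) (s : seq I) (p : pred I) (F : I -> T -> R) :
  (forall i, L1 (F i)) -> L1 (fun x => \sum_(i <- s | p i) F i x).
Proof.
move=> h; have := @integrable_sum _ _ _ mu _ measurableT I s p
   (fun i => EFin \o F i) (fun i _ => h i).
apply: eq_integrable => // x _ /=; by rewrite sumEFin.
Qed.

Lemma EFin_Rintegral f : L1 f -> (\int[mu]_x (f x)%:E)%E = (\int[mu]_x f x)%:E.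
Proof. by move=> h; rewrite /Rintegral fineK//; exact: integrable_fin_num. Qed.

Lemma Rintegral_sum (I : Type) (s : seq I) (F : I -> T -> R) :
  (forall i, L1 (F i)) ->
  \int[mu]_x (\sum_(i <- s) F i x) = \sum_(i <- s) \int[mu]_x F i x.
Proof.
move=> h; elim: s => [|i s ih].
  under eq_Rintegral do rewrite big_nil.
  by rewrite Rintegral_cst// mul0r big_nil.
under eq_Rintegral do rewrite big_cons.
rewrite RintegralD//; first by rewrite ih big_cons.
- exact: h.
- exact: L1_sum.
Qed.

(** Passage from extended to real integrals: for a nonnegative function the extended bound already
    contains integrability. *)
Lemma ge0_Rintegral_le f (c : R) : measurable_fun setT f ->
  (forall x, 0 <= f x) -> (\int[mu]_x (f x)%:E <= c%:E)%E ->
  L1 f /\ \int[mu]_x f x <= c.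
Proof.
move=> mf f0 h.
have If : L1 f.
  apply/integrableP; split; first exact/measurable_EFinP.
  under eq_integral => x _ do rewrite /= ger0_norm//.
  exact: le_lt_trans h (ltry _).
by split=> //; rewrite -lee_fin -EFin_Rintegral.
Qed.

Lemma le_Rint f g : L1 f -> L1 g -> (forall x, f x <= g x) ->
  \int[mu]_x f x <= \int[mu]_x g x.
Proof. by move=> hf hg fg; apply: le_Rintegral. Qed.

Lemma Rint_ge0 f : (forall x, 0 <= f x) -> 0 <= \int[mu]_x f x.
Proof. by move=> h; apply: Rintegral_ge0. Qed.

Lemma RintD f g : L1 f -> L1 g ->
  \int[mu]_x (f x + g x) = \int[mu]_x f x + \int[mu]_x g x.
Proof. by move=> hf hg; apply: RintegralD. Qed.

Lemma RintB f g : L1 f -> L1 g ->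
  \int[mu]_x (f x - g x) = \int[mu]_x f x - \int[mu]_x g x.
Proof. by move=> hf hg; apply: RintegralB. Qed.

Lemma RintZ c f : L1 f -> \int[mu]_x (c * f x) = c * \int[mu]_x f x.
Proof. by move=> hf; apply: RintegralZl. Qed.

Lemma eq_Rint f g : f =1 g -> \int[mu]_x f x = \int[mu]_x g x.
Proof. by move=> fg; apply: eq_Rintegral => x _. Qed.

Lemma le_norm_Rint f g : L1 f -> L1 g -> (forall x, `|f x| <= g x) ->
  `|\int[mu]_x f x| <= \int[mu]_x g x.
Proof.
move=> hf hg fg; apply: le_trans (le_normr_Rintegral _ _) _ => //.
apply: le_Rint => //; apply: L1_le hg _.
  by apply: measurableT_comp => //; exact: L1_measurable.
by move=> x; rewrite normr_id.
Qed.

Lemma L1M_sqr f g : measurable_fun setT f -> measurable_fun setT g ->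
  L1 (fun x => f x ^+ 2) -> L1 (fun x => g x ^+ 2) -> L1 (fun x => f x * g x).
Proof.
move=> mf mg hf hg; apply: (L1_le _ (L1D hf hg)); first by mfun.
move=> x; rewrite normrM -(real_normK (num_real (f x))) -(real_normK (num_real (g x))).
by nra.
Qed.

Lemma Rint_cauchy_schwarz f g : measurable_fun setT f -> measurable_fun setT g ->
  L1 (fun x => f x ^+ 2) -> L1 (fun x => g x ^+ 2) ->
  (\int[mu]_x (f x * g x)) ^+ 2 <=
  \int[mu]_x (f x ^+ 2) * \int[mu]_x (g x ^+ 2).
Proof.
move=> mf mg hf hg; have hfg := L1M_sqr mf mg hf hg.
set a := \int[mu]_x (f x ^+ 2); set b := \int[mu]_x (g x ^+ 2).
set c := \int[mu]_x (f x * g x).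
have key s t : 0 <= s ^+ 2 * a + (2 * s * t * c + t ^+ 2 * b).
  have -> : s ^+ 2 * a + (2 * s * t * c + t ^+ 2 * b) =
      \int[mu]_x (s ^+ 2 * f x ^+ 2 + (2 * s * t * (f x * g x) + t ^+ 2 * g x ^+ 2)).
    rewrite RintD; [|exact: L1Z|by apply: L1D; exact: L1Z].
    rewrite RintD; [|exact: L1Z|exact: L1Z].
    by rewrite !RintZ.
  apply: Rint_ge0 => x.
  rewrite (_ : _ + _ = (s * f x + t * g x) ^+ 2) ?sqr_ge0//; ring.
exact: quad_form_discr key.
Qed.

End real_integral.
Arguments L1 {d T R} mu f.
Arguments eq_Rint {d T R mu f} g _.

Section probability_integral.
Context d (T : measurableType d) (R : realType) (P : probability T R).

Lemma L1_cst (c : R) : L1 P (fun=> c).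
Proof. exact: finite_measure_integrable_cst. Qed.

Lemma L1_bounded (f : T -> R) (c : R) : measurable_fun setT f ->
  (forall x, `|f x| <= c) -> L1 P f.
Proof. by move=> mf fc; apply: (L1_le mf (L1_cst c)). Qed.

Lemma Rint_cst (c : R) : \int[P]_x c = c.
Proof. by rewrite Rintegral_cst// [X in fine X](probability_setT P) mulr1. Qed.

Lemma integral_cstP (c : R) : (\int[P]_x c%:E)%E = c%:E.
Proof. by rewrite integral_cst// [X in (_ * X)%E](probability_setT P) mule1. Qed.

Lemma L1_sqr (f : T -> R) : measurable_fun setT f ->
  L1 P (fun x => f x ^+ 2) -> L1 P f.
Proof.
move=> mf h; apply: (L1_le mf (L1D (L1_cst 1) h)) => x.
rewrite -(real_normK (num_real (f x))); nra.
Qed.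

End probability_integral.

(** * Tonelli's theorem for i.i.d. samples of varying size *)

Section iid_tonelli.
Context d (T : measurableType d) (R : realType) (P : probability T R).
Local Open Scope ereal_scope.

Lemma measurable_cons_pair k :
  measurable_fun setT (fun p : T * k.-tuple T => [tuple of p.1 :: p.2]).
Proof. exact: measurable_cons. Qed.

Lemma measurable_fun_cons k (f : k.+1.-tuple T -> \bar R) :
  measurable_fun setT f ->
  measurable_fun setT (fun p : T * k.-tuple T => f [tuple of p.1 :: p.2]).
Proof. by move=> mf; exact: (measurableT_comp mf (@measurable_cons_pair k)). Qed.

Lemma integral_iid_law k (f : k.+1.-tuple T -> \bar R) :
  measurable_fun setT f -> (forall D, 0 <= f D) ->
  \int[iid_law P k.+1]_D f D =
  \int[iid_law P k]_D \int[P]_z f [tuple of z :: D].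
Proof.
move=> mf f0; rewrite /= ge0_integral_distribution//.
rewrite (@fubini_tonelli2 _ _ _ _ _ P (iid_law P k)); [|exact: measurable_fun_cons|].
  exact: eq_integral.
by move=> p; exact: f0.
Qed.

Lemma integral_iid_law0 (f : 0.-tuple T -> \bar R) :
  measurable_fun setT f -> \int[iid_law P 0]_D f D = f [tuple].
Proof. by move=> mf; rewrite /= integral_dirac// diracT mul1e. Qed.

(** Statistics live on [seq T] and are measurable at each length, so that inductions on the sample
    size can pass from [s] to [z :: s] freely. *)
Definition mseq (f : seq T -> R) :=
  forall k, measurable_fun setT (fun D : k.-tuple T => f D).

Definition Eiid k (f : seq T -> R) := \int[iid_law P k]_D (f D)%:E.

Lemma mseqEFin f k : mseq f -> measurable_fun setT (fun D : k.-tuple T => (f D)%:E).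
Proof. by move=> mf; apply/measurable_EFinP; exact: mf. Qed.

Lemma EiidD k f g : mseq f -> mseq g -> (forall s, (0 <= f s)%R) ->
  (forall s, (0 <= g s)%R) -> Eiid k (fun s => f s + g s)%R = Eiid k f + Eiid k g.
Proof.
move=> mf mg f0 g0; rewrite /Eiid -ge0_integralD//.
- by move=> D _; rewrite lee_fin.
- exact: mseqEFin.
- by move=> D _; rewrite lee_fin.
- exact: mseqEFin.
Qed.

Lemma EiidZ k f c : mseq f -> (forall s, (0 <= f s)%R) -> (0 <= c)%R ->
  Eiid k (fun s => c * f s)%R = c%:E * Eiid k f.
Proof.
move=> mf f0 c0; rewrite /Eiid -ge0_integralZl_EFin//.
- by move=> D _; rewrite lee_fin.
- exact: mseqEFin.
Qed.

Lemma Eiid_cst k c : Eiid k (fun=> c) = c%:E.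
Proof. exact: integral_cstP. Qed.

Lemma Eiid_leD k f g (A B : R) : mseq f -> mseq g -> (forall s, (0 <= f s)%R) ->
  (forall s, (0 <= g s)%R) -> Eiid k f <= A%:E -> Eiid k g <= B%:E ->
  Eiid k (fun s => f s + g s)%R <= (A + B)%:E.
Proof. by move=> mf mg f0 g0 fA gB; rewrite EiidD// EFinD; exact: leeD. Qed.

Lemma Eiid_leZ k f c (A : R) : mseq f -> (forall s, (0 <= f s)%R) -> (0 <= c)%R ->
  Eiid k f <= A%:E -> Eiid k (fun s => c * f s)%R <= (c * A)%:E.
Proof.
by move=> mf f0 c0 fA; rewrite EiidZ// EFinM; apply: lee_wpmul2l => //; rewrite lee_fin.
Qed.

Lemma Eiid0 f : mseq f -> Eiid 0 f = (f [::])%:E.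
Proof. by move=> mf; rewrite /Eiid integral_iid_law0//; exact: mseqEFin. Qed.

(** Conditioning on all observations but the newest: a bound on the conditional mean can be
    integrated. The moment recursions below are inductions with this step. *)
Lemma EiidS_le k f g : mseq f -> mseq g -> (forall s, (0 <= f s)%R) ->
  (forall s, L1 P (fun z => f (z :: s)) /\ (\int[P]_z f (z :: s) <= g s)%R) ->
  Eiid k.+1 f <= Eiid k g.
Proof.
move=> mf mg f0 h; rewrite /Eiid integral_iid_law; last 2 first.
- exact: mseqEFin.
- by move=> D; rewrite lee_fin.
have mfc : measurable_fun setT (fun p : T * k.-tuple T => (f (p.1 :: p.2))%:E).
  exact: (measurable_fun_cons (mseqEFin (k := k.+1) mf)).
apply: ge0_le_integral => //.
- by move=> D _; apply: integral_ge0 => z _; rewrite lee_fin.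
- apply: (@measurable_fun_fubini_tonelli_G _ _ _ _ _ P
    (fun p : T * k.-tuple T => (f (p.1 :: p.2))%:E)) => // p.
  by rewrite lee_fin.
- exact: mseqEFin.
- by move=> D _; have [hl hle] := h D; rewrite EFin_Rintegral// lee_fin.
Qed.

Lemma mseq_Rint (f : seq T -> T -> R) :
  (forall k, measurable_fun setT (fun p : k.-tuple T * T => f p.1 p.2)) ->
  (forall s z, (0 <= f s z)%R) -> mseq (fun s => \int[P]_z f s z)%R.
Proof.
move=> mf f0 k; apply: measurableT_comp; first exact: fine_measurable.
apply: (@measurable_fun_fubini_tonelli_F _ _ _ _ _ P (fun p : k.-tuple T * T => (f p.1 p.2)%:E)).
  by apply/measurable_EFinP; exact: mf.
by move=> p; rewrite lee_fin.
Qed.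

Lemma Eiid_Rint k (f : seq T -> T -> R) :
  (forall k, measurable_fun setT (fun p : k.-tuple T * T => f p.1 p.2)) ->
  (forall s z, (0 <= f s z)%R) -> (forall s, L1 P (f s)) ->
  Eiid k (fun s => \int[P]_z f s z)%R = \int[P]_z Eiid k (f ^~ z).
Proof.
move=> mf f0 Lf; rewrite /Eiid; under eq_integral do rewrite -EFin_Rintegral//.
apply: (@fubini_tonelli _ _ _ _ _ (iid_law P k) P (fun p : k.-tuple T * T => (f p.1 p.2)%:E)).
  by apply/measurable_EFinP; exact: mf.
by move=> p; rewrite lee_fin.
Qed.

Lemma Rint_iidS k (f : seq T -> R) : mseq f -> (forall s, 0 <= f s <= 1)%R ->
  (\int[iid_law P k.+1]_D f D = \int[iid_law P k]_D \int[P]_z f (z :: D))%R /\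
  measurable_fun setT (fun D : k.-tuple T => \int[P]_z f (z :: D))%R.
Proof.
move=> mf f01; have f0 s : (0 <= f s)%R by have /andP[] := f01 s.
have mfc : measurable_fun setT (fun p : T * k.-tuple T => (f (p.1 :: p.2))%:E).
  exact: (measurable_fun_cons (mseqEFin (k := k.+1) mf)).
have Lz s : size s = k -> L1 P (fun z => f (z :: s)).
  move=> sk; apply: (@L1_bounded _ _ _ _ _ 1%R); last first.
    by move=> z; rewrite ger0_norm//; have /andP[] := f01 (z :: s).
  have -> : (fun z => f (z :: s)) =
     (fun p : T * k.-tuple T => f (p.1 :: p.2)) \o (fun z => (z, Tuple (introT eqP sk))) by [].
  apply: measurableT_comp; first exact/measurable_EFinP.
  by apply: measurable_fun_pair.
split.
  rewrite /Rintegral; congr fine; rewrite integral_iid_law; last 2 first.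
  - exact: mseqEFin.
  - by move=> D; rewrite lee_fin.
  by apply: eq_integral => D _; rewrite EFin_Rintegral//; apply: Lz; rewrite size_tuple.
apply: measurableT_comp; first exact: fine_measurable.
apply: (@measurable_fun_fubini_tonelli_G _ _ _ _ _ P
    (fun p : T * k.-tuple T => (f (p.1 :: p.2))%:E)) => // p.
by rewrite lee_fin.
Qed.

(** Measurability of statistics defined by recursion on the sample, such as [pairsum]. *)
Lemma mseq_cons_ind (f : seq T -> R) (g : seq T -> T -> R) :
  (forall k, measurable_fun setT (fun p : k.-tuple T * T => g p.1 p.2)) ->
  (forall z s, f (z :: s) = g s z + f s)%R -> mseq f.
Proof.
move=> mg fE; elim=> [|k ih].
  rewrite (_ : (fun D : 0.-tuple T => f D) = fun=> f [::]); last first.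
    by apply/funext => D; rewrite tuple0.
  exact: measurable_cst.
rewrite (_ : (fun D : k.+1.-tuple T => f D) =
   fun D : k.+1.-tuple T => (g [tuple of behead D] (thead D) + f [tuple of behead D])%R); last first.
  by apply/funext => D; rewrite {1}(tuple_eta D) fE.
have mb : measurable_fun setT (fun D : k.+1.-tuple T => [tuple of behead D]).
  exact: measurable_behead.
have mt : measurable_fun setT (fun D : k.+1.-tuple T => thead D) by exact: measurable_tnth.
apply: measurable_funD; last exact: (measurableT_comp ih mb).
exact: (measurableT_comp (mg k) (measurable_fun_pair mb mt)).
Qed.

Lemma mseq_sum (p : T -> R) : measurable_fun setT p ->
  mseq (fun s => \sum_(z <- s) p z)%R.
Proof.
move=> mp k; under eq_fun do rewrite big_tuple.
apply: measurable_sum => i.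
exact: (measurableT_comp mp (measurable_tnth i)).
Qed.

End iid_tonelli.

(** * Second and fourth moments of i.i.d. sums *)

Section iid_moments.
Context d (T : measurableType d) (R : realType) (P : probability T R).
Context (p : T -> R) (mp : measurable_fun setT p) (p4 : L1 P (fun z => p z ^+ 4))
  (p0 : \int[P]_z p z = 0).

Lemma L1_pow_le4 k : (k <= 4)%N -> L1 P (fun z => p z ^+ k).
Proof.
move=> k4; apply: (L1_le _ (L1D (L1_cst P 1) p4)); first by mfun.
move=> z; rewrite normrX -[p z ^+ 4]ger0_norm ?exprn_even_ge0// normrX.
have [z1|z1] := leP `|p z| 1.
  by apply: (@le_trans _ _ 1); [exact: exprn_ile1|rewrite lerDl exprn_ge0].
rewrite ler_wpDl// ler_weXn2l// ltW//.
Qed.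

Let s2 := \int[P]_z (p z ^+ 2).
Let s4 := \int[P]_z (p z ^+ 4).
Let s2_ge0 : 0 <= s2. Proof. by apply: Rint_ge0 => z; exact: sqr_ge0. Qed.
Let s4_ge0 : 0 <= s4. Proof. by apply: Rint_ge0 => z; exact: exprn_even_ge0. Qed.

Let mseq_sumX k : mseq (fun s => (\sum_(z <- s) p z) ^+ k).
Proof. by move=> n; apply: measurable_funX; exact: mseq_sum. Qed.

Lemma Eiid_sum_sqr k : (Eiid P k (fun s => (\sum_(z <- s) p z) ^+ 2)%R <= (k%:R * s2)%:E)%E.
Proof.
elim: k => [|k ih]; first by rewrite Eiid0// big_nil expr0n mul0r.
have L1 : L1 P p by rewrite (_ : p = fun z => p z ^+ 1); [exact: (L1_pow_le4 (k := 1))|apply/funext => z; rewrite expr1].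
have L2 := L1_pow_le4 (isT : 2 <= 4)%N.
apply: (le_trans (EiidS_le (g := fun s => s2 + (\sum_(z <- s) p z) ^+ 2) _ _ _ _ _)) => //.
- by move=> n; apply: measurable_funD => //; exact: mseq_sumX.
- by move=> s; exact: sqr_ge0.
- move=> s; set a := \sum_(z <- s) p z.
  have e : (fun z => (\sum_(z <- z :: s) p z) ^+ 2) =
     (fun z => p z ^+ 2 + (2 * a * p z + a ^+ 2)).
    by apply/funext => z; rewrite big_cons -/a; ring.
  split; first by rewrite e; apply: L1D => //; apply: L1D; [exact: L1Z|exact: L1_cst].
  rewrite e RintD//; last by apply: L1D; [exact: L1Z|exact: L1_cst].
  rewrite RintD//; [|exact: L1Z|exact: L1_cst].
  by rewrite RintZ// p0 mulr0 add0r Rint_cst.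
rewrite EiidD; [|by move=> n; exact: measurable_cst|exact: mseq_sumX|done|by move=> s; exact: sqr_ge0].
rewrite Eiid_cst (_ : k.+1%:R * s2 = s2 + k%:R * s2); last by rewrite -natr1; ring.
by rewrite EFinD leeD2l.
Qed.

Lemma Eiid_sum_pow4 k : (Eiid P k (fun s => (\sum_(z <- s) p z) ^+ 4)%R <=
  (4 * k%:R ^+ 2 * s2 ^+ 2 + 3 * k%:R * s4)%:E)%E.
Proof.
elim: k => [|k ih]; first by rewrite Eiid0// big_nil !expr0n /= !(mulr0, mul0r) addr0.
have L1 : L1 P p by rewrite (_ : p = fun z => p z ^+ 1); [exact: (L1_pow_le4 (k := 1))|apply/funext => z; rewrite expr1].
have L2 := L1_pow_le4 (isT : 2 <= 4)%N.
have L3 := L1_pow_le4 (isT : 3 <= 4)%N.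
apply: (le_trans (EiidS_le (g := fun s => (3 * s4 + 8 * s2 * (\sum_(z <- s) p z) ^+ 2) +
   (\sum_(z <- s) p z) ^+ 4) _ _ _ _ _)) => //.
- move=> n; apply: measurable_funD; last exact: mseq_sumX.
  apply: measurable_funD => //; apply: measurable_funM => //; exact: mseq_sumX.
- by move=> s; exact: exprn_even_ge0.
- move=> s; set a := \sum_(z <- s) p z.
  have e : (fun z => (\sum_(z <- z :: s) p z) ^+ 4) = (fun z => p z ^+ 4 +
      (4 * a * p z ^+ 3 + (6 * a ^+ 2 * p z ^+ 2 + (4 * a ^+ 3 * p z + a ^+ 4)))).
    by apply/funext => z; rewrite big_cons -/a; ring.
  split; first by rewrite e; do 2?[apply: L1D; [done|]]; apply: L1D => //;
    [exact: L1Z|apply: L1D; [exact: L1Z|apply: L1D; [exact: L1Z|exact: L1_cst]]].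
  apply: (@le_trans _ _ (\int[P]_z (3 * p z ^+ 4 + (8 * a ^+ 2 * p z ^+ 2 +
      (4 * a ^+ 3 * p z + a ^+ 4))))).
    apply: le_Rint.
    - by rewrite e; apply: L1D => //; apply: L1D; [exact: L1Z|apply: L1D; [exact: L1Z|apply: L1D; [exact: L1Z|exact: L1_cst]]].
    - by apply: L1D; [exact: L1Z|apply: L1D; [exact: L1Z|apply: L1D; [exact: L1Z|exact: L1_cst]]].
    (* The cubic cross term 4 a p^3 is absorbed by the square 2 (p (p - a))^2, which raises the
       coefficients of p^4 and a^2 p^2 from 1 and 6 to 3 and 8. The term in a^3 p stays, as it
       integrates to 0. *)
    - move=> z; rewrite big_cons -/a -subr_ge0.
      rewrite (_ : _ - _ = 2 * (p z * (p z - a)) ^+ 2); last by ring.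
      by rewrite mulr_ge0// sqr_ge0.
  rewrite RintD; [|exact: L1Z|by apply: L1D; [exact: L1Z|apply: L1D; [exact: L1Z|exact: L1_cst]]].
  rewrite RintD; [|exact: L1Z|by apply: L1D; [exact: L1Z|exact: L1_cst]].
  rewrite RintD; [|exact: L1Z|exact: L1_cst].
  by rewrite (RintZ _ p4) (RintZ _ L2) (RintZ _ L1) p0 mulr0 add0r Rint_cst -/s2 -/s4; lra.
have m8 : mseq (fun s => 8 * s2 * (\sum_(z <- s) p z) ^+ 2).
  by move=> n; apply: measurable_funM => //; exact: mseq_sumX.
have p8 s : 0 <= 8 * s2 * (\sum_(z <- s) p z) ^+ 2 by rewrite mulr_ge0 ?sqr_ge0// mulr_ge0.
rewrite EiidD; [|by move=> n; apply: measurable_funD => //; exact: m8|exact: mseq_sumX|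
  by move=> s; rewrite addr_ge0// mulr_ge0|by move=> s; exact: exprn_even_ge0].
rewrite EiidD; [|by move=> n; exact: measurable_cst|exact: m8|by move=> s; rewrite mulr_ge0|done].
rewrite Eiid_cst EiidZ; [|exact: mseq_sumX|by move=> s; exact: sqr_ge0|by rewrite mulr_ge0].
have h2 : ((8 * s2)%:E * Eiid P k (fun s => (\sum_(z <- s) p z) ^+ 2)%R <=
   (8 * s2 * (k%:R * s2))%:E)%E.
  by rewrite [leRHS]EFinM; apply: lee_wpmul2l; [rewrite lee_fin mulr_ge0|exact: Eiid_sum_sqr].
apply: (le_trans (leeD (leeD2l _ h2) ih)); rewrite -!EFinD lee_fin -natr1.
by have := sqr_ge0 s2; have : 0 <= k%:R :> R by []; nra.
Qed.

End iid_moments.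

(** * Gaussian averages *)

Section gauss.
Context (R : realType).
Local Notation mu := (@lebesgue_measure R).
Local Notation pdf := (normal_pdf (0 : R) 1).

Definition gE (F : R -> R) : R := \int[mu]_y (F y * pdf y).

Lemma normal_pdf_sd (m s x : R) : 0 < s -> normal_pdf m s x = pdf ((x - m) / s) / s.
Proof.
move=> s0; rewrite !normal_pdfE ?gt_eqF ?oner_eq0// /normal_peak /normal_fun.
rewrite subr0 expr1n -mulrnAr sqrtrM ?sqr_ge0// sqrtr_sqr gtr0_norm// invfM mul1r.
rewrite (_ : - ((x - m) / s) ^+ 2 / 2 = - (x - m) ^+ 2 / (s ^+ 2 *+ 2)).
  by rewrite [RHS]mulrC mulrA.
by rewrite -[in RHS]mulr_natr; field; rewrite gt_eqF.
Qed.

Lemma pdfE (x : R) : pdf x = normal_peak 1 * expR (- (x ^+ 2 / 2)).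
Proof.
by rewrite normal_pdfE ?oner_eq0// /normal_fun subr0 expr1n mulNr.
Qed.

Lemma pdf_gt0 (x : R) : 0 < pdf x.
Proof. by rewrite pdfE mulr_gt0 ?expR_gt0// normal_peak_gt0// oner_eq0. Qed.

(** Both sides are the joint density of a standard Gaussian pair with correlation [al], conditioned
    on one coordinate or the other; the exponent is symmetric in y and z. *)
Lemma pdf_rotation (al be y z : R) : 0 < be -> al ^+ 2 + be ^+ 2 = 1 ->
  pdf y * normal_pdf (al * y) be z = pdf z * normal_pdf (al * z) be y.
Proof.
move=> be0 h; rewrite (normal_pdf_sd (al * y))// (normal_pdf_sd (al * z))// !pdfE.
have e : expR (- (y ^+ 2 / 2)) * expR (- (((z - al * y) / be) ^+ 2 / 2)) =
    expR (- (z ^+ 2 / 2)) * expR (- (((y - al * z) / be) ^+ 2 / 2)).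
  rewrite -!expRD; congr expR; apply/eqP; rewrite -subr_eq0.
  rewrite (_ : _ - _ = (z ^+ 2 - y ^+ 2) * (al ^+ 2 + be ^+ 2 - 1) / (2 * be ^+ 2)).
    by rewrite h subrr mulr0 mul0r.
  by field; rewrite gt_eqF.
by rewrite !mulrA !(mulrAC _ (expR _) (normal_peak 1)) -!(mulrA _ (expR _) (expR _)) e.
Qed.

Lemma normal_pdf_affine (G : R -> R) (m s : R) : 0 < s -> continuous G ->
  (forall x, 0 <= G x) ->
  (\int[mu]_y (G (m + s * y) * pdf y)%:E =
   \int[mu]_z (G z * normal_pdf m s z)%:E)%E.
Proof.
move=> s0 cG G0.
pose F (z : R^o) := (z - m) / s.
have F'E : F^`()%classic = cst s^-1.
  apply/funext => z; rewrite /F derive1E deriveM// deriveD// derive_cst scaler0.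
  by rewrite add0r derive_id derive_cst addr0 scaler1.
rewrite (@increasing_ge0_integration_by_substitutionT _ F)//.
- apply: eq_integral => z _; rewrite F'E (normal_pdf_sd m)// !fctE /=.
  have -> : m + s * F z = z by rewrite /F mulrCA mulfV ?gt_eqF// mulr1 subrKC.
  by rewrite mulrA.
- by move=> x y xy; rewrite /F ltr_pM2r ?invr_gt0// ltrD2r.
- by rewrite F'E => ?; exact: cvg_cst.
- by rewrite F'E; exact: is_cvg_cst.
- by rewrite F'E; exact: is_cvg_cst.
- by apply/gt0_cvgMlNy; [rewrite invr_gt0|exact: cvg_addrr_Ny].
- by apply/gt0_cvgMly; [rewrite invr_gt0|exact: cvg_addrr].
- move=> x; apply: cvgM; last by apply: continuous_normal_pdf; rewrite oner_eq0.
  apply: (cvg_comp _ G); last exact: cG.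
  by apply: (@cvgD _ R^o); [exact: cvg_cst|apply: (@cvgM _ R^o); [exact: cvg_cst|exact: cvg_id]].
- by move=> x; rewrite mulr_ge0// ltW// pdf_gt0.
Qed.

(** For independent standard Gaussians, al Y + be Y' is again standard Gaussian. A substitution in
    the inner variable, Tonelli and the symmetry of the joint density leave a full normal mass to
    integrate, so no change of variables in the plane occurs. *)
Lemma ge0_integral_rotation (G : R -> R) (al be : R) :
  0 < be -> al ^+ 2 + be ^+ 2 = 1 -> continuous G -> (forall x, 0 <= G x) ->
  (\int[mu]_y \int[mu]_y' ((G (al * y + be * y') * pdf y') * pdf y)%:E =
   \int[mu]_z (G z * pdf z)%:E)%E.
Proof.
move=> be0 h cG G0.
have mpdf m s : measurable_fun setT (normal_pdf m s : R -> R) by exact: measurable_normal_pdf.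
have mG : measurable_fun setT G by exact: continuous_measurable_fun.
transitivity (\int[mu]_y \int[mu]_z (G z * (pdf y * normal_pdf (al * y) be z))%:E)%E.
  apply: eq_integral => y _.
  under eq_integral do rewrite EFinM muleC.
  rewrite ge0_integralZl_EFin//; last 3 first.
    by move=> y' _; rewrite lee_fin mulr_ge0// ltW// pdf_gt0.
    apply/measurable_EFinP; apply: measurable_funM; last exact: mpdf.
    by apply: (measurableT_comp mG); mfun.
    by rewrite ltW// pdf_gt0.
  rewrite normal_pdf_affine// -ge0_integralZl_EFin//; last 3 first.
    by move=> z _; rewrite lee_fin mulr_ge0// normal_pdf_ge0.
    by apply/measurable_EFinP; apply: measurable_funM => //; exact: mpdf.
    by rewrite ltW// pdf_gt0.
  by apply: eq_integral => z _; rewrite -EFinM mulrCA.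
rewrite (@fubini_tonelli _ _ _ _ _ mu mu (fun p => (G p.2 * (pdf p.1 * normal_pdf (al * p.1) be p.2))%:E)); last 2 first.
- have mpair : measurable_fun [set: R * R] (fun p : R * R => (p.2 - al * p.1) / be).
    apply: measurable_funM => //; apply: measurable_funB => //.
    by apply: measurable_funM.
  apply/measurable_EFinP/measurable_funM; first exact: (measurableT_comp mG measurable_snd).
  apply: measurable_funM; first exact: (measurableT_comp (mpdf 0 1) measurable_fst).
  rewrite (_ : (fun x => _) = (fun p : R * R => pdf ((p.2 - al * p.1) / be) / be)); last first.
    by apply/funext => p; rewrite (normal_pdf_sd (al * _)).
  by apply: measurable_funM => //; exact: (measurableT_comp (mpdf 0 1) mpair).
- by move=> p; rewrite lee_fin !mulr_ge0// normal_pdf_ge0.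
apply: eq_integral => z _.
transitivity (\int[mu]_y ((G z * pdf z)%:E * (normal_pdf (al * z) be y)%:E))%E.
  by apply: eq_integral => y _ /=; rewrite pdf_rotation// mulrA EFinM.
rewrite ge0_integralZl_EFin//.
- by rewrite integral_normal_pdf mule1.
- by move=> y _; rewrite lee_fin normal_pdf_ge0.
- by apply/measurable_EFinP; exact: mpdf.
- by rewrite mulr_ge0// normal_pdf_ge0.
Qed.

Lemma measurable_pdf : measurable_fun [set: measurableTypeR R] pdf.
Proof. exact: measurable_normal_pdf. Qed.

Lemma L1_pdf : L1 mu pdf.
Proof. exact: integrable_normal_pdf. Qed.

Lemma Rint_normal_pdf (m s : R) : \int[mu]_y normal_pdf m s y = 1.
Proof. by rewrite /Rintegral integral_normal_pdf. Qed.

Lemma L1_pow4_pdf : L1 mu (fun y => y ^+ 4 * pdf y).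
Proof.
apply: (@L1_le _ _ _ mu _ (fun y => 64 * normal_pdf 0 2 y)).
- by apply: measurable_funM; [mfun|exact: measurable_pdf].
- by apply: L1Z; exact: integrable_normal_pdf.
have sd2 y : normal_pdf (0 : R) 2 y = pdf (y / 2) / 2.
  by rewrite normal_pdf_sd// subr0.
move=> y; rewrite sd2 ger0_norm; last first.
  by rewrite mulr_ge0 ?exprn_even_ge0// ltW// pdf_gt0.
rewrite !pdfE; have := normal_peak_ge0 (1 : R); move: (normal_peak 1) => p p0.
(* The surplus exponent is split into two equal halves, each bounded by exp u >= 1 + u; the product
   32 (1 + 3 y^2 / 16)^2 exceeds y^4. *)
rewrite (_ : - (y ^+ 2 / 2) = - ((y / 2) ^+ 2 / 2) - (3 * y ^+ 2 / 16 + 3 * y ^+ 2 / 16)); last by field.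
rewrite expRD (expRN (_ / 16 + _)) (expRD (_ / 16)).
have e0 := expR_gt0 (- ((y / 2) ^+ 2 / 2)); move: (expR (- _)) e0 => E E0.
rewrite (_ : 64 * _ = p * (E * 32)); last by field.
rewrite (mulrCA (y ^+ 4)) ler_wpM2l// (mulrCA (y ^+ 4)) ler_wpM2l ?(ltW E0)//.
rewrite ler_pdivrMr ?mulr_gt0 ?expR_gt0//.
have := expR_ge1Dx (3 * y ^+ 2 / 16); have := sqr_ge0 y.
rewrite (_ : y ^+ 4 = (y ^+ 2) ^+ 2); last by ring.
by move: (y ^+ 2) (expR _) => t e t0 h; nra.
Qed.

Lemma L1_pdf_le (F : R -> R) : measurable_fun [set: R] F ->
  (exists c, forall y, `|F y| <= c * (1 + y ^+ 4)) -> L1 mu (fun y => F y * pdf y).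
Proof.
move=> mF [c hc]; apply: (@L1_le _ _ _ mu _ (fun y => c * (pdf y + y ^+ 4 * pdf y))).
- by apply: measurable_funM => //; exact: measurable_pdf.
- by apply: L1Z; apply: L1D; [exact: L1_pdf|exact: L1_pow4_pdf].
move=> y; rewrite normrM (gtr0_norm (pdf_gt0 _)) -[X in X + _ * _]mul1r -mulrDl mulrA.
by rewrite ler_wpM2r// ltW// pdf_gt0.
Qed.

Lemma gE_cst (c : R) : gE (fun=> c) = c.
Proof.
rewrite /gE RintZ; last exact: L1_pdf.
by rewrite Rint_normal_pdf mulr1.
Qed.

(* Integrate the tangent line bound exp u >= 1 + u over the density of N(t, 1) and let t
   have the sign of the mean. *)
Lemma gE_id : gE id = 0.
Proof.
have L : L1 mu (fun y => y * pdf y).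
  apply: L1_pdf_le; first exact: measurable_id.
  by exists 1 => y; rewrite mul1r ler_norml; apply/andP; split;
    have := sqr_ge0 (y ^+ 2 - 1); have := sqr_ge0 (y - 1); have := sqr_ge0 (y + 1);
    rewrite (_ : y ^+ 4 = (y ^+ 2) ^+ 2); [nra|ring|nra|ring].
have key t : t * gE id <= t ^+ 2 / 2.
  have : \int[mu]_y (pdf y - t ^+ 2 / 2 * pdf y + t * (y * pdf y)) <=
         \int[mu]_y normal_pdf t 1 y.
    apply: le_Rint.
    - by apply: L1D; [apply: L1B; [|apply: L1Z]; exact: L1_pdf|exact: L1Z].
    - exact: integrable_normal_pdf.
    move=> y; rewrite (normal_pdf_sd t)// divr1 divr1 !pdfE.
    rewrite (_ : - ((y - t) ^+ 2 / 2) = - (y ^+ 2 / 2) + (t * y - t ^+ 2 / 2)); last by field.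
    rewrite expRD; have := expR_ge1Dx (t * y - t ^+ 2 / 2).
    have : 0 <= normal_peak (1 : R) * expR (- (y ^+ 2 / 2)).
      by rewrite mulr_ge0// ?expR_ge0// normal_peak_ge0.
    rewrite [X in _ -> _ -> _ <= X]mulrA.
    move: (normal_peak 1 * expR _) (expR (_ - _)) => A B A0 AB; nra.
  rewrite RintD; last 2 first.
  - by apply: L1B; [|apply: L1Z]; exact: L1_pdf.
  - exact: L1Z.
  rewrite RintB; [|exact: L1_pdf|by apply: L1Z; exact: L1_pdf].
  rewrite !RintZ//; last exact: L1_pdf.
  rewrite !Rint_normal_pdf; have -> : \int[mu]_x (x * pdf x) = gE id by [].
  lra.
have [h|h|//] := ltgtP (gE id) 0.
  by have := key (gE id); nra.
by have := key (gE id); nra.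
Qed.

(* The same comparison with the density of N(0, 1/r^2), for r slightly below and above 1. *)
Lemma gE_sqr : gE (fun y => y ^+ 2) = 1.
Proof.
have L : L1 mu (fun y => y ^+ 2 * pdf y).
  apply: L1_pdf_le; first by mfun; exact: measurable_id.
  exists 1 => y; rewrite mul1r ger0_norm ?sqr_ge0//.
  by have := sqr_ge0 (y ^+ 2 - 1); rewrite (_ : y ^+ 4 = (y ^+ 2) ^+ 2); [nra|ring].
set m2 := gE _.
have key r : 0 < r -> 1 - (r ^+ 2 - 1) / 2 * m2 <= r^-1.
  move=> r0.
  have sd y : normal_pdf (0 : R) r^-1 y = pdf (y * r) * r.
    by rewrite normal_pdf_sd ?invr_gt0// subr0 invrK.
  have : \int[mu]_y (pdf y - (r ^+ 2 - 1) / 2 * (y ^+ 2 * pdf y)) <=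
         \int[mu]_y (r^-1 * normal_pdf 0 r^-1 y).
    apply: le_Rint.
    - by apply: L1B; [exact: L1_pdf|exact: L1Z].
    - by apply: L1Z; exact: integrable_normal_pdf.
    move=> y; rewrite sd (_ : r^-1 * _ = pdf (y * r)); last by field; rewrite gt_eqF.
    rewrite !pdfE.
    rewrite (_ : - ((y * r) ^+ 2 / 2) = - (y ^+ 2 / 2) + - ((r ^+ 2 - 1) / 2 * y ^+ 2)); last by field.
    rewrite expRD; have := expR_ge1Dx (- ((r ^+ 2 - 1) / 2 * y ^+ 2)).
    have : 0 <= normal_peak (1 : R) * expR (- (y ^+ 2 / 2)).
      by rewrite mulr_ge0// ?expR_ge0// normal_peak_ge0.
    rewrite [X in _ -> _ -> _ <= X]mulrA.
    move: (normal_peak 1 * expR (- (y ^+ 2 / 2))) (expR (- (_ * y ^+ 2))) => A B A0 AB; nra.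
  rewrite RintB; [|exact: L1_pdf|exact: L1Z].
  rewrite !RintZ//; last exact: integrable_normal_pdf.
  by rewrite !Rint_normal_pdf mulr1.
have lo r : 1 < r -> 2 <= m2 * (r * (r + 1)).
  move=> r1; have r0 : 0 < r by lra.
  have := key r r0; rewrite -(ler_pM2l r0) mulfV ?gt_eqF// => h.
  rewrite -(@ler_pM2l _ (r - 1)) ?subr_gt0//; lra.
have up r : 0 < r < 1 -> m2 * (r * (r + 1)) <= 2.
  move=> /andP[r0 r1].
  have := key r r0; rewrite -(ler_pM2l r0) mulfV ?gt_eqF// => h.
  rewrite -(@ler_pM2l _ (1 - r)) ?subr_gt0//; lra.
have m0 : 0 <= m2 by have := lo 2; lra.
apply/eqP; rewrite eq_le; apply/andP; split.
- rewrite leNgt; apply/negP => h; pose r := 1 - (1 - m2^-1) / 2.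
  have m2V : m2 * m2^-1 = 1 by rewrite mulfV// gt_eqF// (lt_trans ltr01).
  have V1 : m2^-1 < 1 by rewrite invf_lt1// (lt_trans ltr01).
  have V0 : 0 < m2^-1 by rewrite invr_gt0 (lt_trans ltr01).
  have := up r; rewrite (_ : 0 < r < 1); last by rewrite /r; apply/andP; split; lra.
  move=> /(_ isT); apply/negP; rewrite -ltNge /r.
  move: (m2^-1) m2V V1 V0 => v m2V V1 V0; nra.
- rewrite leNgt; apply/negP => h; pose r := 1 + (1 - m2) / 4.
  have := lo r; rewrite /r; rewrite (_ : 1 < _); last by lra.
  by move=> /(_ isT); nra.
Qed.

Lemma L1_pdf_bounded (F : R -> R) c : measurable_fun [set: R] F ->
  (forall y, `|F y| <= c) -> L1 mu (fun y => F y * pdf y).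
Proof.
move=> mF hc; apply: L1_pdf_le => //; exists c => y.
have c0 : 0 <= c := le_trans (normr_ge0 _) (hc y).
by rewrite (le_trans (hc y))// ler_peMr// lerDl exprn_even_ge0.
Qed.

Lemma gE_ge0 (F : R -> R) : (forall y, 0 <= F y) -> 0 <= gE F.
Proof. by move=> F0; apply: Rint_ge0 => y; rewrite mulr_ge0// ltW// pdf_gt0. Qed.

Lemma gE_norm_le (F : R -> R) c : measurable_fun [set: R] F ->
  (forall y, `|F y| <= c) -> `|gE F| <= c.
Proof.
move=> mF hc; rewrite -(gE_cst c); apply: le_norm_Rint.
- exact: L1_pdf_bounded hc.
- by apply: L1Z; exact: L1_pdf.
by move=> y; rewrite normrM (gtr0_norm (pdf_gt0 _)) ler_wpM2r// ltW// pdf_gt0.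
Qed.

(** [a] and [b] stand for the first two derivatives at x. Stated as inequalities, the property
    survives Gaussian averaging with the same K, without differentiation under the integral. *)
Definition taylor_at (K : R) (F : R -> R) (x a b : R) :=
  [/\ `|a| <= K, `|b| <= K &
   forall y, `|F (x + y) - F x - a * y - b / 2 * y ^+ 2| <= K * `|y| ^+ 3].

(** The heat semigroup, indexed by standard deviation rather than variance. *)
Definition gavg (s : R) (F : R -> R) (x : R) : R := gE (fun y => F (x + s * y)).

Lemma taylor_continuous K F : (forall x, exists a b, taylor_at K F x a b) ->
  continuous F.
Proof.
move=> h x; have [a [b [ha hb hF]]] := h x.
have K0 : 0 <= K := le_trans (normr_ge0 _) ha.
have lip y : `|y| <= 1 -> `|F (x + y) - F x| <= 3 * K * `|y|.
  move=> y1; have h3 := hF y; have y0 : 0 <= `|y| by [].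
  have h1 : `|a * y| <= K * `|y| by rewrite normrM ler_wpM2r.
  have h2 : `|b / 2 * y ^+ 2| <= K * `|y|.
    rewrite normrM normrX normrM normfV (ger0_norm (_ : 0 <= 2))//.
    move: (`|y|) (`|b|) (normr_ge0 b) hb y0 y1 => t B B0 hB t0 t1.
    have p1 : 0 <= (K - B) * t by rewrite mulr_ge0// subr_ge0.
    have p2 : 0 <= B * (t * (1 - t)) by rewrite !mulr_ge0// subr_ge0.
    have p3 : 0 <= B * t by rewrite mulr_ge0.
    by nra.
  have h4 : K * `|y| ^+ 3 <= K * `|y|.
    rewrite ler_wpM2l// exprS ler_piMr// expr_le1//.
  move: h1 h2 h3; rewrite !ler_norml => /andP[? ?] /andP[? ?] /andP[? ?].
  by apply/andP; split; lra.
apply/cvgrPdist_le => e e0; apply/nbhs_normP; exists (Num.min 1 (e / (3 * K + 1))) => /=.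
  by rewrite lt_min ltr01 divr_gt0// ltr_wpDl// mulr_ge0.
move=> z /=; rewrite lt_min => /andP[z1 z2].
have := lip (z - x); rewrite subrKC (distrC z x) (distrC (F z)) => /(_ (ltW z1)) h'.
rewrite (le_trans h')//.
move: z2; rewrite ltr_pdivlMr; last by rewrite ltr_wpDl// mulr_ge0.
by have := normr_ge0 (x - z); lra.
Qed.

Lemma gavg_taylor K (F F1 F2 : R -> R) s x :
  measurable_fun [set: R] F -> measurable_fun [set: R] F1 ->
  measurable_fun [set: R] F2 -> (forall z, `|F z| <= 1) ->
  (forall z, taylor_at K F z (F1 z) (F2 z)) ->
  taylor_at K (gavg s F) x (gavg s F1 x) (gavg s F2 x).
Proof.
move=> mF mF1 mF2 F01 hF.
have mc (G : R -> R) z : measurable_fun [set: R] G -> measurable_fun [set: R] (fun y : R => G (z + s * y)).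
  by move=> mG; apply: (measurableT_comp mG); mfun.
have b1 z : `|F1 z| <= K by have [] := hF z.
have b2 z : `|F2 z| <= K by have [] := hF z.
split; [apply: gE_norm_le => //; exact: mc|apply: gE_norm_le => //; exact: mc|].
move=> y; rewrite /gavg.
have I0 z : L1 mu (fun u => F (z + s * u) * pdf u).
  by apply: (@L1_pdf_bounded _ 1) => //; exact: mc.
have I1 : L1 mu (fun u => F1 (x + s * u) * pdf u).
  by apply: (@L1_pdf_bounded _ K) => //; exact: mc.
have I2 : L1 mu (fun u => F2 (x + s * u) * pdf u).
  by apply: (@L1_pdf_bounded _ K) => //; exact: mc.
have -> : gE (fun u => F (x + y + s * u)) - gE (fun u => F (x + s * u)) -
   gE (fun u => F1 (x + s * u)) * y - gE (fun u => F2 (x + s * u)) / 2 * y ^+ 2 =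
   gE (fun u => F (x + y + s * u) - F (x + s * u) - F1 (x + s * u) * y
       - F2 (x + s * u) / 2 * y ^+ 2).
  rewrite /gE.
  transitivity (\int[mu]_u (F (x + y + s * u) * pdf u - F (x + s * u) * pdf u
     - y * (F1 (x + s * u) * pdf u) - y ^+ 2 / 2 * (F2 (x + s * u) * pdf u))); last first.
    by apply: eq_Rint => u; ring.
  rewrite RintB; [|by apply: L1B; [exact: L1B|exact: L1Z]|exact: L1Z].
  rewrite RintB; [|exact: L1B|exact: L1Z].
  rewrite RintB// !RintZ//; ring.
apply: gE_norm_le.
  apply: measurable_funB; [apply: measurable_funB; [apply: measurable_funB|]|].
  - exact: mc.
  - exact: mc.
  - by apply: measurable_funM => //; exact: mc.
  - by apply: measurable_funM => //; apply: measurable_funM => //; exact: mc.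
move=> u; have [_ _ h] := hF (x + s * u); have := h y.
by rewrite (_ : x + s * u + y = x + y + s * u)//; ring.
Qed.

(** Variances of independent Gaussians add: rotate with coefficients v / r and s / r. The rotation
    needs the second one positive, hence the separate case s = 0. *)
Lemma gavg_semigroup (F : R -> R) x v s : continuous F -> (forall z, 0 <= F z <= 1) ->
  0 <= v -> 0 <= s ->
  gE (fun y => gavg s F (x + v * y)) = gavg (Num.sqrt (s ^+ 2 + v ^+ 2)) F x.
Proof.
move=> cF F01 v0; rewrite le_eqVlt => /predU1P[<-|s0].
  rewrite expr0n add0r sqrtr_sqr ger0_norm// /gavg; congr gE; apply/funext => y.
  rewrite -[RHS]gE_cst; congr gE; apply/funext => z.
  by rewrite mul0r addr0.
set r := Num.sqrt _.
have r0 : 0 < r by rewrite sqrtr_gt0 ltr_pwDl ?exprn_gt0// sqr_ge0.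
have r2 : r ^+ 2 = s ^+ 2 + v ^+ 2 by rewrite sqr_sqrtr// addr_ge0 ?sqr_ge0.
have F0 z : 0 <= F z by have /andP[] := F01 z.
have mF : measurable_fun [set: R] F by exact: continuous_measurable_fun.
have mc z t : measurable_fun [set: R] (fun y => F (z + t * y)).
  by apply: (measurableT_comp mF); mfun.
have F1 z : `|F z| <= 1 by have /andP[? ?] := F01 z; rewrite ger0_norm.
have LF z t : L1 mu (fun y => F (z + t * y) * pdf y).
  exact: (@L1_pdf_bounded _ 1).
have cG : continuous (fun z => F (x + r * z)).
  move=> z; apply: (cvg_comp (fun z => x + r * z) F); last exact: cF.
  by apply: (@cvgD _ R^o); [exact: cvg_cst|apply: (@cvgM _ R^o); [exact: cvg_cst|exact: cvg_id]].
have s1 : (v / r) ^+ 2 + (s / r) ^+ 2 = 1.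
  by rewrite !expr_div_n -mulrDl addrC -r2 mulfV// gt_eqF// exprn_gt0.
have := ge0_integral_rotation (divr_gt0 s0 r0) s1 cG (fun z => F0 _).
rewrite (EFin_Rintegral (LF _ _)) => h.
rewrite /gavg /gE /Rintegral; congr fine.
rewrite (EFin_Rintegral (LF _ _)) -h; apply: eq_integral => y _.
rewrite EFinM [X in (X * _)%E](esym (EFin_Rintegral (LF (x + v * y) s))) -ge0_integralZr//.
- apply: eq_integral => z _; rewrite -EFinM; congr (F _ * _ * _)%:E.
  by field; rewrite gt_eqF.
- by apply/measurable_EFinP; apply: measurable_funM; [exact: mc|exact: measurable_pdf].
- by move=> z _; rewrite lee_fin mulr_ge0// normal_pdf_ge0.
- by rewrite lee_fin normal_pdf_ge0.
Qed.

Lemma gE_le (F G : R -> R) c : measurable_fun [set: R] F -> measurable_fun [set: R] G ->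
  (forall y, 0 <= F y) -> (forall y, F y <= G y) ->
  (forall y, G y <= c * (1 + y ^+ 4)) -> gE F <= gE G.
Proof.
move=> mF mG F0 FG Gc; apply: le_Rint.
- apply: L1_pdf_le => //; exists c => y; rewrite ger0_norm//.
  exact: le_trans (FG y) (Gc y).
- apply: L1_pdf_le => //; exists c => y; rewrite ger0_norm//.
  exact: le_trans (F0 y) (FG y).
by move=> y; rewrite ler_wpM2r// ltW// pdf_gt0.
Qed.

Lemma measurable_indicR (V : set R) : measurable V -> measurable_fun [set: R] (\1_V : R -> R).
Proof. by move=> mV; exact: measurable_indic. Qed.

Lemma normal_prob_gE (V : set R) : measurable V -> normal_prob (0 : R) 1 V = (gE \1_V)%:E.
Proof.
move=> mV; rewrite /normal_prob integral_mkcond/= /gE -EFin_Rintegral; last first.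
  apply: (@L1_pdf_bounded _ 1); first exact: measurable_indicR.
  by move=> y; rewrite indicE; case: (_ \in _); rewrite ?normr1 ?normr0.
apply: eq_integral => y _; rewrite patchE indicE.
by case: ifPn => _; rewrite ?mul1r ?mul0r.
Qed.

Lemma pdf_le1 (y : R) : pdf y <= 1.
Proof.
rewrite (le_trans (normal_pdf_ub _ _ _)) ?oner_eq0// /normal_peak invf_le1; last first.
  by rewrite sqrtr_gt0 expr1n mul1r mulrn_wgt0// pi_gt0.
rewrite -[leLHS]sqrtr1 ler_wsqrtr// expr1n mul1r mulr2n.
by have := pi_ge2 R; lra.
Qed.

Lemma gE_itv_le (a b : R) : a <= b -> gE \1_`]a, b] <= b - a.
Proof.
move=> ab; rewrite -lee_fin -normal_prob_gE// /normal_prob.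
apply: (@le_trans _ _ (\int[mu]_(x in `]a, b]) (cst 1%E x))%E).
  apply: ge0_le_integral => //.
  - by move=> y _; rewrite lee_fin normal_pdf_ge0.
  - by apply/measurable_EFinP; apply: measurable_funTS; exact: measurable_pdf.
  - by move=> y _; rewrite lee_fin pdf_le1.
rewrite integral_cst// [X in (_ * X)%E](@lebesgue_measure_itv R `]a, b]) /= mul1e lte_fin.
by case: ifPn => _; rewrite ?lee_fin ?subr_ge0.
Qed.

Lemma gE_tail_le (V : set R) (a : R) : measurable V -> 0 < a ->
  (forall y, V y -> a <= `|y|) -> gE \1_V <= a ^- 2.
Proof.
move=> mV a0 hV; rewrite -[leRHS]mulr1 -gE_sqr.
have -> : a ^- 2 * gE (fun y => y ^+ 2) = gE (fun y => a ^- 2 * y ^+ 2).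
  rewrite /gE -RintZ; first by apply: eq_Rint => y; rewrite mulrA.
  apply: L1_pdf_le; first by mfun.
  exists 1 => y; rewrite mul1r ger0_norm ?sqr_ge0//.
  by have := sqr_ge0 (y ^+ 2 - 1); rewrite (_ : y ^+ 4 = (y ^+ 2) ^+ 2); [nra|ring].
apply: (@gE_le _ _ (a ^- 2)).
- exact: measurable_indicR.
- by mfun.
- by move=> y; rewrite indicE.
- move=> y; rewrite indicE; case: (boolP (y \in V)) => [|_]; last first.
    by rewrite mulr_ge0 ?sqr_ge0// invr_ge0 sqr_ge0.
  rewrite inE => /hV ay; rewrite mulrC ler_pdivlMr ?exprn_gt0// mul1r.
  rewrite -[leRHS](real_normK (num_real y)); exact: lerXn2r (ltW a0) _ ay.
- move=> y; apply: ler_wpM2l; first by rewrite invr_ge0 sqr_ge0.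
  by have := sqr_ge0 (y ^+ 2 - 1); rewrite (_ : y ^+ 4 = (y ^+ 2) ^+ 2); [nra|ring].
Qed.

(** The set behind [gauss_quantile] must be nonempty and bounded below for its [inf] to mean
    anything; both follow from the second-moment tail bound. A point strictly above the infimum
    dominates some member of the set, so continuity of the distribution function does not enter. *)
Lemma quantile_ge (p x : R) : 0 < p < 1 -> gauss_quantile p < x ->
  p <= gE \1_`]-oo, x].
Proof.
move=> /andP[p0 p1] qx.
pose S := [set x : R | (p%:E <= normal_prob (0 : R) 1 `]-oo, x])%E].
have lo y : 0 < y -> p <= gE \1_`]-oo, - y] -> y ^+ 2 <= p^-1.
  move=> y0 h; rewrite -[leLHS]invrK lef_pV2 ?posrE ?invr_gt0 ?exprn_gt0//.
  apply: (le_trans h); apply: gE_tail_le => // z /=; rewrite in_itv/= => zy.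
  by rewrite ler_normr lerNr zy orbT.
have S0 : S !=set0.
  (* Chosen so that y^-2 = 1 - p, the allowed upper tail. *)
  pose y := Num.sqrt (1 - p)^-1.
  have y0 : 0 < y by rewrite sqrtr_gt0 invr_gt0 subr_gt0.
  exists y; rewrite /S /= normal_prob_gE// lee_fin.
  have : gE \1_`]y, +oo[ <= y ^- 2.
    apply: gE_tail_le => // z /=; rewrite in_itv/= andbT => yz.
    by rewrite ler_normr ltW.
  rewrite sqr_sqrtr ?invrK; last by rewrite invr_ge0 subr_ge0 ltW.
  have : (normal_prob (0 : R) 1 `]-oo, y] + normal_prob (0 : R) 1 `]y, +oo[ = 1)%E.
    rewrite -measureU//; last first.
      by rewrite -subset0 => z [] /=; rewrite !in_itv/= andbT leNgt => /negP.
    rewrite -setCitvl setUv; exact: probability_setT.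
  by rewrite !normal_prob_gE// -EFinD => -[] ? ?; lra.
have Slb : has_lbound S.
  exists (- (p^-1 + 1)) => z; rewrite /S /= normal_prob_gE// lee_fin => h.
  rewrite leNgt; apply/negP => zlt.
  have p10 : 0 < p^-1 by rewrite invr_gt0.
  have := @lo (- z); rewrite opprK => /(_ _ h); nra.
have xq : 0 < x - gauss_quantile p by rewrite subr_gt0.
have [y Sy yx] := inf_adherent xq (conj S0 Slb).
move: Sy yx; rewrite /S /= normal_prob_gE// lee_fin subrKC => Sy yx.
apply: (le_trans Sy); apply: (@gE_le _ _ 1); try exact: measurable_indicR.
- by move=> z; rewrite indicE.
- move=> z; rewrite !indicE !mem_setE !in_itv/=; case: (boolP (z <= y)) => [zy|//].
  by rewrite (le_trans zy (ltW yx)).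
- move=> z; rewrite indicE mul1r; have : (0 : R) <= z ^+ 4 by rewrite exprn_even_ge0.
  by case: (_ \in _) => /= ?; lra.
Qed.

Lemma gE_affine_comb (A B : R -> R) : L1 mu (fun y => A y * pdf y) ->
  L1 mu (fun y => B y * pdf y) -> gE (fun y => A y + (1 - B y)) = gE A + (1 - gE B).
Proof.
move=> LA LB; rewrite /gE.
transitivity (\int[mu]_y (A y * pdf y + (pdf y - B y * pdf y))).
  by apply: eq_Rint => y; ring.
rewrite RintD//; last by apply: L1B => //; exact: L1_pdf.
by rewrite RintB//; [rewrite Rint_normal_pdf|exact: L1_pdf].
Qed.

(** F is dominated by the indicator of the window of half-width [de] around the quantile plus that
    of the tail beyond it. The density is at most 1, so the window has mass at most 2 de. *)
Lemma quantile_tail (p de : R) (F : R -> R) : 0 < p < 1 -> 0 < de ->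
  measurable_fun [set: R] F -> (forall x, 0 <= F x <= 1) ->
  (forall x, x <= gauss_quantile p - de -> F x = 0) -> gE F <= 1 - p + 2 * de.
Proof.
move=> p01 de0 mF F01 F0; set q := gauss_quantile p in F0 *.
have := quantile_ge p01 (_ : q < q + de); rewrite ltrDl de0 => /(_ isT) h.
have h2 : gE \1_`]q - de, q + de] <= 2 * de by apply: le_trans (gE_itv_le _) _; lra.
have LI V : measurable V -> L1 mu (fun y => (\1_V y : R) * pdf y).
  move=> mV; apply: (@L1_pdf_bounded _ 1); first exact: measurable_indicR.
  by move=> y; rewrite indicE; case: (_ \in _); rewrite ?normr1 ?normr0.
have : gE F <= gE (fun y => \1_`]q - de, q + de] y + (1 - \1_`]-oo, q + de] y)).
  apply: (@gE_le _ _ 2) => //.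
  - apply: measurable_funD; first exact: measurable_indicR.
    by apply: measurable_funB => //; exact: measurable_indicR.
  - by move=> y; have /andP[] := F01 y.
  - move=> y; rewrite !indicE !mem_setE !in_itv/=; have /andP[Fy0 Fy1] := F01 y.
    case: (ltP (q - de) y) => hy /=; last by rewrite F0// (le_trans hy) ?subrr ?addr0//; lra.
    by case: (y <= q + de); lra.
  - move=> y; rewrite !indicE; have : (0 : R) <= y ^+ 4 by rewrite exprn_even_ge0.
    by case: (_ \in _); case: (_ \in _) => /= ?; lra.
rewrite gE_affine_comb; [|exact: LI|exact: LI].
lra.
Qed.

End gauss.

(** * Moments of degenerate kernels *)

Section kernel_moments.
Context d (T : measurableType d) (R : realType) (P : probability T R).
Context (I : finType) (w : I -> R) (e : I -> T -> R) (lam om kap : R).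

Definition ip (b : I -> R) z := \sum_i b i * e i z.
Definition sqnorm z := \sum_i e i z ^+ 2.
Definition n2 (b : I -> R) := \sum_i b i ^+ 2.
Definition cov i j := \int[P]_z (e i z * e j z).
(** A degenerate kernel, written as the linear form [ip] with coefficients frozen at z, so that all
    bounds for linear forms apply to it. *)
Definition ker z := ip (fun i => w i * e i z).
Definition kersum (s : seq T) := ip (fun i => w i * \sum_(z <- s) e i z).
(** The second moment of the kernel at two independent points, that is, its squared Hilbert-Schmidt
    norm; see [int_kervar]. *)
Definition hs2 := \sum_i \sum_j w i * w j * cov i j ^+ 2.

Context (me : forall i, measurable_fun setT (e i))
  (Ine : L1 P (fun z => sqnorm z ^+ 2)) (hkap : \int[P]_z (sqnorm z ^+ 2) <= kap)
  (e_mean : forall i, \int[P]_z e i z = 0)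
  (lam0 : 0 <= lam) (om0 : 0 <= om)
  (hlam : forall b, \int[P]_z (ip b z ^+ 2) <= lam * n2 b)
  (hom : forall i, `|w i| <= om).

Lemma measurable_ip b : measurable_fun setT (ip b).
Proof. by apply: measurable_sum => i; mfun; exact: me. Qed.

Lemma ip_sqr_le b z : ip b z ^+ 2 <= n2 b * sqnorm z.
Proof. exact: sum_cauchy_schwarz. Qed.

Lemma n2_ge0 b : 0 <= n2 b.
Proof. by apply: sumr_ge0 => i _; exact: sqr_ge0. Qed.

Lemma sqnorm_ge0 z : 0 <= sqnorm z.
Proof. by apply: sumr_ge0 => i _; exact: sqr_ge0. Qed.

Lemma ip_pow4_le b z : ip b z ^+ 4 <= n2 b ^+ 2 * sqnorm z ^+ 2.
Proof.
rewrite (_ : ip b z ^+ 4 = (ip b z ^+ 2) ^+ 2); last by ring.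
by rewrite -exprMn; apply: lerXn2r (ip_sqr_le _ _); rewrite nnegrE ?sqr_ge0// mulr_ge0// ?n2_ge0// sqnorm_ge0.
Qed.

Lemma L1_ip4 b : L1 P (fun z => ip b z ^+ 4).
Proof.
apply: (L1_le _ (L1Z (n2 b ^+ 2) Ine)).
  by apply: measurable_funX; exact: measurable_ip.
by move=> z; rewrite ger0_norm ?exprn_even_ge0//; exact: ip_pow4_le.
Qed.

Lemma int_ip4_le b : \int[P]_z (ip b z ^+ 4) <= n2 b ^+ 2 * kap.
Proof.
apply: (@le_trans _ _ (\int[P]_z (n2 b ^+ 2 * sqnorm z ^+ 2))).
  by apply: le_Rint; [exact: L1_ip4|exact: L1Z|move=> z; exact: ip_pow4_le].
by rewrite RintZ// ler_wpM2l// sqr_ge0.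
Qed.

Lemma L1_ip2 b : L1 P (fun z => ip b z ^+ 2).
Proof. exact: (L1_pow_le4 (measurable_ip b) (L1_ip4 b)). Qed.

Lemma ip_delta i : e i = ip (fun j => (j == i)%:R).
Proof.
apply/funext => z; rewrite /ip (bigD1 i)//= eqxx mul1r big1 ?addr0// => j /negbTE ->.
by rewrite mul0r.
Qed.

Lemma L1_e2 i : L1 P (fun z => e i z ^+ 2).
Proof. by rewrite (ip_delta i); exact: L1_ip2. Qed.

Lemma L1_e i : L1 P (e i).
Proof. exact: (L1_sqr (me i) (L1_e2 i)). Qed.

Lemma L1_ip b : L1 P (ip b).
Proof. exact: (L1_sqr (measurable_ip b) (L1_ip2 b)). Qed.

Lemma int_ip b : \int[P]_z ip b z = 0.
Proof.
rewrite Rintegral_sum; last by move=> i; apply: L1Z; exact: L1_e.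
by rewrite big1// => i _; rewrite RintZ; [rewrite e_mean mulr0|exact: L1_e].
Qed.

Lemma L1_ipM b b' : L1 P (fun z => ip b z * ip b' z).
Proof. by apply: L1M_sqr; [exact: measurable_ip|exact: measurable_ip|exact: L1_ip2|exact: L1_ip2]. Qed.

Lemma L1_ip_e b i : L1 P (fun z => ip b z * e i z).
Proof. by rewrite (ip_delta i); exact: L1_ipM. Qed.

Lemma int_ip_ip b b' : \int[P]_z (ip b z * ip b' z) =
  \sum_i b' i * \int[P]_z (ip b z * e i z).
Proof.
transitivity (\int[P]_z \sum_i (b' i * (ip b z * e i z))).
  apply: eq_Rint => z; rewrite {2}/ip mulr_sumr; apply: eq_bigr => i _; ring.
rewrite Rintegral_sum; last by move=> i; apply: L1Z; exact: L1_ip_e.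
by apply: eq_bigr => i _; rewrite RintZ//; exact: L1_ip_e.
Qed.

Lemma int_ip_e b i : \int[P]_z (ip b z * e i z) = \sum_j b j * cov i j.
Proof.
transitivity (\int[P]_z \sum_j (b j * (e i z * e j z))).
  apply: eq_Rint => z; rewrite {1}/ip mulr_suml; apply: eq_bigr => j _; ring.
have L j : L1 P (fun z => e i z * e j z) by rewrite (ip_delta i); exact: L1_ip_e.
rewrite Rintegral_sum; last by move=> j; apply: L1Z.
by apply: eq_bigr => j _; rewrite RintZ.
Qed.

Lemma int_ip2E b : \int[P]_z (ip b z ^+ 2) = \sum_i \sum_j b i * b j * cov i j.
Proof.
rewrite (eq_Rint (fun z => ip b z * ip b z)); last by move=> z; rewrite expr2.
rewrite int_ip_ip; apply: eq_bigr => i _; rewrite int_ip_e mulr_sumr.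
by apply: eq_bigr => j _; rewrite mulrA.
Qed.

Lemma n2_wM b : n2 (fun i => w i * b i) <= om ^+ 2 * n2 b.
Proof.
rewrite /n2 mulr_sumr; apply: ler_sum => i _; rewrite exprMn ler_wpM2r ?sqr_ge0//.
by rewrite -(real_normK (num_real (w i))) lerXn2r.
Qed.

Lemma int_ip2_ge0 b : 0 <= \int[P]_z (ip b z ^+ 2).
Proof. by apply: Rint_ge0 => z; exact: sqr_ge0. Qed.

Definition kervar z := \int[P]_z' (ker z z' ^+ 2).
(** Conditional variance, given the sample s, of the term that one more observation adds to the pair
    sum. *)
Definition sumvar s := \int[P]_z (kersum s z ^+ 2).

Lemma kervar_ge0 z : 0 <= kervar z. Proof. exact: int_ip2_ge0. Qed.
Lemma sumvar_ge0 s : 0 <= sumvar s. Proof. exact: int_ip2_ge0. Qed.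

Lemma kervar_le z : kervar z <= lam * om ^+ 2 * sqnorm z.
Proof.
rewrite (le_trans (hlam _))// -mulrA ler_wpM2l//.
exact: n2_wM.
Qed.

Lemma measurable_kervar : measurable_fun setT kervar.
Proof.
rewrite (_ : kervar = fun z => \sum_i \sum_j w i * e i z * (w j * e j z) * cov i j).
  by apply: measurable_sum => i; apply: measurable_sum => j; mfun; exact: me.
by apply/funext => z; exact: int_ip2E.
Qed.

Lemma L1_kervar2 : L1 P (fun z => kervar z ^+ 2).
Proof.
apply: (L1_le _ (L1Z ((lam * om ^+ 2) ^+ 2) Ine)).
  by apply: measurable_funX; exact: measurable_kervar.
move=> z; rewrite ger0_norm ?sqr_ge0// -exprMn lerXn2r// ?nnegrE ?kervar_ge0//.
  by rewrite !mulr_ge0// ?sqr_ge0// sqnorm_ge0.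
exact: kervar_le.
Qed.

Lemma int_kervar2_le : \int[P]_z (kervar z ^+ 2) <= lam ^+ 2 * om ^+ 4 * kap.
Proof.
apply: (@le_trans _ _ (\int[P]_z ((lam * om ^+ 2) ^+ 2 * sqnorm z ^+ 2))).
  apply: le_Rint; [exact: L1_kervar2|exact: L1Z|] => z.
  rewrite -exprMn lerXn2r// ?nnegrE ?kervar_ge0//.
    by rewrite !mulr_ge0// ?sqr_ge0// sqnorm_ge0.
  exact: kervar_le.
rewrite RintZ// (_ : (lam * om ^+ 2) ^+ 2 = lam ^+ 2 * om ^+ 4); last by ring.
by rewrite ler_wpM2l// mulr_ge0// exprn_even_ge0.
Qed.

Lemma L1_kervar : L1 P kervar.
Proof. exact: L1_sqr measurable_kervar L1_kervar2. Qed.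

Lemma int_kervar : \int[P]_z kervar z = hs2.
Proof.
have L i j : L1 P (fun z => e i z * e j z) by rewrite (ip_delta i); exact: L1_ip_e.
rewrite (eq_Rint (fun z => \sum_i \sum_j (w i * w j * cov i j) * (e i z * e j z))).
  rewrite Rintegral_sum; last by move=> i; apply: L1_sum => j; apply: L1Z.
  apply: eq_bigr => i _; rewrite Rintegral_sum; last by move=> j; apply: L1Z.
  apply: eq_bigr => j _; rewrite RintZ// -/(cov i j); ring.
move=> z; rewrite /kervar int_ip2E; apply: eq_bigr => i _; apply: eq_bigr => j _; ring.
Qed.

Lemma hs2_ge0 : 0 <= hs2.
Proof. by rewrite -int_kervar; apply: Rint_ge0 => z; exact: kervar_ge0. Qed.

Lemma mseq_sumvar : mseq sumvar.
Proof.
move=> k; rewrite (_ : (fun D : k.-tuple T => sumvar D) = fun D : k.-tuple T => \sum_i \sum_j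
    w i * (\sum_(z <- D) e i z) * (w j * (\sum_(z <- D) e j z)) * cov i j).
  apply: measurable_sum => i; apply: measurable_sum => j; mfun; exact: (mseq_sum (me _)).
by apply/funext => D; exact: int_ip2E.
Qed.

Lemma kersum_cons z s z' : kersum (z :: s) z' = kersum s z' + ker z z'.
Proof.
rewrite /kersum /ker /ip -big_split /=; apply: eq_bigr => i _; rewrite big_cons; ring.
Qed.

Lemma kersum_nil z : kersum [::] z = 0.
Proof. by rewrite /kersum /ip big1// => i _; rewrite big_nil mulr0 mul0r. Qed.

Lemma sumvar_nil : sumvar [::] = 0.
Proof.
by rewrite /sumvar (eq_Rint (fun=> 0)) ?Rint_cst// => z; rewrite kersum_nil expr0n.
Qed.

Lemma kersumE s z : kersum s z = \sum_(z' <- s) ker z' z.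
Proof.
elim: s => [|z' s ih]; first by rewrite kersum_nil big_nil.
by rewrite kersum_cons big_cons ih addrC.
Qed.

Lemma kerC z z' : ker z z' = ker z' z.
Proof. by apply: eq_bigr => i _; ring. Qed.

(** Coefficients of the cross term of [sumvar (z :: s)], which is a centred linear form in the new
    point. *)
Definition drift s i := w i * \int[P]_z (kersum s z * e i z).

Lemma sumvar_cons z s : sumvar (z :: s) = sumvar s + (2 * ip (drift s) z + kervar z).
Proof.
rewrite /sumvar (eq_Rint (fun z' => kersum s z' ^+ 2 +
  (2 * (kersum s z' * ker z z') + ker z z' ^+ 2))); last first.
  by move=> z'; rewrite kersum_cons; ring.
rewrite RintD; [|exact: L1_ip2|by apply: L1D; [apply: L1Z; exact: L1_ipM|exact: L1_ip2]].
rewrite RintD; [|by apply: L1Z; exact: L1_ipM|exact: L1_ip2].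
rewrite RintZ; last exact: L1_ipM.
congr (_ + (_ * _ + _)); rewrite int_ip_ip; apply: eq_bigr => i _; rewrite /drift; ring.
Qed.

Lemma int_drift2_le s : \int[P]_z (ip (drift s) z ^+ 2) <= lam ^+ 2 * om ^+ 2 * sumvar s.
Proof.
pose c i := \int[P]_z (kersum s z * e i z).
apply: (le_trans (hlam _)); apply: (@le_trans _ _ (lam * (om ^+ 2 * n2 c))).
  by rewrite ler_wpM2l//; exact: n2_wM.
suff h : n2 c <= lam * sumvar s.
  have : om ^+ 2 * n2 c <= om ^+ 2 * (lam * sumvar s) by rewrite ler_wpM2l// sqr_ge0.
  by move=> /(ler_wpM2l lam0); rewrite !mulrA; move/le_trans; apply; rewrite le_eqVlt; apply/orP; left; apply/eqP; ring.
(* Duality: the squared norm of c is an inner product of [kersum s] with the form that c itself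
   defines, so Cauchy-Schwarz and [hlam] bound it by a multiple of its own square root. *)
have e1 : n2 c = \int[P]_z (kersum s z * ip c z).
  by rewrite int_ip_ip; apply: eq_bigr => i _; rewrite -/(c i) expr2.
have h1 : n2 c ^+ 2 <= sumvar s * (lam * n2 c).
  rewrite e1; apply: (le_trans (Rint_cauchy_schwarz _ _ _ _)).
  - exact: measurable_ip.
  - exact: measurable_ip.
  - exact: L1_ip2.
  - exact: L1_ip2.
  by rewrite -e1 ler_wpM2l// sumvar_ge0.
have [->|c0] := eqVneq (n2 c) 0; first by rewrite mulr_ge0// sumvar_ge0.
have cgt : 0 < n2 c by rewrite lt_def c0 n2_ge0.
by rewrite -(ler_pM2r cgt); move: h1; rewrite expr2; lra.
Qed.

Lemma L1_drift_kervar s : L1 P (fun z => 2 * ip (drift s) z + kervar z).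
Proof. by apply: L1D; [apply: L1Z; exact: L1_ip|exact: L1_kervar]. Qed.

Lemma Eiid_sumvar k : (Eiid P k sumvar <= (k%:R * hs2)%:E)%E.
Proof.
elim: k => [|k ih]; first by rewrite Eiid0 ?sumvar_nil ?mul0r//; exact: mseq_sumvar.
apply: (@le_trans _ _ (Eiid P k (fun s => sumvar s + hs2))).
  apply: EiidS_le.
  - exact: mseq_sumvar.
  - by move=> n; apply: measurable_funD => //; exact: mseq_sumvar.
  - exact: sumvar_ge0.
  move=> s; rewrite (_ : (fun z => sumvar (z :: s)) =
      fun z => sumvar s + (2 * ip (drift s) z + kervar z)); last first.
    by apply/funext => z; exact: sumvar_cons.
  split; first by apply: L1D; [exact: L1_cst|exact: L1_drift_kervar].
  rewrite RintD; [|exact: L1_cst|exact: L1_drift_kervar].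
  rewrite RintD; [|by apply: L1Z; exact: L1_ip|exact: L1_kervar].
  by rewrite RintZ; [rewrite int_ip mulr0 add0r int_kervar Rint_cst|exact: L1_ip].
rewrite -natr1 mulrDl mul1r; apply: Eiid_leD => //.
- exact: mseq_sumvar.
- exact: sumvar_ge0.
- by move=> s; exact: hs2_ge0.
- by rewrite Eiid_cst.
Qed.

Definition dev2 s := (sumvar s - (size s)%:R * hs2) ^+ 2.

Lemma mseq_dev2 : mseq dev2.
Proof.
move=> k; under eq_fun do rewrite /dev2 size_tuple.
by apply: measurable_funX; apply: measurable_funB => //; exact: mseq_sumvar.
Qed.

(** The centred conditional variance is a martingale in the sample size: its increment 2 ip (drift
    s) + (kervar - hs2) has mean 0, so only squared increments accumulate. Summing 8 j over j < k
    gives the 4 k^2. *)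
Lemma Eiid_dev2 k : (Eiid P k dev2 <=
  (4 * k%:R ^+ 2 * (lam ^+ 2 * om ^+ 2) * hs2 + 2 * k%:R * (lam ^+ 2 * om ^+ 4 * kap))%:E)%E.
Proof.
elim: k => [|k ih].
  by rewrite Eiid0 /dev2 ?sumvar_nil /= ?(mul0r, mulr0, subr0, expr0n, addr0)//; exact: mseq_dev2.
set D := lam ^+ 2 * om ^+ 4 * kap in ih *.
have D0 : 0 <= D.
  by apply: le_trans int_kervar2_le; apply: Rint_ge0 => z; exact: sqr_ge0.
have lo0 : 0 <= lam ^+ 2 * om ^+ 2 by rewrite mulr_ge0 ?sqr_ge0.
apply: (@le_trans _ _ (Eiid P k (fun s => dev2 s + (8 * (lam ^+ 2 * om ^+ 2) * sumvar s + 2 * D)))).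
  apply: EiidS_le.
  - exact: mseq_dev2.
  - move=> n; apply: measurable_funD; first exact: mseq_dev2.
    by apply: measurable_funD => //; apply: measurable_funM => //; exact: mseq_sumvar.
  - by move=> s; exact: sqr_ge0.
  move=> s; set r := sumvar s - (size s)%:R * hs2.
  pose y z := 2 * ip (drift s) z + (kervar z - hs2).
  have e1 : (fun z => dev2 (z :: s)) = fun z => r ^+ 2 + (2 * r * y z + y z ^+ 2).
    by apply/funext => z; rewrite /dev2 sumvar_cons /= -natr1 /y /r; ring.
  have Lk : L1 P (fun z => kervar z - hs2) by apply: L1B; [exact: L1_kervar|exact: L1_cst].
  have mk : measurable_fun setT (fun z => kervar z - hs2).
    by apply: measurable_funB => //; exact: measurable_kervar.
  have Lk2 : L1 P (fun z => (kervar z - hs2) ^+ 2).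
    rewrite (_ : (fun z => _) = fun z => kervar z ^+ 2 + ((- (2 * hs2)) * kervar z + hs2 ^+ 2)); last first.
      by apply/funext => z; ring.
    apply: L1D; [exact: L1_kervar2|apply: L1D; [apply: L1Z; exact: L1_kervar|exact: L1_cst]].
  have Ly : L1 P y by apply: L1D => //; apply: L1Z; exact: L1_ip.
  have my : measurable_fun setT y.
    by apply: measurable_funD => //; apply: measurable_funM => //; exact: measurable_ip.
  have Lb : L1 P (fun z => 8 * ip (drift s) z ^+ 2 + 2 * (kervar z - hs2) ^+ 2).
    by apply: L1D; apply: L1Z => //; exact: L1_ip2.
  have yb z : y z ^+ 2 <= 8 * ip (drift s) z ^+ 2 + 2 * (kervar z - hs2) ^+ 2.
    rewrite -subr_ge0 (_ : _ - _ = (2 * ip (drift s) z - (kervar z - hs2)) ^+ 2) ?sqr_ge0//.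
    by rewrite /y; ring.
  have Ly2 : L1 P (fun z => y z ^+ 2).
    by apply: (L1_le _ Lb) => [|z]; [mfun|rewrite ger0_norm ?sqr_ge0].
  have iy : \int[P]_z y z = 0.
    rewrite RintD//; last by apply: L1Z; exact: L1_ip.
    rewrite RintZ; last exact: L1_ip.
    rewrite RintB; [|exact: L1_kervar|exact: L1_cst].
    by rewrite int_ip mulr0 add0r int_kervar Rint_cst subrr.
  have ik : \int[P]_z ((kervar z - hs2) ^+ 2) <= D.
    rewrite (eq_Rint (fun z => kervar z ^+ 2 + ((- (2 * hs2)) * kervar z + hs2 ^+ 2))); last by move=> z; ring.
    rewrite RintD; [|exact: L1_kervar2|apply: L1D; [apply: L1Z; exact: L1_kervar|exact: L1_cst]].
    rewrite RintD; [|apply: L1Z; exact: L1_kervar|exact: L1_cst].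
    rewrite RintZ; last exact: L1_kervar.
    rewrite Rint_cst int_kervar; have := int_kervar2_le; rewrite -/D.
    by have := sqr_ge0 hs2; move: (\int[P]_z _) => A; lra.
  rewrite e1; split.
    by apply: L1D; [exact: L1_cst|apply: L1D => //; exact: L1Z].
  rewrite RintD; [|exact: L1_cst|by apply: L1D => //; exact: L1Z].
  rewrite RintD//; last exact: L1Z.
  rewrite (RintZ _ Ly) iy mulr0 add0r Rint_cst -/r -/(dev2 s) lerD2l.
  apply: (le_trans (le_Rint Ly2 Lb yb)).
  rewrite RintD; [|by apply: L1Z; exact: L1_ip2|exact: L1Z].
  rewrite RintZ; last exact: L1_ip2.
  rewrite RintZ//; have := int_drift2_le s; lra.
apply: (@le_trans _ _ ((4 * k%:R ^+ 2 * (lam ^+ 2 * om ^+ 2) * hs2 + 2 * k%:R * D) +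
    (8 * (lam ^+ 2 * om ^+ 2) * (k%:R * hs2) + 2 * D))%:E).
  apply: Eiid_leD => //.
  - exact: mseq_dev2.
  - by move=> n; apply: measurable_funD => //; apply: measurable_funM => //; exact: mseq_sumvar.
  - by move=> s; exact: sqr_ge0.
  - by move=> s; rewrite addr_ge0// mulr_ge0// ?sumvar_ge0// mulr_ge0.
  apply: Eiid_leD => //.
  - by move=> n; apply: measurable_funM => //; exact: mseq_sumvar.
  - by move=> s; rewrite mulr_ge0// ?sumvar_ge0// mulr_ge0.
  - by move=> s; rewrite mulr_ge0.
  - apply: Eiid_leZ; [exact: mseq_sumvar|exact: sumvar_ge0|by rewrite mulr_ge0|exact: Eiid_sumvar].
  - by rewrite Eiid_cst.
rewrite lee_fin -natr1; have h0 := hs2_ge0; have : 0 <= lam ^+ 2 * om ^+ 2 * hs2 by rewrite mulr_ge0.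
by move: (lam ^+ 2 * om ^+ 2) => lo; nra.
Qed.

Definition sum4 s := \int[P]_z (kersum s z ^+ 4).

Lemma measurable_kersum2 k : measurable_fun setT (fun p : k.-tuple T * T => kersum p.1 p.2).
Proof.
apply: measurable_sum => i; apply: measurable_funM.
  apply: measurable_funM => //.
  exact: (measurableT_comp (mseq_sum (me i) (k := k)) measurable_fst).
exact: (measurableT_comp (me i) measurable_snd).
Qed.

Lemma L1_kersum4 s : L1 P (fun z => kersum s z ^+ 4). Proof. exact: L1_ip4. Qed.

Lemma mseq_sum4 : mseq sum4.
Proof.
apply: (mseq_Rint P (f := fun s z => kersum s z ^+ 4)) => [k|s z].
  by apply: measurable_funX; exact: measurable_kersum2.
exact: exprn_even_ge0.
Qed.

Lemma sum4_ge0 s : 0 <= sum4 s.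
Proof. by apply: Rint_ge0 => z; exact: exprn_even_ge0. Qed.

Lemma n2_we_le z : n2 (fun i => w i * e i z) <= om ^+ 2 * sqnorm z.
Proof. exact: n2_wM. Qed.

Lemma kap_ge0 : 0 <= kap.
Proof. by apply: le_trans hkap; apply: Rint_ge0 => z; exact: sqr_ge0. Qed.

Lemma int_ker4_le z : \int[P]_z' (ker z z' ^+ 4) <= om ^+ 4 * kap * sqnorm z ^+ 2.
Proof.
apply: (le_trans (int_ip4_le _)).
rewrite (_ : om ^+ 4 * kap * sqnorm z ^+ 2 = (om ^+ 2 * sqnorm z) ^+ 2 * kap); last by ring.
apply: ler_wpM2r; first exact: kap_ge0.
apply: lerXn2r; rewrite ?nnegrE ?n2_ge0// ?mulr_ge0 ?sqr_ge0 ?sqnorm_ge0//.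
exact: n2_we_le.
Qed.

(** With the integrals exchanged and z fixed, [kersum s z] is a sum of independent centred terms of
    variance [kervar z], to which [Eiid_sum_pow4] applies. *)
Lemma Eiid_sum4 k : (Eiid P k sum4 <=
  (4 * k%:R ^+ 2 * (lam ^+ 2 * om ^+ 4 * kap) + 3 * k%:R * (om ^+ 4 * kap ^+ 2))%:E)%E.
Proof.
rewrite (@Eiid_Rint _ _ _ P k (fun s z => kersum s z ^+ 4)); last 3 first.
- by move=> n; apply: measurable_funX; exact: measurable_kersum2.
- by move=> s z; exact: exprn_even_ge0.
- exact: L1_kersum4.
pose g z := 4 * k%:R ^+ 2 * kervar z ^+ 2 + 3 * k%:R * (om ^+ 4 * kap) * sqnorm z ^+ 2.
have Lg : L1 P g by apply: L1D; apply: L1Z => //; exact: L1_kervar2.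
apply: (@le_trans _ _ (\int[P]_z (g z)%:E)%E).
  apply: ge0_le_integral => //.
  - by move=> z _; apply: integral_ge0 => D _; rewrite lee_fin exprn_even_ge0.
  - apply: (@measurable_fun_fubini_tonelli_G _ _ _ _ _ (iid_law P k)
      (fun p : k.-tuple T * T => (kersum p.1 p.2 ^+ 4)%:E)).
      by apply/measurable_EFinP; apply: measurable_funX; exact: measurable_kersum2.
    by move=> p; rewrite lee_fin exprn_even_ge0.
  - by apply/measurable_EFinP; exact: L1_measurable Lg.
  move=> z _.
  have -> : (fun s => kersum s z ^+ 4) = fun s => (\sum_(z' <- s) ker z z') ^+ 4.
    by apply/funext => s; congr (_ ^+ 4); rewrite kersumE; apply: eq_bigr => z' _; exact: kerC.
  apply: (le_trans (Eiid_sum_pow4 (measurable_ip _) (L1_ip4 _) (int_ip _) k)).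
  rewrite lee_fin /g lerD2l -[leRHS]mulrA; apply: ler_wpM2l; first by rewrite mulr_ge0.
  exact: int_ker4_le.
rewrite EFin_Rintegral// lee_fin /g RintD; [|by apply: L1Z; exact: L1_kervar2|exact: L1Z].
rewrite (RintZ _ L1_kervar2) (RintZ _ Ine); apply: lerD.
  by rewrite ler_wpM2l ?mulr_ge0//; exact: int_kervar2_le.
rewrite (_ : 3 * k%:R * (om ^+ 4 * kap ^+ 2) = 3 * k%:R * (om ^+ 4 * kap) * kap); last by ring.
by rewrite ler_wpM2l// !mulr_ge0// ?exprn_even_ge0// kap_ge0.
Qed.

End kernel_moments.

(** * Lindeberg replacement *)

(** Trades the absolute third moment of a Taylor remainder for the second and fourth moments, which
    are computable; [et] will be the target accuracy. *)
Lemma cube_amgm (R : realFieldType) (et t : R) : 0 < et -> 0 <= t ->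
  t ^+ 3 <= (et * t ^+ 2 + t ^+ 4 / et) / 2.
Proof.
move=> et0 t0; rewrite -subr_ge0.
rewrite (_ : _ - _ = t ^+ 2 * (et - t) ^+ 2 / (2 * et)); last by field; rewrite gt_eqF.
by apply: divr_ge0; [rewrite mulr_ge0// sqr_ge0|rewrite mulr_ge0// ltW].
Qed.

Lemma norm_amgm (R : realFieldType) (et t : R) : 0 < et -> `|t| <= (et + t ^+ 2 / et) / 2.
Proof.
move=> et0; rewrite -[t ^+ 2]real_normK ?num_real// -subr_ge0.
rewrite (_ : _ - _ = (et - `|t|) ^+ 2 / (2 * et)); last by field; rewrite gt_eqF.
by rewrite divr_ge0 ?sqr_ge0// mulr_ge0// ltW.
Qed.

Section taylor_mean.
Context d (T : measurableType d) (R : realType) (P : probability T R).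

Lemma taylor_mean (K et : R) (G : R -> R) x a b (y : T -> R) :
  0 < et -> measurable_fun [set: R] G -> (forall t, 0 <= G t <= 1) ->
  taylor_at K G x a b -> measurable_fun setT y -> L1 P (fun z => y z ^+ 4) ->
  \int[P]_z y z = 0 ->
  `|\int[P]_z G (x + y z) - G x - b / 2 * \int[P]_z (y z ^+ 2)| <=
  K * ((et * \int[P]_z (y z ^+ 2) + \int[P]_z (y z ^+ 4) / et) / 2).
Proof.
move=> et0 mG G01 [ha hb hG] my y4 y0.
have K0 : 0 <= K := le_trans (normr_ge0 _) ha.
have y2 : L1 P (fun z => y z ^+ 2) := L1_pow_le4 my y4 (isT : 2 <= 4)%N.
have y1 : L1 P y := L1_sqr my y2.
have LG : L1 P (fun z => G (x + y z)).
  apply: (@L1_bounded _ _ _ _ _ 1).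
    by apply: (measurableT_comp mG); apply: measurable_funD.
  by move=> z; have /andP[? ?] := G01 (x + y z); rewrite ger0_norm.
have Lr : L1 P (fun z => G (x + y z) - G x - a * y z - b / 2 * y z ^+ 2).
  apply: L1B; last exact: L1Z.
  by apply: L1B; [apply: L1B => //; exact: L1_cst|exact: L1Z].
have -> : \int[P]_z G (x + y z) - G x - b / 2 * \int[P]_z (y z ^+ 2) =
    \int[P]_z (G (x + y z) - G x - a * y z - b / 2 * y z ^+ 2).
  rewrite RintB; [|by apply: L1B; [apply: L1B => //; exact: L1_cst|exact: L1Z]|exact: L1Z].
  rewrite RintB; [|by apply: L1B => //; exact: L1_cst|exact: L1Z].
  rewrite RintB//; last exact: L1_cst.
  by rewrite (RintZ _ y1) (RintZ _ y2) y0 mulr0 subr0 Rint_cst.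
have Lb : L1 P (fun z => K * (et / 2 * y z ^+ 2 + (2 * et)^-1 * y z ^+ 4)).
  by apply: L1Z; apply: L1D; exact: L1Z.
apply: (le_trans (le_norm_Rint Lr Lb _)).
  move=> z; apply: (le_trans (hG _)); apply: ler_wpM2l => //.
  apply: (le_trans (cube_amgm et0 (normr_ge0 _))).
  rewrite (_ : `|y z| ^+ 4 = y z ^+ 4); last by rewrite -normrX ger0_norm ?exprn_even_ge0.
  rewrite real_normK ?num_real// le_eqVlt; apply/orP; left; apply/eqP.
  by field; rewrite gt_eqF.
rewrite RintZ; last by apply: L1D; exact: L1Z.
rewrite RintD; [|exact: L1Z|exact: L1Z].
rewrite (RintZ _ y2) (RintZ _ y4) ler_wpM2l//.
by rewrite le_eqVlt; apply/orP; left; apply/eqP; field; rewrite gt_eqF.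
Qed.

End taylor_mean.

Section gauss_taylor.
Context (R : realType).
Local Notation mu := (@lebesgue_measure R).
Local Notation pdf := (normal_pdf (0 : R) 1).

Definition gauss4 : R := gE (fun y => y ^+ 4).

Lemma gauss_taylor (K et : R) (G : R -> R) x a b v :
  0 < et -> measurable_fun [set: R] G -> (forall t, 0 <= G t <= 1) ->
  taylor_at K G x a b ->
  `|gE (fun y => G (x + v * y)) - G x - b / 2 * v ^+ 2| <=
  K * ((et * v ^+ 2 + v ^+ 4 * gauss4 / et) / 2).
Proof.
move=> et0 mG G01 [ha hb hG].
have K0 : 0 <= K := le_trans (normr_ge0 _) ha.
have Ly : L1 mu (fun y => y * pdf y).
  apply: L1_pdf_le; first exact: measurable_id.
  by exists 1 => y; rewrite mul1r ler_norml; apply/andP; split;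
    have := sqr_ge0 (y ^+ 2 - 1); have := sqr_ge0 (y - 1); have := sqr_ge0 (y + 1);
    rewrite (_ : y ^+ 4 = (y ^+ 2) ^+ 2); [nra|ring|nra|ring].
have Ly2 : L1 mu (fun y => y ^+ 2 * pdf y).
  apply: L1_pdf_le; first by mfun; exact: measurable_id.
  exists 1 => y; rewrite mul1r ger0_norm ?sqr_ge0//.
  by have := sqr_ge0 (y ^+ 2 - 1); rewrite (_ : y ^+ 4 = (y ^+ 2) ^+ 2); [nra|ring].
have LG : L1 mu (fun y => G (x + v * y) * pdf y).
  apply: (@L1_pdf_bounded _ _ 1).
    by apply: (measurableT_comp mG); mfun.
  by move=> y; have /andP[? ?] := G01 (x + v * y); rewrite ger0_norm.
have Lr : L1 mu (fun y => G (x + v * y) * pdf y - G x * pdf y - (a * v) * (y * pdf y) -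
    (b / 2 * v ^+ 2) * (y ^+ 2 * pdf y)).
  apply: L1B; last exact: L1Z.
  by apply: L1B; [apply: L1B => //; apply: L1Z; exact: L1_pdf|exact: L1Z].
have -> : gE (fun y => G (x + v * y)) - G x - b / 2 * v ^+ 2 =
    \int[mu]_y (G (x + v * y) * pdf y - G x * pdf y - (a * v) * (y * pdf y) -
    (b / 2 * v ^+ 2) * (y ^+ 2 * pdf y)).
  rewrite RintB; [|by apply: L1B; [apply: L1B => //; apply: L1Z; exact: L1_pdf|exact: L1Z]|exact: L1Z].
  rewrite RintB; [|by apply: L1B => //; apply: L1Z; exact: L1_pdf|exact: L1Z].
  rewrite RintB//; last by apply: L1Z; exact: L1_pdf.
  rewrite (RintZ _ Ly) (RintZ _ Ly2) (RintZ _ (@L1_pdf R)) Rint_normal_pdf.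
  have -> : \int[mu]_x0 (x0 * pdf x0) = 0 by exact: gE_id.
  have -> : \int[mu]_x0 (x0 ^+ 2 * pdf x0) = 1 by exact: gE_sqr.
  by rewrite mulr0 subr0 !mulr1.
have Lb : L1 mu (fun y => K * (et / 2 * v ^+ 2 * (y ^+ 2 * pdf y) + (2 * et)^-1 * v ^+ 4 * (y ^+ 4 * pdf y))).
  by apply: L1Z; apply: L1D; apply: L1Z => //; exact: L1_pow4_pdf.
apply: (le_trans (le_norm_Rint Lr Lb _)).
  move=> y; rewrite (_ : _ - _ = (G (x + v * y) - G x - a * (v * y) - b / 2 * (v * y) ^+ 2) * pdf y); last by ring.
  rewrite (_ : K * _ = K * ((et * (v * y) ^+ 2 + (v * y) ^+ 4 / et) / 2) * pdf y); last first.
    by field; rewrite gt_eqF.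
  rewrite normrM (gtr0_norm (pdf_gt0 _)) ler_wpM2r//; first by rewrite ltW// pdf_gt0.
  apply: (le_trans (hG _)); apply: ler_wpM2l => //.
  apply: (le_trans (cube_amgm et0 (normr_ge0 _))).
  rewrite (_ : `|v * y| ^+ 4 = (v * y) ^+ 4); last by rewrite -normrX ger0_norm ?exprn_even_ge0.
  by rewrite real_normK ?num_real.
rewrite RintZ; last by apply: L1D; apply: L1Z => //; exact: L1_pow4_pdf.
rewrite RintD; [|exact: L1Z|by apply: L1Z; exact: L1_pow4_pdf].
rewrite (RintZ _ Ly2) (RintZ _ (@L1_pow4_pdf R)) ler_wpM2l//.
have -> : \int[mu]_x0 (x0 ^+ 2 * pdf x0) = 1 by exact: gE_sqr.
rewrite -/gauss4 le_eqVlt; apply/orP; left; apply/eqP.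
rewrite /gauss4 /gE; field; rewrite gt_eqF//.
Qed.

Lemma gauss4_ge0 : 0 <= gauss4.
Proof. by apply: gE_ge0 => y; exact: exprn_even_ge0. Qed.

End gauss_taylor.

(** Sorts the replacement error into a deterministic part and multiples of [dev2], [sumvar] and
    [sum4], whose means are bounded separately. *)
Lemma swap_err_regroup (R : realFieldType) (K a et m k b x1 x2 x3 x4 : R) :
  et != 0 -> m != 0 ->
  K * (a ^+ 2 / 2 * ((et * m + (et * m)^-1 * (x4 - k * b) ^+ 2) / 2 + k * x2) +
     (et * (a ^+ 2 * x4) + a ^+ 4 * x1 / et) / 2 +
     (et * (a ^+ 2 * k) + (a ^+ 2 * k) ^+ 2 * x3 / et) / 2) =
  K * (a ^+ 2 / 2 * (et * m / 2 + k * x2) +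
     (et * (a ^+ 2 * k) + (a ^+ 2 * k) ^+ 2 * x3 / et) / 2 +
     (a ^+ 2 / (4 * et * m) * (x4 - k * b) ^+ 2 +
      (et * a ^+ 2 / 2 * x4 + a ^+ 4 / (2 * et) * x1))).
Proof. by move=> et0 m0; congr (K * _); field; rewrite et0 m0. Qed.

Section pairsum.
Context (T : Type) (R : realType).

(** The recursion on the head follows the construction of [iid_law], so one conditioning step
    removes exactly one observation. *)
Fixpoint pairsum (H : T -> T -> R) (s : seq T) : R :=
  if s is z :: s' then \sum_(z' <- s') H z z' + pairsum H s' else 0.

End pairsum.

Section lindeberg.
Context d (T : measurableType d) (R : realType) (P : probability T R).
Context (I : finType) (w : I -> R) (e : I -> T -> R) (lam om kap : R).
Context (me : forall i, measurable_fun setT (e i))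
  (Ine : L1 P (fun z => sqnorm e z ^+ 2)) (hkap : \int[P]_z (sqnorm e z ^+ 2) <= kap)
  (e_mean : forall i, \int[P]_z e i z = 0)
  (lam0 : 0 <= lam) (om0 : 0 <= om)
  (hlam : forall b, \int[P]_z (ip e b z ^+ 2) <= lam * n2 b)
  (hom : forall i, `|w i| <= om).
Context (K : R) (F F1 F2 : R -> R) (cF : continuous F) (F01 : forall x, 0 <= F x <= 1)
  (mF1 : measurable_fun [set: R] F1) (mF2 : measurable_fun [set: R] F2)
  (hF : forall x, taylor_at K F x (F1 x) (F2 x)).

Local Notation H := (ker w e).
Local Notation be := (hs2 P w e).
Local Notation q := (sumvar P w e).

Let mF : measurable_fun [set: R] F. Proof. exact: continuous_measurable_fun. Qed.
Let F_norm x : `|F x| <= 1. Proof. by have /andP[? ?] := F01 x; rewrite ger0_norm. Qed.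

Lemma pairsum_cons z s : pairsum H (z :: s) = kersum w e s z + pairsum H s.
Proof. by rewrite /= kersumE; congr (_ + _); apply: eq_bigr => z' _; exact: kerC. Qed.

Lemma mseq_pairsum : mseq (pairsum H).
Proof.
apply: (mseq_cons_ind (g := kersum w e)) => [k|z s]; first exact: measurable_kersum2.
exact: pairsum_cons.
Qed.

Lemma gavg01 s x : 0 <= gavg s F x <= 1.
Proof.
have h : `|gavg s F x| <= 1.
  apply: gE_norm_le => //.
  by apply: (measurableT_comp mF); mfun.
rewrite (le_trans (ler_norm _) h) andbT; apply: gE_ge0 => y.
by have /andP[] := F01 (x + s * y).
Qed.

Lemma gavg_taylor_at s x : taylor_at K (gavg s F) x (gavg s F1 x) (gavg s F2 x).
Proof. exact: gavg_taylor. Qed.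

Lemma gavg_continuous s : continuous (gavg s F).
Proof.
apply: (taylor_continuous (K := K)) => x.
by exists (gavg s F1 x), (gavg s F2 x); exact: gavg_taylor_at.
Qed.

Lemma gavg_measurable s : measurable_fun [set: R] (gavg s F).
Proof. by apply: continuous_measurable_fun; exact: gavg_continuous. Qed.

Let K0 : 0 <= K. Proof. by have [h _ _] := hF 0; exact: le_trans (normr_ge0 _) h. Qed.

Context (a et : R) (a0 : 0 <= a) (et0 : 0 < et).

(** Three sources of error, one per line: the conditional variance [q s] differs from k, and the
    Taylor remainders of the data term and of the Gaussian term. The weight et m in the first is the
    tolerated size of the deviation of [q s] from k times [be]. *)
Definition swap_err (m k : R) (s : seq T) : R :=
  K * (a ^+ 2 / 2 * ((et * m + (et * m)^-1 * (q s - k * be) ^+ 2) / 2 + k * `|be - 1|) +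
       (et * (a ^+ 2 * q s) + a ^+ 4 * sum4 P w e s / et) / 2 +
       (et * (a ^+ 2 * k) + (a ^+ 2 * k) ^+ 2 * gauss4 R / et) / 2).

(* Given the [k] observations [s], one more contributes a term of conditional variance
   [a ^+ 2 * q s], which is exchanged for a Gaussian of the deterministic variance [a ^+ 2 * k]. *)
Lemma swap_step (m : R) (t : R) (k : nat) (s : seq T) x : 0 < m -> 0 <= t ->
  `|\int[P]_z gavg t F (x + a * kersum w e s z) -
    gavg (Num.sqrt (t ^+ 2 + a ^+ 2 * k%:R)) F x| <= swap_err m k%:R s.
Proof.
move=> m0 t0.
pose v := a * Num.sqrt (k%:R : R).
have v2 : v ^+ 2 = a ^+ 2 * k%:R by rewrite exprMn sqr_sqrtr.
have -> : gavg (Num.sqrt (t ^+ 2 + a ^+ 2 * k%:R)) F x = gE (fun y => gavg t F (x + v * y)).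
  by rewrite -v2 gavg_semigroup// mulr_ge0// sqrtr_ge0.
have tay := gavg_taylor_at t x; set b := gavg t F2 x in tay.
have hb : `|b| <= K by case: tay.
have my : measurable_fun setT (fun z => a * kersum w e s z).
  by apply: measurable_funM => //; exact: measurable_ip.
have y4 : L1 P (fun z => (a * kersum w e s z) ^+ 4).
  rewrite (_ : (fun z => _) = fun z => a ^+ 4 * kersum w e s z ^+ 4); last first.
    by apply/funext => z; rewrite exprMn.
  by apply: L1Z; exact: L1_ip4.
have i1 : \int[P]_z (a * kersum w e s z) = 0.
  by rewrite RintZ; [rewrite int_ip ?mulr0|exact: L1_ip].
have i2 : \int[P]_z ((a * kersum w e s z) ^+ 2) = a ^+ 2 * q s.
  rewrite (eq_Rint (fun z => a ^+ 2 * kersum w e s z ^+ 2)); last by move=> z; rewrite exprMn.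
  by rewrite RintZ//; exact: L1_ip2.
have i4 : \int[P]_z ((a * kersum w e s z) ^+ 4) = a ^+ 4 * sum4 P w e s.
  rewrite (eq_Rint (fun z => a ^+ 4 * kersum w e s z ^+ 4)); last by move=> z; rewrite exprMn.
  by rewrite RintZ//; exact: L1_ip4.
have h1 := taylor_mean et0 (gavg_measurable t) (gavg01 t) tay my y4 i1.
have h2 := gauss_taylor v et0 (gavg_measurable t) (gavg01 t) tay.
rewrite i2 i4 in h1.
have v4 : v ^+ 4 = (a ^+ 2 * k%:R) ^+ 2 by rewrite -v2; ring.
rewrite v2 v4 in h2.
have h3 : `|q s - k%:R| <= (et * m + (et * m)^-1 * (q s - k%:R * be) ^+ 2) / 2 + k%:R * `|be - 1|.
  rewrite (_ : q s - k%:R = (q s - k%:R * be) + k%:R * (be - 1)); last by ring.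
  apply: (le_trans (ler_normD _ _)); rewrite normrM (ger0_norm (ler0n _ _)).
  by rewrite lerD2r [(et * m)^-1 * _]mulrC; apply: norm_amgm; rewrite mulr_gt0.
have h4 : `|b / 2 * (a ^+ 2 * q s) - b / 2 * (a ^+ 2 * k%:R)| <=
   K * (a ^+ 2 / 2 * ((et * m + (et * m)^-1 * (q s - k%:R * be) ^+ 2) / 2 + k%:R * `|be - 1|)).
  rewrite (_ : _ - _ = b * (a ^+ 2 / 2 * (q s - k%:R))); last by ring.
  rewrite normrM normrM (ger0_norm (_ : 0 <= a ^+ 2 / 2)); last by rewrite divr_ge0// sqr_ge0.
  apply: ler_pM => //; first by rewrite mulr_ge0// divr_ge0// sqr_ge0.
  by apply: ler_wpM2l => //; rewrite divr_ge0// sqr_ge0.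
rewrite /swap_err; set A := \int[P]_z _ in h1 *; set B := gE _ in h2 *.
set X := K * (a ^+ 2 / 2 * _) in h4.
rewrite 2!(mulrDr K) -/X.
move: h1 h2 h4; rewrite !ler_norml => /andP[? ?] /andP[? ?] /andP[? ?].
by apply/andP; split; lra.
Qed.

Let c0 (m k : R) := a ^+ 2 / 2 * (et * m / 2 + k * `|be - 1|) +
  (et * (a ^+ 2 * k) + (a ^+ 2 * k) ^+ 2 * gauss4 R / et) / 2.
Let c1 (m : R) := a ^+ 2 / (4 * et * m).
Let c2 := et * a ^+ 2 / 2.
Let c3 := a ^+ 4 / (2 * et).

Definition swap_bound (m k : R) := c0 m k +
  (c1 m * (4 * k ^+ 2 * (lam ^+ 2 * om ^+ 2) * be + 2 * k * (lam ^+ 2 * om ^+ 4 * kap)) +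
   (c2 * (k * be) +
    c3 * (4 * k ^+ 2 * (lam ^+ 2 * om ^+ 4 * kap) + 3 * k * (om ^+ 4 * kap ^+ 2)))).

Lemma integral_swap_err (m : R) k : 0 < m ->
  (\int[iid_law P k]_D (swap_err m k%:R D)%:E <= (K * swap_bound m k%:R)%:E)%E.
Proof.
move=> m0.
have g40 := gauss4_ge0 R.
have c00 : 0 <= c0 m k%:R.
  rewrite /c0 addr_ge0//.
    apply: mulr_ge0; first by rewrite divr_ge0// sqr_ge0.
    by apply: addr_ge0; [rewrite divr_ge0// mulr_ge0// ltW|rewrite mulr_ge0].
  apply: divr_ge0 => //; apply: addr_ge0.
    by apply: mulr_ge0; [exact: ltW|rewrite mulr_ge0// sqr_ge0].
  by apply: divr_ge0; [rewrite mulr_ge0// sqr_ge0|exact: ltW].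
have c10 : 0 <= c1 m by rewrite /c1 divr_ge0 ?sqr_ge0// !mulr_ge0 ?ltW.
have c20 : 0 <= c2 by rewrite /c2 divr_ge0// mulr_ge0 ?sqr_ge0// ltW.
have c30 : 0 <= c3 by rewrite /c3 divr_ge0 ?exprn_even_ge0// mulr_ge0// ltW.
pose f1 s := c1 m * dev2 P w e s.
pose f2 s := c2 * q s.
pose f3 s := c3 * sum4 P w e s.
have mf1 : mseq f1 by move=> n; apply: measurable_funM => //; exact: (mseq_dev2 _ me Ine).
have mf2 : mseq f2 by move=> n; apply: measurable_funM => //; exact: (mseq_sumvar _ me Ine).
have mf3 : mseq f3 by move=> n; apply: measurable_funM => //; exact: mseq_sum4.
have f10 s : 0 <= f1 s by rewrite mulr_ge0// sqr_ge0.
have f20 s : 0 <= f2 s by rewrite mulr_ge0// sumvar_ge0.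
have f30 s : 0 <= f3 s by rewrite mulr_ge0// sum4_ge0.
have m23 : mseq (fun s => f2 s + f3 s) by move=> n; apply: measurable_funD; [exact: mf2|exact: mf3].
have m123 : mseq (fun s => f1 s + (f2 s + f3 s)) by move=> n; apply: measurable_funD; [exact: mf1|exact: m23].
rewrite (_ : (\int[_]_D _)%E = Eiid P k (fun s => K * (c0 m k%:R + (f1 s + (f2 s + f3 s))))); last first.
  apply: eq_integral => D _; congr (_%:E).
  rewrite /swap_err /f1 /f2 /f3 /dev2 size_tuple /c0 /c1 /c2 /c3.
  by apply: swap_err_regroup; rewrite gt_eqF.
have f230 s : 0 <= f2 s + f3 s by rewrite addr_ge0.
have f1230 s : 0 <= f1 s + (f2 s + f3 s) by rewrite addr_ge0.
apply: Eiid_leZ => //; [|by move=> s; rewrite addr_ge0|].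
  by move=> n; apply: measurable_funD => //; exact: m123.
apply: Eiid_leD => //; first by rewrite Eiid_cst.
apply: Eiid_leD => //.
  apply: Eiid_leZ => //; [exact: (mseq_dev2 _ me Ine)|by move=> s; exact: sqr_ge0|].
  exact: (Eiid_dev2 me Ine hkap e_mean lam0 om0 hlam hom).
apply: Eiid_leD => //.
  apply: Eiid_leZ => //; [exact: (mseq_sumvar _ me Ine)|by move=> s; exact: sumvar_ge0|].
  exact: (Eiid_sumvar me Ine e_mean lam0 om0 hlam hom).
apply: Eiid_leZ => //; [exact: mseq_sum4|by move=> s; exact: sum4_ge0|].
exact: (Eiid_sum4 me Ine hkap e_mean lam0 om0 hlam hom).
Qed.

(** One replacement costs O(a^2 m et), so m of them cost O(et). The 21 rounds up 3/4 + 5/2 + 5/2 + 1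
    + 14, the contributions of [t4], of half of [t5] plus [t6], and of [t1'], [t2] and [t3]. *)
Lemma swap_bound_le (m k : R) : 0 < m -> 0 <= k <= m -> a ^+ 2 * m ^+ 2 <= 4 ->
  et <= 1 -> `|be - 1| <= et ^+ 2 -> lam ^+ 2 * om ^+ 2 <= et ^+ 2 ->
  lam ^+ 2 * om ^+ 4 * kap <= et ^+ 2 * m -> om ^+ 4 * kap ^+ 2 <= et ^+ 2 * m ^+ 2 ->
  gauss4 R <= et ^+ 2 * m -> swap_bound m k <= 21 * (a ^+ 2 * m * et).
Proof.
move=> m0 /andP[k0 km] am et1 hb hl hD hW hg.
have lo0 : 0 <= lam ^+ 2 * om ^+ 2 by rewrite mulr_ge0 ?sqr_ge0.
have D0 : 0 <= lam ^+ 2 * om ^+ 4 * kap.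
  by rewrite !mulr_ge0 ?exprn_even_ge0//; exact: kap_ge0 hkap.
have W0 : 0 <= om ^+ 4 * kap ^+ 2 by rewrite mulr_ge0 ?exprn_even_ge0.
have g40 := gauss4_ge0 R.
have b0 : 0 <= be by exact: (hs2_ge0 _ me Ine).
have b2 : be <= 2.
  have e21 : et ^+ 2 <= 1 by rewrite expr_le1// ltW.
  by move: hb; rewrite ler_norml => /andP[_ ?]; lra.
have A0 : 0 <= a ^+ 2 by exact: sqr_ge0.
rewrite /swap_bound /c0 /c1 /c2 /c3 (_ : a ^+ 4 = (a ^+ 2) ^+ 2); last by ring.
move: (a ^+ 2) (lam ^+ 2 * om ^+ 2) (lam ^+ 2 * om ^+ 4 * kap) (om ^+ 4 * kap ^+ 2) (gauss4 R) (`|be - 1|) (normr_ge0 (be - 1)) A0 am hb hl hD hW hg lo0 D0 W0 g40 => A lo D W g4 b1 b10 A0 am hb hl hD hW hg lo0 D0 W0 g40.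
have k2 : k ^+ 2 <= m ^+ 2 by apply: lerXn2r; rewrite ?nnegrE// ltW.
have e2 : et ^+ 2 <= et by rewrite expr2 ler_piMr// ltW.
have t1 : 4 * k ^+ 2 * lo * be + 2 * k * D <= 10 * (m ^+ 2 * et ^+ 2).
  have h1 : k ^+ 2 * lo <= m ^+ 2 * et ^+ 2 by apply: ler_pM => //; exact: sqr_ge0.
  have h2 : k ^+ 2 * lo * be <= m ^+ 2 * et ^+ 2 * 2.
    by apply: ler_pM => //; rewrite mulr_ge0// sqr_ge0.
  have h3 : k * D <= m * (et ^+ 2 * m) by apply: ler_pM.
  by rewrite -!mulrA in h2 h3 *; nra.
have t1' : A / (4 * et * m) * (4 * k ^+ 2 * lo * be + 2 * k * D) <= 5 / 2 * (A * m * et).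
  apply: (@le_trans _ _ (A / (4 * et * m) * (10 * (m ^+ 2 * et ^+ 2)))).
    by apply: ler_wpM2l t1; rewrite divr_ge0// !mulr_ge0// ltW.
  by rewrite le_eqVlt; apply/orP; left; apply/eqP; field; rewrite !gt_eqF.
have t2 : et * A / 2 * (k * be) <= A * m * et.
  have h1 : k * be <= m * 2 by apply: ler_pM.
  apply: (@le_trans _ _ (et * A / 2 * (m * 2))).
    by apply: ler_wpM2l h1; rewrite divr_ge0// mulr_ge0// ltW.
  by rewrite le_eqVlt; apply/orP; left; apply/eqP; field.
have t3 : A ^+ 2 / (2 * et) * (4 * k ^+ 2 * D + 3 * k * W) <= 14 * (A * m * et).
  have h1 : k ^+ 2 * D <= m ^+ 2 * (et ^+ 2 * m) by apply: ler_pM => //; exact: sqr_ge0.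
  have h2 : k * W <= m * (et ^+ 2 * m ^+ 2) by apply: ler_pM.
  have h3 : 4 * k ^+ 2 * D + 3 * k * W <= 7 * (m ^+ 3 * et ^+ 2).
    rewrite (_ : m ^+ 3 * et ^+ 2 = m * (et ^+ 2 * m ^+ 2)); last by ring.
    rewrite (_ : m ^+ 2 * (et ^+ 2 * m) = m * (et ^+ 2 * m ^+ 2)) in h1; last by ring.
    by rewrite -(mulrA 4) -(mulrA 3); lra.
  apply: (@le_trans _ _ (A ^+ 2 / (2 * et) * (7 * (m ^+ 3 * et ^+ 2)))).
    by apply: ler_wpM2l h3; rewrite divr_ge0 ?sqr_ge0// mulr_ge0// ltW.
  rewrite (_ : _ * _ = (A * m ^+ 2) * (7 / 2 * (A * m * et))); last by field; rewrite gt_eqF.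
  rewrite (_ : 14 * _ = 4 * (7 / 2 * (A * m * et))); last by field.
  by apply: ler_wpM2r am; rewrite !mulr_ge0// ?ltW.
have t4 : A / 2 * (et * m / 2 + k * b1) <= 3 / 4 * (A * m * et).
  have h1 : k * b1 <= m * et by apply: ler_pM => //; exact: le_trans hb e2.
  apply: (@le_trans _ _ (A / 2 * (et * m / 2 + m * et))).
    by apply: ler_wpM2l; [rewrite divr_ge0|rewrite lerD2l].
  by rewrite le_eqVlt; apply/orP; left; apply/eqP; field.
have t5 : et * (A * k) <= A * m * et.
  rewrite (_ : A * m * et = et * (A * m)); last by ring.
  by apply: ler_wpM2l; [exact: ltW|exact: ler_wpM2l].
have t6 : (A * k) ^+ 2 * g4 / et <= 4 * (A * m * et).
  have h1 : k ^+ 2 * g4 <= m ^+ 2 * (et ^+ 2 * m) by apply: ler_pM => //; exact: sqr_ge0.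
  rewrite (_ : _ / et = A ^+ 2 / et * (k ^+ 2 * g4)); last by ring.
  apply: (@le_trans _ _ (A ^+ 2 / et * (m ^+ 2 * (et ^+ 2 * m)))).
    by apply: ler_wpM2l h1; rewrite divr_ge0 ?sqr_ge0// ltW.
  rewrite (_ : _ * _ = (A * m ^+ 2) * (A * m * et)); last by field; rewrite gt_eqF.
  by apply: ler_wpM2r am; rewrite !mulr_ge0// ltW.
have AE0 : 0 <= A * m * et by rewrite !mulr_ge0// ltW.
by lra.
Qed.

Lemma mseq_gavg t : mseq (fun s => gavg t F (a * pairsum H s)).
Proof.
move=> k; apply: (measurableT_comp (gavg_measurable t)).
by apply: measurable_funM => //; exact: mseq_pairsum.
Qed.

Lemma swap_step_int (m t : R) (k : nat) : 0 < m -> 0 <= t ->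
  `|\int[iid_law P k.+1]_D gavg t F (a * pairsum H D) -
    \int[iid_law P k]_D gavg (Num.sqrt (t ^+ 2 + a ^+ 2 * k%:R)) F (a * pairsum H D)| <=
  K * swap_bound m k%:R.
Proof.
move=> m0 t0.
have [-> mi] := Rint_iidS P k (mseq_gavg t) (fun s => gavg01 t _).
set t' := Num.sqrt _.
have L1' : L1 (iid_law P k) (fun D : k.-tuple T => gavg t' F (a * pairsum H D)).
  apply: (@L1_bounded _ _ _ _ _ 1); first exact: mseq_gavg.
  by move=> D; have /andP[? ?] := gavg01 t' (a * pairsum H D); rewrite ger0_norm.
have Li : L1 (iid_law P k) (fun D : k.-tuple T => \int[P]_z gavg t F (a * pairsum H (z :: D))).
  apply: (@L1_bounded _ _ _ _ _ 1); first exact: mi.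
  move=> D; rewrite -[leRHS](Rint_cst P 1); apply: le_norm_Rint; [|exact: L1_cst|].
    apply: (@L1_bounded _ _ _ _ _ 1); last first.
      by move=> z; have /andP[? ?] := gavg01 t (a * pairsum H (z :: D)); rewrite ger0_norm.
    apply: (measurableT_comp (gavg_measurable t)); apply: measurable_funM => //.
    under eq_fun do rewrite pairsum_cons.
    by apply: measurable_funD => //; exact: measurable_ip.
  by move=> z; have /andP[? ?] := gavg01 t (a * pairsum H (z :: D)); rewrite ger0_norm.
rewrite -RintB//.
have es0 s : 0 <= swap_err m k%:R s.
  exact: le_trans (normr_ge0 _) (swap_step k s 0 m0 t0).
have mes : measurable_fun setT (fun D : k.-tuple T => swap_err m k%:R D).
  rewrite /swap_err; have h2 : measurable_fun setT (fun D : k.-tuple T => q D) by exact: (mseq_sumvar _ me Ine).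
  have h4 : measurable_fun setT (fun D : k.-tuple T => sum4 P w e D) by exact: mseq_sum4.
  by mfun.
have [Les les] := ge0_Rintegral_le mes (fun D => es0 D) (integral_swap_err k m0).
apply: (le_trans _ les); apply: le_norm_Rint => //; first exact: L1B.
move=> D; rewrite (eq_Rint (fun z => gavg t F (a * pairsum H D + a * kersum w e D z))).
  exact: swap_step.
by move=> z; rewrite pairsum_cons mulrDr addrC.
Qed.

(** The path [A k] keeps k observations and a Gaussian of variance [tau k], the share of the
    variance due to the removed ones; it joins the statistic (k = m, [tau] = 0) to the standard
    Gaussian (k = 0, [tau] = 1). Since a^2 m^2 <= 4, the total cost is 84 K et. *)
Theorem lindeberg (m : nat) : (2 <= m)%N -> a ^+ 2 = 2 / (m%:R * (m%:R - 1)) ->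
  et <= 1 -> `|be - 1| <= et ^+ 2 -> lam ^+ 2 * om ^+ 2 <= et ^+ 2 ->
  lam ^+ 2 * om ^+ 4 * kap <= et ^+ 2 * m%:R -> om ^+ 4 * kap ^+ 2 <= et ^+ 2 * m%:R ^+ 2 ->
  gauss4 R <= et ^+ 2 * m%:R ->
  `|\int[iid_law P m]_D F (a * pairsum H D) - gE F| <= 100 * K * et.
Proof.
move=> m2 ha et1 hb hl hD hW hg.
have m0 : 0 < (m%:R : R) by rewrite ltr0n (leq_trans _ m2).
have m2R : 2 <= (m%:R : R) by rewrite ler_nat.
have am : a ^+ 2 * m%:R ^+ 2 <= 4.
  rewrite ha mulrAC ler_pdivrMr; last by nra.
  by nra.
pose tau k : R := 1 - a ^+ 2 * (k%:R * (k%:R - 1) / 2).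
have tau0 k : (k <= m)%N -> 0 <= tau k.
  move=> km; rewrite /tau subr_ge0 ha mulrAC ler_pdivrMr; last by nra.
  have : (k%:R : R) <= m%:R by rewrite ler_nat.
  by have : 0 <= (k%:R : R) by []; nra.
pose A k := \int[iid_law P k]_D gavg (Num.sqrt (tau k)) F (a * pairsum H D).
have step k : (k < m)%N -> `|A k.+1 - A k| <= K * (21 * (a ^+ 2 * m%:R * et)).
  move=> km; have := swap_step_int k m0 (sqrtr_ge0 (tau k.+1)).
  rewrite sqr_sqrtr ?tau0//.
  have -> : tau k.+1 + a ^+ 2 * k%:R = tau k by rewrite /tau -natr1; field.
  move/le_trans; apply; apply: ler_wpM2l => //; apply: swap_bound_le => //.
  by rewrite ler0n ler_nat ltnW.
have tel k : (k <= m)%N -> `|A k - A 0%N| <= k%:R * (K * (21 * (a ^+ 2 * m%:R * et))).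
  elim: k => [_|k ih km]; first by rewrite subrr normr0 mul0r.
  rewrite (_ : A k.+1 - A 0%N = (A k.+1 - A k) + (A k - A 0%N)); last by ring.
  rewrite -natr1 mulrDl mul1r; apply: (le_trans (ler_normD _ _)); rewrite addrC.
  by apply: lerD; [exact: ih (ltnW km)|exact: step].
have Am : A m = \int[iid_law P m]_D F (a * pairsum H D).
  have tm : tau m = 0 by rewrite /tau ha; field; rewrite !gt_eqF//; lra.
  apply: eq_Rint => D; rewrite tm sqrtr0 /gavg -[RHS]gE_cst.
  by congr gE; apply/funext => y; rewrite mul0r addr0.
have A0 : A 0%N = gE F.
  rewrite /A /Rintegral integral_iid_law0; last exact: (mseqEFin (k := 0) (mseq_gavg _)).
  rewrite /= mulr0 /tau mul0r mul0r mulr0 subr0 sqrtr1 /gavg.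
  by congr gE; apply/funext => y; rewrite add0r mul1r.
rewrite -Am -A0; apply: (le_trans (tel m (leqnn m))).
rewrite (_ : m%:R * _ = 21 * (K * et) * (a ^+ 2 * m%:R ^+ 2)); last by ring.
apply: (@le_trans _ _ (21 * (K * et) * 4)).
  by apply: ler_wpM2l am; rewrite mulr_ge0// mulr_ge0// ltW.
have : 0 <= K * et by rewrite mulr_ge0// ltW.
by rewrite -mulrA; lra.
Qed.

End lindeberg.

(** * Smooth step functions *)

Section smoothstep.
Context (R : realType).
Implicit Types x y u : R.

Definition posp x : R := Num.max x 0.

Lemma pospE x : posp x = if 0 <= x then x else 0.
Proof. by rewrite /posp; case: (leP 0 x). Qed.

Lemma posp_cube_taylor x y :
  `|posp (x + y) ^+ 3 - posp x ^+ 3 - 3 * posp x ^+ 2 * y - 3 * posp x * y ^+ 2| <= `|y| ^+ 3.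
Proof.
have h (t : R) : 0 <= t -> (t <= y ^+ 3 -> `|t| <= `|y| ^+ 3).
  by move=> t0 ty; rewrite ger0_norm// (le_trans ty)// -normrX ler_norm.
rewrite !pospE; case: (leP 0 x) => x0; case: (leP 0 (x + y)) => xy0.
- rewrite (_ : _ - _ = y ^+ 3); last by ring.
  by rewrite normrX.
(* The kink lies between x and x + y. With z = -y the remainder is (z - x)^3 - z^3, and 0 < z - x <=
   z. *)
- have [z yE] : exists z, y = - z by exists (- y); rewrite opprK.
  rewrite yE in xy0 *; rewrite normrN.
  have xz : x < z by lra.
  have z0 : 0 < z by lra.
  rewrite (_ : _ - _ = - (z ^+ 3 - (z - x) ^+ 3)); last by ring.
  have p1 : 0 <= (z - x) ^+ 3 by rewrite exprn_ge0// subr_ge0 ltW.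
  have p2 : (z - x) ^+ 3 <= z ^+ 3.
    by apply: lerXn2r; rewrite ?nnegrE ?subr_ge0 ?(ltW xz) ?(ltW z0)//; lra.
  rewrite normrN (gtr0_norm z0); move: ((z - x) ^+ 3) (z ^+ 3) p1 p2 => A B p1 p2.
  by rewrite ger0_norm; lra.
- rewrite expr0n /= (mulr0 3) mul0r expr0n /= mulr0 mul0r !subr0.
  apply: h; first exact: exprn_ge0.
  by apply: lerXn2r; rewrite ?nnegrE//; lra.
- by rewrite expr0n /= !(mulr0, mul0r, subrr, subr0, expr0n) normr0 exprn_ge0.
Qed.

(* The integrated cubic B-spline: a C^2 step from 0 to 1 on [0, 3] whose second derivative is
   Lipschitz. The Taylor bounds are algebraic, so no derivative is ever taken. *)
Definition bstep u := (posp u ^+ 3 - 3 * posp (u - 1) ^+ 3 + 3 * posp (u - 2) ^+ 3 -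
  posp (u - 3) ^+ 3) / 6.
Definition bstep1 u := (posp u ^+ 2 - 3 * posp (u - 1) ^+ 2 + 3 * posp (u - 2) ^+ 2 -
  posp (u - 3) ^+ 2) / 2.
Definition bstep2 u := posp u - 3 * posp (u - 1) + 3 * posp (u - 2) - posp (u - 3).

Ltac pospcases u :=
  rewrite !pospE; case: (leP 0 u) => ?; case: (leP 0 (u - 1)) => ?;
  case: (leP 0 (u - 2)) => ?; case: (leP 0 (u - 3)) => ?; try lra.

Lemma bstep_le0 u : u <= 0 -> bstep u = 0.
Proof.
move=> u0; rewrite /bstep /posp !max_r; [|lra|lra|lra|lra].
by rewrite !expr0n /= !mulr0 subr0 addr0 subr0 mul0r.
Qed.

Lemma bstep_ge3 u : 3 <= u -> bstep u = 1.
Proof. by move=> u3; rewrite /bstep /posp !max_l; [field|lra|lra|lra|lra]. Qed.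

Lemma bstep01 u : 0 <= bstep u <= 1.
Proof.
have [u0|u0] := leP u 0; first by rewrite bstep_le0// lexx ler01.
have [u3|u3] := leP 3 u; first by rewrite bstep_ge3// lexx ler01.
rewrite /bstep /posp (max_l (ltW u0)) (@max_r _ _ (u - 3)); last lra.
have [u1|u1] := leP u 1.
  rewrite !max_r; [|lra|lra].
  rewrite !expr0n /= !mulr0 subr0 addr0 subr0; apply/andP; split.
    by rewrite divr_ge0// exprn_ge0// ltW.
  have : u ^+ 3 <= 1 by rewrite exprn_ile1// ltW.
  lra.
rewrite (@max_l _ _ (u - 1)); last lra.
have [u2|u2] := leP u 2.
  rewrite (@max_r _ _ (u - 2)); last lra.
  rewrite !expr0n /= !mulr0 subr0 addr0.
  have -> : u = (u - 1) + 1 by ring.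
  have v0 : 0 <= u - 1 by lra.
  have v1 : u - 1 <= 1 by lra.
  move: (u - 1) v0 v1 => v v0 v1; rewrite addrK.
  have h2 : v ^+ 2 <= v by rewrite expr2 ler_piMr.
  have h3 : v ^+ 3 <= v ^+ 2 by rewrite exprS ler_piMl ?sqr_ge0.
  have h4 : 0 <= v ^+ 3 by rewrite exprn_ge0.
  rewrite (_ : (v + 1) ^+ 3 - 3 * v ^+ 3 = 1 + 3 * v + 3 * v ^+ 2 - 2 * v ^+ 3); last by ring.
  have h5 : 0 <= (1 - v) ^+ 2 * (1 + 2 * v) by rewrite mulr_ge0 ?sqr_ge0//; lra.
  rewrite (_ : _ * _ = 1 - 3 * v ^+ 2 + 2 * v ^+ 3) in h5; last by ring.
  by apply/andP; split; lra.
rewrite (@max_l _ _ (u - 2)); last lra.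
rewrite expr0n /= subr0.
have [v uE] : exists v, u = 3 - v by exists (3 - u); ring.
have v0 : 0 <= v by lra.
have v1 : v <= 1 by lra.
rewrite (_ : _ + _ = 6 - v ^+ 3); last by rewrite uE; ring.
have h4 : 0 <= v ^+ 3 by rewrite exprn_ge0.
have h5 : v ^+ 3 <= 1 by rewrite exprn_ile1.
by apply/andP; split; lra.
Qed.

Lemma bstep2_le u : `|bstep2 u| <= 2.
Proof. by rewrite /bstep2 ler_norml; apply/andP; split; pospcases u. Qed.

Lemma bstep1_le u : `|bstep1 u| <= 2.
Proof.
rewrite /bstep1.
have [u0|u0] := leP u 0.
  rewrite /posp !max_r; [|lra|lra|lra|lra].
  by rewrite !expr0n /= !mulr0 subr0 addr0 subr0 mul0r normr0.
have [u3|u3] := leP 3 u.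
  by rewrite /posp !max_l; [|lra|lra|lra|lra]; rewrite (_ : _ / 2 = 0) ?normr0//; field.
rewrite ler_norml; apply/andP; split; rewrite !pospE; case: (leP 0 u) => ?; case: (leP 0 (u - 1)) => ?;
  case: (leP 0 (u - 2)) => ?; case: (leP 0 (u - 3)) => ?; nra.
Qed.

Lemma bstep_taylor u : taylor_at 2 bstep u (bstep1 u) (bstep2 u).
Proof.
split; [exact: bstep1_le|exact: bstep2_le|move=> y].
pose r x := posp (x + y) ^+ 3 - posp x ^+ 3 - 3 * posp x ^+ 2 * y - 3 * posp x * y ^+ 2.
have hr x : - (`|y| ^+ 3) <= r x <= `|y| ^+ 3 by rewrite -ler_norml; exact: posp_cube_taylor.
rewrite (_ : _ - _ = (r u - 3 * r (u - 1) + 3 * r (u - 2) - r (u - 3)) / 6); last first.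
  rewrite /bstep /bstep1 /bstep2 /r.
  have -> : u + y - 1 = u - 1 + y by ring.
  have -> : u + y - 2 = u - 2 + y by ring.
  have -> : u + y - 3 = u - 3 + y by ring.
  by field.
have := hr u; have := hr (u - 1); have := hr (u - 2); have := hr (u - 3).
have : 0 <= `|y| ^+ 3 by rewrite exprn_ge0.
move: (r u) (r (u - 1)) (r (u - 2)) (r (u - 3)) (`|y| ^+ 3) => r0 r1 r2 r3 Y Y0 /andP[? ?] /andP[? ?] /andP[? ?] /andP[? ?].
by rewrite ler_norml; apply/andP; split; lra.
Qed.

Definition step_fun x0 k y := bstep (k * (y - x0)).

Lemma step_taylor x0 k y : 1 <= k ->
  taylor_at (2 * k ^+ 3) (step_fun x0 k) y (k * bstep1 (k * (y - x0)))
    (k ^+ 2 * bstep2 (k * (y - x0))).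
Proof.
move=> k1; have [h1 h2 h3] := bstep_taylor (k * (y - x0)).
have k0 : 0 <= k by lra.
have k2 : k <= k ^+ 3 by rewrite -[leLHS]expr1 ler_weXn2l.
have k3 : k ^+ 2 <= k ^+ 3 by rewrite ler_weXn2l.
split.
- rewrite normrM (ger0_norm k0) (mulrC 2); apply: ler_pM => //.
- rewrite normrM (ger0_norm (sqr_ge0 k)) (mulrC 2); apply: ler_pM => //; exact: sqr_ge0.
move=> t; move: (h3 (k * t)).
have -> : step_fun x0 k (y + t) = bstep (k * (y - x0) + k * t) by congr bstep; ring.
rewrite /step_fun normrM (ger0_norm k0).
set u := k * (y - x0).
move: (bstep u) (bstep1 u) (bstep2 u) (bstep (u + k * t)) => B C D A.
have -> : A - B - k * C * t - k ^+ 2 * D / 2 * t ^+ 2 =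
  A - B - C * (k * t) - D / 2 * (k * t) ^+ 2 by ring.
have -> : 2 * k ^+ 3 * `|t| ^+ 3 = 2 * (k * `|t|) ^+ 3 by ring.
by [].
Qed.

Lemma posp_measurable : measurable_fun [set: R] posp.
Proof. by apply: measurable_maxr; [exact: measurable_id|exact: measurable_cst]. Qed.

Lemma bstep1_measurable : measurable_fun [set: R] bstep1.
Proof.
have h c : measurable_fun [set: R] (fun u : R => posp (u - c)).
  by apply: (measurableT_comp posp_measurable); apply: measurable_funB; [exact: measurable_id|exact: measurable_cst].
have h0 : measurable_fun [set: R] (fun u : R => posp u) by exact: posp_measurable.
by rewrite /bstep1; mfun; exact: h.
Qed.

Lemma bstep2_measurable : measurable_fun [set: R] bstep2.
Proof.
have h c : measurable_fun [set: R] (fun u : R => posp (u - c)).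
  by apply: (measurableT_comp posp_measurable); apply: measurable_funB; [exact: measurable_id|exact: measurable_cst].
have h0 : measurable_fun [set: R] (fun u : R => posp u) by exact: posp_measurable.
by rewrite /bstep2; mfun; exact: h.
Qed.

End smoothstep.

Lemma prob_le_integral d (T : measurableType d) (R : realType) (P : probability T R)
    (A : set T) (f : T -> R) : measurable A -> measurable_fun setT f ->
  (forall z, 0 <= f z) -> (forall z, A z -> 1 <= f z) -> (P A <= \int[P]_z (f z)%:E)%E.
Proof.
move=> mA mf f0 fA; rewrite -[A in P A]setIT -integral_indic//.
apply: ge0_le_integral => //.
- by apply/measurable_EFinP; exact: measurable_indic.
- exact/measurable_EFinP.
move=> z _; rewrite lee_fin indicE; case: (boolP (z \in A)) => [|_]; last exact: f0.
by rewrite inE; exact: fA.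
Qed.

(** * Gaussian tail bounds for degenerate quadratic forms *)

Section abstract_test.
Context (R : realType) (p ep : R) (p01 : 0 < p < 1) (ep0 : 0 < ep).

Let de := ep / 8.
Let q := gauss_quantile p.
Let k := Num.max 1 (3 / de).
Let K := 2 * k ^+ 3.

(** Error budget: the step function rises from 0 at q - 2 de to 1 before q - de, which is why k >= 3
    / de; smoothing then costs 4 de = ep / 2, and the replacement error 100 K [clt_rate] is at most
    the other ep / 2. *)
Definition clt_slack := de.
Definition clt_rate := Num.min 1 (ep / (200 * K)).

Let de0 : 0 < de. Proof. by rewrite divr_gt0. Qed.
Let k1 : 1 <= k. Proof. by rewrite le_max lexx. Qed.
Let K0 : 0 < K. Proof. by rewrite mulr_gt0// exprn_gt0// (lt_le_trans ltr01). Qed.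

Lemma clt_slack_gt0 : 0 < clt_slack. Proof. exact: de0. Qed.

Lemma clt_rate_gt0 : 0 < clt_rate.
Proof.
have h200 : 0 < 200 :> R by rewrite ltr0n.
by rewrite lt_min ltr01 (divr_gt0 ep0 (mulr_gt0 h200 K0)).
Qed.

(** The threshold x may lie below the quantile by [clt_slack]. That room is spent under the
    alternative, on the linear part and on the error of the mean. *)
Lemma clt_tail d (T : measurableType d) (P : probability T R) (I : finType)
  (w : I -> R) (e : I -> T -> R) (lam om kap a : R) (m : nat) :
  (forall i, measurable_fun setT (e i)) ->
  L1 P (fun z => sqnorm e z ^+ 2) -> \int[P]_z (sqnorm e z ^+ 2) <= kap ->
  (forall i, \int[P]_z e i z = 0) -> 0 <= lam -> 0 <= om ->
  (forall b, \int[P]_z (ip e b z ^+ 2) <= lam * n2 b) ->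
  (forall i, `|w i| <= om) -> 0 <= a ->
  (2 <= m)%N -> a ^+ 2 = 2 / (m%:R * (m%:R - 1)) ->
  `|hs2 P w e - 1| <= clt_rate ^+ 2 -> lam ^+ 2 * om ^+ 2 <= clt_rate ^+ 2 ->
  lam ^+ 2 * om ^+ 4 * kap <= clt_rate ^+ 2 * m%:R ->
  om ^+ 4 * kap ^+ 2 <= clt_rate ^+ 2 * m%:R ^+ 2 ->
  gauss4 R <= clt_rate ^+ 2 * m%:R ->
  forall x, q - clt_slack <= x ->
  (iid_law P m [set D : m.-tuple T | (x < a * pairsum (ker w e) D)%R] <= (1 - p + ep)%:E)%E.
Proof.
move=> me Ine hkap e0 lam0 om0 hlam hom a0 m2 ha hb hl hD hW hg x qx.
pose F := step_fun (q - 2 * de) k.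
have kge : 3 <= k * de by rewrite -ler_pdivrMr// le_max lexx orbT.
have F01 y : 0 <= F y <= 1 by exact: bstep01.
have tF y := step_taylor (q - 2 * de) y k1.
have cF : continuous F by apply: (taylor_continuous (K := K)) => y; do 2 eexists; exact: tF.
have maff : measurable_fun [set: R] (fun y : R => k * (y - (q - 2 * de))).
  by apply: measurable_funM => //; apply: measurable_funB => //; exact: measurable_id.
have mF1 : measurable_fun [set: R] (fun y => k * bstep1 (k * (y - (q - 2 * de)))).
  by apply: measurable_funM => //; exact: (measurableT_comp (@bstep1_measurable R) maff).
have mF2 : measurable_fun [set: R] (fun y => k ^+ 2 * bstep2 (k * (y - (q - 2 * de)))).
  by apply: measurable_funM => //; exact: (measurableT_comp (@bstep2_measurable R) maff).
have r1 : clt_rate <= 1 by rewrite ge_min lexx.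
have := lindeberg me Ine hkap e0 lam0 om0 hlam hom cF F01 mF1 mF2 tF a0 clt_rate_gt0
   m2 ha r1 hb hl hD hW hg.
have mF : measurable_fun [set: R] F by exact: continuous_measurable_fun.
have gF : gE F <= 1 - p + 2 * (2 * de).
  apply: (quantile_tail p01) => //; first by rewrite mulr_gt0.
  move=> y hy; apply: bstep_le0; rewrite pmulr_rle0; first by rewrite subr_le0.
  exact: lt_le_trans ltr01 k1.
have hK : 100 * K * clt_rate <= ep / 2.
  apply: (@le_trans _ _ (100 * K * (ep / (200 * K)))).
    apply: ler_wpM2l; first by apply: mulr_ge0 => //; exact: ltW.
    by rewrite /clt_rate ge_min lexx orbT.
  by rewrite le_eqVlt; apply/orP; left; apply/eqP; field; rewrite gt_eqF.
have mU : measurable_fun setT (fun D : m.-tuple T => a * pairsum (ker w e) D).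
  by apply: measurable_funM => //; exact: mseq_pairsum.
have mFU : measurable_fun setT (fun D : m.-tuple T => F (a * pairsum (ker w e) D)).
  exact: (measurableT_comp mF mU).
have LF : L1 (iid_law P m) (fun D : m.-tuple T => F (a * pairsum (ker w e) D)).
  by apply: (@L1_bounded _ _ _ _ _ 1) => // D; have /andP[? ?] := F01 (a * pairsum (ker w e) D); rewrite ger0_norm.
move=> h; apply: (le_trans (prob_le_integral (iid_law P m) _ mFU _ _)).
- rewrite (_ : [set _ | _] = (fun D : m.-tuple T => a * pairsum (ker w e) D) @^-1` `]x, +oo[).
    by rewrite -[X in measurable X]setTI; apply: mU.
  by apply/seteqP; split => D /=; rewrite in_itv/= andbT.
- by move=> D; have /andP[] := F01 (a * pairsum (ker w e) D).
- move=> D /= hx; rewrite /F /step_fun bstep_ge3//; apply: (le_trans kge).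
  apply: ler_wpM2l; first exact: le_trans ler01 k1.
  by move: qx; rewrite /clt_slack; lra.
rewrite EFin_Rintegral// lee_fin.
move: h; rewrite ler_norml => /andP[_].
set X := \int[_]_D _; move=> h0; have {}h0 : X - gE F <= 100 * K * clt_rate := h0.
have h4 : 4 * de = ep / 2 by rewrite /de; field.
by move: X (gE F) (100 * K * clt_rate) gF h0 hK h4 => X g r; lra.
Qed.

End abstract_test.

(** * Hoeffding decomposition *)

(** Each point has size - 1 partners, hence the factor of the linear part; the constant part counts
    the pairs. *)
Lemma pairsum_hoeffding d (T : measurableType d) (R : realType) (I : finType) (w th : I -> R)
    (e : I -> T -> R) (s : seq T) :
  pairsum (ker w (fun i z => e i z + th i)) s =
  pairsum (ker w e) s + ((size s)%:R - 1) * (\sum_(z <- s) ip e (fun i => w i * th i) z) +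
  (size s)%:R * ((size s)%:R - 1) / 2 * \sum_i w i * th i ^+ 2.
Proof.
elim: s => [|z s ih]; first by rewrite /= big_nil mulr0 !mul0r !addr0.
have kE z' : ker w (fun i z => e i z + th i) z z' = ker w e z z' +
  (ip e (fun i => w i * th i) z + ip e (fun i => w i * th i) z' + \sum_i w i * th i ^+ 2).
  by rewrite /ker /ip -!big_split; apply: eq_bigr => i _ /=; ring.
rewrite [LHS]/= ih (eq_bigr _ (fun z' _ => kE z')) !big_split /= big_cons.
have cE x : \sum_(i <- s) x = (size s)%:R * x :> R.
  by rewrite big_const_seq count_predT iter_addr_0 mulr_natl.
rewrite !cE -(natr1 (size s)).
move: (\sum_(i <- s) ker w e z i) (pairsum _ _) (ip _ _ z) (\sum_i _ * _ ^+ 2) (size s)%:R.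
by move: (\sum_(i <- s) ip _ _ i) => x1 x2 x3 x4 x5 x6; field.
Qed.

Lemma chebyshev2 d (T : measurableType d) (R : realType) (P : probability T R)
    (X : T -> R) (A : set T) (t v : R) : measurable A -> measurable_fun setT X -> 0 < t ->
  (forall z, A z -> t <= `|X z|) -> (\int[P]_z (X z ^+ 2)%:E <= v%:E)%E ->
  (P A <= (v / t ^+ 2)%:E)%E.
Proof.
move=> mA mX t0 hA hv.
have mX2 : measurable_fun setT (fun z => (t ^+ 2)^-1 * X z ^+ 2) by mfun.
apply: (le_trans (prob_le_integral P mA mX2 _ _)).
- by move=> z; rewrite mulr_ge0// ?invr_ge0 sqr_ge0.
- move=> z /hA h; rewrite mulrC ler_pdivlMr ?exprn_gt0// mul1r -(real_normK (num_real (X z))).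
  by rewrite lerXn2r ?nnegrE// ltW.
under eq_integral do rewrite EFinM.
rewrite ge0_integralZl//.
- by rewrite mulrC EFinM lee_wpmul2l// lee_fin invr_ge0 sqr_ge0.
- by apply/measurable_EFinP; mfun.
- by move=> z _; rewrite lee_fin sqr_ge0.
- by rewrite lee_fin invr_ge0 sqr_ge0.
Qed.

Section hoeffding.
Context d (T : measurableType d) (R : realType) (P : probability T R).
Context (I : finType) (w : I -> R) (e : I -> T -> R) (th : I -> R) (lam om kap : R).
Context (me : forall i, measurable_fun setT (e i))
  (Ine : L1 P (fun z => sqnorm e z ^+ 2)) (hkap : \int[P]_z (sqnorm e z ^+ 2) <= kap)
  (e_mean : forall i, \int[P]_z e i z = 0)
  (lam0 : 0 <= lam) (om0 : 0 <= om)
  (hlam : forall b, \int[P]_z (ip e b z ^+ 2) <= lam * n2 b)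
  (hom : forall i, 0 <= w i <= om).

Let hom' i : `|w i| <= om.
Proof. by have /andP[? ?] := hom i; rewrite ger0_norm. Qed.

(** Successive terms are orthogonal, so the second moment grows by the mean of [sumvar], at most k
    hs2, at each step. *)
Lemma Eiid_pairsum2 k : (Eiid P k (fun s => pairsum (ker w e) s ^+ 2)%R <=
  (k%:R * (k%:R - 1) / 2 * hs2 P w e)%:E)%E.
Proof.
have mp2 : mseq (fun s => pairsum (ker w e) s ^+ 2).
  by move=> n; apply: measurable_funX; exact: mseq_pairsum.
elim: k => [|k ih]; first by rewrite Eiid0 //= expr0n !mul0r.
apply: (@le_trans _ _ (Eiid P k (fun s => sumvar P w e s + pairsum (ker w e) s ^+ 2)%R)).
  apply: EiidS_le => //.
  - by move=> n; apply: measurable_funD; [exact: mseq_sumvar|exact: mp2].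
  - by move=> s; exact: sqr_ge0.
  - move=> s; set c := pairsum _ _.
    have L2 : L1 P (fun z => kersum w e s z ^+ 2) by apply: L1_ip2 Ine _.
    have L3 : L1 P (fun z => kersum w e s z) by apply: L1_ip Ine _.
    have hE z : pairsum (ker w e) (z :: s) ^+ 2 =
      (kersum w e s z ^+ 2 + (2 * c) * kersum w e s z) + c ^+ 2.
      by rewrite pairsum_cons -/c; ring.
    have hE' : (fun z => pairsum (ker w e) (z :: s) ^+ 2) =
      (fun z => (kersum w e s z ^+ 2 + (2 * c) * kersum w e s z) + c ^+ 2).
      by apply/funext.
    rewrite hE'; split.
      by apply: L1D; [apply: L1D => //; exact: L1Z|exact: L1_cst].
    rewrite RintD; [|by apply: L1D => //; exact: L1Z|exact: L1_cst].
    rewrite RintD; [|by []|exact: L1Z].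
    by rewrite (RintZ _ L3) (int_ip _ Ine)// mulr0 addr0 Rint_cst.
apply: (@le_trans _ _ ((k%:R * hs2 P w e)%:E + (k%:R * (k%:R - 1) / 2 * hs2 P w e)%:E)%E).
  rewrite EiidD//; [|exact: mseq_sumvar|exact: sumvar_ge0|by move=> s; exact: sqr_ge0].
  by apply: leeD => //; exact: (Eiid_sumvar me Ine e_mean lam0 om0).
by rewrite -EFinD lee_fin -natr1 le_eqVlt; apply/orP; left; apply/eqP; field.
Qed.

Context (m : nat) (a : R) (m2 : (2 <= m)%N) (a0 : 0 <= a)
  (ha : a ^+ 2 = 2 / (m%:R * (m%:R - 1))).

Let Q := \sum_i w i * th i ^+ 2.
Let mu := a * (m%:R * (m%:R - 1) / 2) * Q.
Let V (s : seq T) := a * pairsum (ker w (fun i z => e i z + th i)) s.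
Let D0 (s : seq T) := a * pairsum (ker w e) s.
Let Lin (s : seq T) := a * (m%:R - 1) * \sum_(z <- s) ip e (fun i => w i * th i) z.

Let m1 : 1 <= m%:R - 1 :> R.
Proof. by rewrite lerBrDr; rewrite (_ : 1 + 1 = 2%:R) ?ler_nat. Qed.

Lemma hoeffdingE (s : m.-tuple T) : V s = D0 s + Lin s + mu.
Proof. by rewrite /V pairsum_hoeffding size_tuple /D0 /Lin /mu /Q; ring. Qed.

Lemma hoeffding_mean_ge0 : 0 <= mu.
Proof.
rewrite /mu mulr_ge0//; last first.
  by apply: sumr_ge0 => i _; rewrite mulr_ge0 ?sqr_ge0//; have /andP[] := hom i.
by rewrite mulr_ge0// divr_ge0// mulr_ge0//; apply: le_trans m1.
Qed.

Let am : a ^+ 2 * (m%:R * (m%:R - 1) / 2) = 1.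
Proof.
have m0 : m%:R != 0 :> R by rewrite pnatr_eq0; case: (m) m2.
have m10 : m%:R - 1 != 0 :> R by rewrite gt_eqF// (lt_le_trans ltr01 m1).
by rewrite ha; field; rewrite m0 m10.
Qed.

Lemma int_degenerate_part2 : (\int[iid_law P m]_D (D0 D ^+ 2)%:E <= (hs2 P w e)%:E)%E.
Proof.
have mp2 : mseq (fun s => pairsum (ker w e) s ^+ 2).
  by move=> n; apply: measurable_funX; exact: mseq_pairsum.
rewrite (_ : (\int[_]_D _)%E = Eiid P m (fun s => a ^+ 2 * pairsum (ker w e) s ^+ 2)%R).
  rewrite (_ : hs2 P w e = a ^+ 2 * (m%:R * (m%:R - 1) / 2 * hs2 P w e)).
    apply: Eiid_leZ => //; [by move=> s; exact: sqr_ge0|exact: sqr_ge0|exact: Eiid_pairsum2].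
  by rewrite mulrA am mul1r.
by apply: eq_integral => D _; rewrite /D0 exprMn.
Qed.

(** Because 0 <= w <= om, w^2 <= om w, so the variance of the linear part is bounded by a multiple
    of mu and not of mu^2. This makes Chebyshev effective for large mu and the linear part
    negligible for bounded mu. The 3 comes from 2 a (m - 1) <= sqrt 8. *)
Lemma int_linear_part2 : (\int[iid_law P m]_D (Lin D ^+ 2)%:E <= (3 * (lam * om) * mu)%:E)%E.
Proof.
pose b i := w i * th i.
have Lb : L1 P (fun z => ip e b z ^+ 4) by apply: L1_ip4.
have mb : measurable_fun setT (ip e b) by exact: measurable_ip.
have hb : n2 b <= om * Q.
  rewrite /n2 /Q mulr_sumr; apply: ler_sum => i _; have /andP[w0 w1] := hom i.
  by rewrite /b exprMn expr2 -mulrA ler_wpM2r// mulr_ge0// sqr_ge0.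
rewrite (_ : (\int[_]_D _)%E = Eiid P m (fun s => (a * (m%:R - 1)) ^+ 2 *
    (\sum_(z <- s) ip e b z) ^+ 2)%R); last first.
  by apply: eq_integral => D _; rewrite /Lin exprMn.
have h1 : (Eiid P m (fun s => (a * (m%:R - 1)) ^+ 2 * (\sum_(z <- s) ip e b z) ^+ 2)%R <=
   ((a * (m%:R - 1)) ^+ 2 * (m%:R * \int[P]_z (ip e b z ^+ 2)))%:E)%E.
  apply: Eiid_leZ.
  - by move=> n; apply: measurable_funX; exact: mseq_sum.
  - by move=> s; exact: sqr_ge0.
  - exact: sqr_ge0.
  - by apply: Eiid_sum_sqr => //; exact: int_ip.
apply: (le_trans h1); rewrite lee_fin.
have Q0 : 0 <= Q by apply: sumr_ge0 => i _; rewrite mulr_ge0 ?sqr_ge0//; have /andP[] := hom i.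
have h2 : \int[P]_z (ip e b z ^+ 2) <= lam * (om * Q).
  by apply: (le_trans (hlam b)); rewrite ler_wpM2l.
have m0 : 0 <= m%:R :> R by [].
apply: (@le_trans _ _ ((a * (m%:R - 1)) ^+ 2 * (m%:R * (lam * (om * Q))))).
  by rewrite ler_wpM2l ?sqr_ge0// ler_wpM2l.
have -> : (a * (m%:R - 1)) ^+ 2 * (m%:R * (lam * (om * Q))) =
  2 * (a * (m%:R - 1)) * (lam * om) * mu.
  by rewrite /mu; field.
rewrite ler_wpM2r ?hoeffding_mean_ge0// ler_wpM2r ?mulr_ge0//.
have : (2 * (a * (m%:R - 1))) ^+ 2 <= 3 ^+ 2.
  have mp : 0 < m%:R :> R by rewrite ltr0n; case: (m) m2.
  have m10 : m%:R - 1 != 0 :> R by rewrite gt_eqF// (lt_le_trans ltr01 m1).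
  rewrite (_ : _ ^+ 2 = 4 * (a ^+ 2 * (m%:R - 1) ^+ 2)); last by ring.
  rewrite ha (_ : _ * (2 / _ * _) = 8 * (m%:R - 1) / m%:R); last first.
    by field; rewrite m10 gt_eqF.
  by rewrite ler_pdivrMr//; move: m1; lra.
by rewrite ler_pXn2r// nnegrE// !mulr_ge0//; apply: le_trans m1.
Qed.

Let mD0 : measurable_fun setT (fun D : m.-tuple T => D0 D).
Proof. by apply: measurable_funM => //; exact: mseq_pairsum. Qed.

Let mLin : measurable_fun setT (fun D : m.-tuple T => Lin D).
Proof. by apply: measurable_funM => //; apply: mseq_sum; exact: measurable_ip. Qed.

Lemma measurable_hoeffding : measurable_fun setT (fun D : m.-tuple T => V D).
Proof.
rewrite (_ : (fun D : m.-tuple T => V D) = fun D : m.-tuple T => D0 D + Lin D + mu).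
  by mfun.
by apply/funext => D; exact: hoeffdingE.
Qed.

Lemma hoeffding_chebyshev z : z < mu ->
  (iid_law P m [set D : m.-tuple T | (V D <= z)%R] <=
   (2 * (hs2 P w e + 3 * (lam * om) * mu) / (mu - z) ^+ 2)%:E)%E.
Proof.
move=> zmu; apply: (@chebyshev2 _ _ _ _ (fun D : m.-tuple T => D0 D + Lin D)).
- rewrite (_ : [set _ | _] = (fun D : m.-tuple T => V D) @^-1` `]-oo, z]).
    by rewrite -[X in measurable X]setTI; apply: measurable_hoeffding.
  by apply/seteqP; split => D /=; rewrite in_itv.
- by mfun.
- by rewrite subr_gt0.
- move=> D /=; rewrite hoeffdingE => h.
  by rewrite ler_normr; apply/orP; right; lra.
have hle D : (D0 D + Lin D) ^+ 2 <= 2 * D0 D ^+ 2 + 2 * Lin D ^+ 2.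
  have := sqr_ge0 (D0 D - Lin D).
  rewrite (_ : (D0 D - Lin D) ^+ 2 = 2 * D0 D ^+ 2 + 2 * Lin D ^+ 2 - (D0 D + Lin D) ^+ 2); last by ring.
  by rewrite subr_ge0.
apply: (@le_trans _ _ (\int[iid_law P m]_D (2 * D0 D ^+ 2 + 2 * Lin D ^+ 2)%:E)%E).
  apply: ge0_le_integral => //.
  - by move=> D _; rewrite lee_fin sqr_ge0.
  - by apply/measurable_EFinP; mfun.
  - by apply/measurable_EFinP; mfun.
  - by move=> D _; rewrite lee_fin.
under eq_integral do rewrite EFinD.
have hm (f : m.-tuple T -> R) : measurable_fun setT f ->
  measurable_fun setT (fun D : m.-tuple T => (2 * f D ^+ 2)%:E).
  by move=> mf; apply/measurable_EFinP; mfun.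
have hz (f : m.-tuple T -> R) v : measurable_fun setT f ->
  (\int[iid_law P m]_D (f D ^+ 2)%:E <= v%:E)%E ->
  (\int[iid_law P m]_D (2 * f D ^+ 2)%:E <= (2 * v)%:E)%E.
  move=> mf hv; under eq_integral do rewrite EFinM.
  rewrite ge0_integralZl//; [by rewrite EFinM lee_wpmul2l|by apply/measurable_EFinP; mfun|].
  by move=> D _; rewrite lee_fin sqr_ge0.
rewrite ge0_integralD//; [|by move=> D _; rewrite lee_fin mulr_ge0 ?sqr_ge0|exact: hm
   |by move=> D _; rewrite lee_fin mulr_ge0 ?sqr_ge0|exact: hm].
rewrite mulrDr EFinD; apply: leeD; apply: hz => //.
- exact: int_degenerate_part2.
- exact: int_linear_part2.
Qed.

(** Changing the sign of the weights preserves [hs2] and the bounds on the absolute weights, so the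
    lower tail follows from the upper-tail bound [clt_tail]. *)
Lemma pairsum_kerN s : pairsum (ker (fun i => - w i) e) s = - pairsum (ker w e) s.
Proof.
elim: s => [|z s ih] /=; first by rewrite oppr0.
rewrite ih opprD -sumrN; congr (_ + _); apply: eq_bigr => z' _.
by rewrite /ker /ip -sumrN; apply: eq_bigr => i _; rewrite !mulNr.
Qed.

Lemma hs2N : hs2 P (fun i => - w i) e = hs2 P w e.
Proof. by apply: eq_bigr => i _; apply: eq_bigr => j _; rewrite mulrNN. Qed.

Context (p ep : R) (p01 : 0 < p < 1) (ep0 : 0 < ep).
Local Notation rate := (clt_rate ep).
Local Notation slack := (clt_slack ep).
Context (hb : `|hs2 P w e - 1| <= rate ^+ 2) (hl : lam ^+ 2 * om ^+ 2 <= rate ^+ 2)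
  (hD : lam ^+ 2 * om ^+ 4 * kap <= rate ^+ 2 * m%:R)
  (hW : om ^+ 4 * kap ^+ 2 <= rate ^+ 2 * m%:R ^+ 2)
  (hg : gauss4 R <= rate ^+ 2 * m%:R).

Lemma hoeffding_lower_tail : 2 * gauss_quantile p - slack / 2 <= mu ->
  (iid_law P m [set D : m.-tuple T | (V D <= gauss_quantile p)%R] <=
   (1 - p + ep + 3 * (lam * om) * mu / (slack / 4) ^+ 2)%:E)%E.
Proof.
move=> hmu; have s0 := clt_slack_gt0 ep0.
set z := gauss_quantile p in hmu *.
pose A1 := [set D : m.-tuple T | (z - slack < a * pairsum (ker (fun i => - w i) e) D)%R].
pose A2 := [set D : m.-tuple T | (slack / 4 <= `|Lin D|)%R].
have mN : measurable_fun setT (fun D : m.-tuple T => a * pairsum (ker (fun i => - w i) e) D).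
  by apply: measurable_funM => //; exact: mseq_pairsum.
have mA1 : measurable A1.
  rewrite (_ : A1 = (fun D : m.-tuple T => a * pairsum (ker (fun i => - w i) e) D) @^-1` `]z - slack, +oo[).
    by rewrite -[X in measurable X]setTI; apply: mN.
  by apply/seteqP; split => D /=; rewrite in_itv/= andbT.
have mA2 : measurable A2.
  rewrite (_ : A2 = (fun D : m.-tuple T => `|Lin D|) @^-1` `[slack / 4, +oo[).
    by rewrite -[X in measurable X]setTI; apply: (measurableT_comp _ mLin).
  by apply/seteqP; split => D /=; rewrite in_itv/= andbT.
have mV : measurable [set D : m.-tuple T | (V D <= z)%R].
  rewrite (_ : [set _ | _] = (fun D : m.-tuple T => V D) @^-1` `]-oo, z]).
    by rewrite -[X in measurable X]setTI; apply: measurable_hoeffding.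
  by apply/seteqP; split => D /=; rewrite in_itv.
apply: (@le_trans _ _ (iid_law P m (A1 `|` A2))).
  apply: le_measure; rewrite ?inE//; first exact: measurableU.
  (* If the linear part stays below slack / 4, then D0 <= z + slack / 4 - mu <= -z + 3 slack / 4. *)
  move=> D /=; rewrite hoeffdingE => h; have [hL|hL] := leP (slack / 4) `|Lin D|; first by right.
  left; rewrite /A1 /= pairsum_kerN mulrN -/(D0 D).
  by move: hL; rewrite ltr_norml => /andP[? ?]; lra.
apply: (le_trans (measureU2 _ mA1 mA2)); rewrite EFinD; apply: leeD.
  apply: (clt_tail p01 ep0 me Ine hkap e_mean lam0 om0 hlam _ a0 m2 ha _ hl hD hW hg) => //.
    by move=> i; rewrite normrN.
  by rewrite hs2N.
apply: (chebyshev2 (X := fun D : m.-tuple T => Lin D)) => //; first by rewrite divr_gt0.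
exact: int_linear_part2.
Qed.

Lemma hoeffding_upper_tail : (forall i, th i = 0) ->
  (iid_law P m [set D : m.-tuple T | (gauss_quantile p < V D)%R] <= (1 - p + ep)%:E)%E.
Proof.
move=> th0; rewrite (_ : [set _ | _] =
    [set D : m.-tuple T | (gauss_quantile p < a * pairsum (ker w e) D)%R]); last first.
  rewrite /V (_ : (fun i z => e i z + th i) = e)//.
  by apply/funext => i; apply/funext => z; rewrite th0 addr0.
apply: (clt_tail p01 ep0 me Ine hkap e_mean lam0 om0 hlam _ a0 m2 ha hb hl hD hW hg) => //.
by rewrite lerBlDr lerDl ltW// clt_slack_gt0.
Qed.

End hoeffding.

(** * Moments of regression scores *)

Section L1_bounded_factor.
Context d (X : measurableType d) (R : realType) (P : {measure set X -> \bar R}).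

Lemma L1_norm (f : X -> R) : L1 P f -> L1 P (fun x => `|f x|).
Proof. by move=> /integrable_abse. Qed.

Lemma L1_Mbounded (f b : X -> R) (c : R) : L1 P f -> measurable_fun setT b ->
  (forall x, `|b x| <= c) -> L1 P (fun x => f x * b x).
Proof.
move=> Lf mb hb; apply: (L1_le _ (L1Z c (L1_norm Lf))).
  by have mf := L1_measurable Lf; mfun.
by move=> x; rewrite normrM mulrC ler_wpM2r.
Qed.

End L1_bounded_factor.

Section product_integral.
Context d1 d2 (X : measurableType d1) (Y : measurableType d2) (R : realType).
Context (P : probability X R) (Q : probability Y R).

Lemma L1_prodM (a : X -> R) (b : Y -> R) : L1 P a -> L1 Q b ->
  L1 (P \x Q)%E (fun z : X * Y => a z.1 * b z.2).
Proof.
move=> La Lb; have ma := L1_measurable La; have mb := L1_measurable Lb.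
have mab : measurable_fun setT (fun z : X * Y => a z.1 * b z.2).
  by apply: measurable_funM; [exact: (measurableT_comp ma measurable_fst)
    |exact: (measurableT_comp mb measurable_snd)].
apply/integrable12ltyP; first exact/measurable_EFinP.
rewrite (_ : (\int[P]_x _)%E = (\int[P]_x (\int[Q]_y `|b y| * `|a x|)%:E)%E).
  have L : L1 P (fun x => \int[Q]_y `|b y| * `|a x|) by apply: L1Z; exact: L1_norm.
  by rewrite (EFin_Rintegral L) ltry.
apply: eq_integral => x _.
under eq_integral do rewrite /= normrM EFinM.
rewrite ge0_integralZl_EFin//; last by apply/measurable_EFinP; exact: measurableT_comp.
by rewrite EFin_Rintegral ?EFinM 1?muleC//; exact: L1_norm.
Qed.

Lemma Rint_prodM (a : X -> R) (b : Y -> R) : L1 P a -> L1 Q b ->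
  \int[(P \x Q)%E]_z (a z.1 * b z.2) = \int[P]_x a x * \int[Q]_y b y.
Proof.
move=> La Lb; rewrite /Rintegral.
rewrite -[X in fine X = _](integral12_prod_meas1 (L1_prodM La Lb)) /=.
rewrite (_ : (\int[P]_x _)%E = (\int[P]_x ((\int[Q]_y b y) * a x)%:E)%E).
  by rewrite -/(Rintegral _ _ _) (RintZ _ La) mulrC.
apply: eq_integral => x _; rewrite /fubini_F /=.
under eq_integral do rewrite EFinM.
by rewrite integralZl// EFin_Rintegral// EFinM muleC.
Qed.

Lemma L1_fst (a : X -> R) : L1 P a -> L1 (P \x Q)%E (fun z : X * Y => a z.1).
Proof.
by move=> La; have := L1_prodM La (L1_cst Q 1); under [X in L1 _ X]eq_fun do rewrite mulr1.
Qed.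

Lemma Rint_fst (a : X -> R) : L1 P a -> \int[(P \x Q)%E]_z (a z.1) = \int[P]_x a x.
Proof.
move=> La; rewrite -[RHS]mulr1 -(Rint_cst Q 1) -(Rint_prodM La (L1_cst Q 1)).
by apply: eq_Rint => z; rewrite mulr1.
Qed.

End product_integral.

Section bessel.
Context d (X : measurableType d) (R : realType) (P : probability X R).
Context (I : finType) (psi : I -> X -> R).
Context (mpsi : forall i, measurable_fun setT (psi i))
  (psi2 : forall i, L1 P (fun t => psi i t ^+ 2))
  (psi_orth : forall i j, \int[P]_t (psi i t * psi j t) = (i == j)%:R).

Let psiM i j : L1 P (fun t => psi i t * psi j t). Proof. exact: L1M_sqr. Qed.

Lemma ip_sqrE (b : I -> R) t : ip psi b t ^+ 2 = \sum_i \sum_j b i * b j * (psi i t * psi j t).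
Proof.
rewrite expr2 /ip mulr_suml; apply: eq_bigr => i _.
by rewrite mulr_sumr; apply: eq_bigr => j _; ring.
Qed.

Lemma L1_ip_sqr (b : I -> R) : L1 P (fun t => ip psi b t ^+ 2).
Proof.
under [X in L1 _ X]eq_fun do rewrite ip_sqrE.
by apply: L1_sum => i; apply: L1_sum => j; exact: L1Z.
Qed.

Lemma int_ip_sqr (b : I -> R) : \int[P]_t (ip psi b t ^+ 2) = n2 b.
Proof.
under eq_Rintegral do rewrite ip_sqrE.
rewrite Rintegral_sum; last by move=> i; apply: L1_sum => j; exact: L1Z.
apply: eq_bigr => i _; rewrite Rintegral_sum; last by move=> j; exact: L1Z.
rewrite (bigD1 i)//= big1 ?addr0.
  by rewrite (RintZ _ (psiM _ _)) psi_orth eqxx mulr1 expr2.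
by move=> j ji; rewrite (RintZ _ (psiM _ _)) psi_orth eq_sym (negbTE ji) mulr0.
Qed.

Lemma bessel (u : X -> R) : measurable_fun setT u -> L1 P (fun t => u t ^+ 2) ->
  \sum_i (\int[P]_t (u t * psi i t)) ^+ 2 <= \int[P]_t (u t ^+ 2).
Proof.
move=> mu u2; pose c i := \int[P]_t (u t * psi i t).
have Lu i : L1 P (fun t => u t * psi i t) by exact: L1M_sqr.
have uE t : (u t - ip psi c t) ^+ 2 =
   (u t ^+ 2 - 2 * (\sum_i c i * (u t * psi i t))) + ip psi c t ^+ 2.
  rewrite (_ : \sum_i c i * (u t * psi i t) = u t * ip psi c t); first ring.
  by rewrite /ip mulr_sumr; apply: eq_bigr => i _; ring.
have h : 0 <= \int[P]_t ((u t - ip psi c t) ^+ 2) by apply: Rint_ge0 => t; exact: sqr_ge0.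
have Ls : L1 P (fun t => \sum_i c i * (u t * psi i t)).
  by apply: L1_sum => i; exact: L1Z.
rewrite (eq_Rint _ uE) RintD in h; [|by apply: L1B => //; exact: L1Z|exact: L1_ip_sqr].
rewrite RintB in h; [|by []|exact: L1Z].
rewrite (RintZ _ Ls) Rintegral_sum in h; last by move=> i; exact: L1Z.
rewrite int_ip_sqr in h.
have e1 : \sum_i \int[P]_t (c i * (u t * psi i t)) = n2 c.
  by apply: eq_bigr => i _; rewrite (RintZ _ (Lu i)) expr2.
rewrite e1 in h; rewrite -/(n2 c); lra.
Qed.

End bessel.

Lemma sqr_add_le (R : realDomainType) (x y : R) : (x + y) ^+ 2 <= 2 * x ^+ 2 + 2 * y ^+ 2.
Proof.
have := sqr_ge0 (x - y).
rewrite (_ : (x - y) ^+ 2 = 2 * x ^+ 2 + 2 * y ^+ 2 - (x + y) ^+ 2); last by ring.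
by rewrite subr_ge0.
Qed.

Lemma pow4_add_le (R : realDomainType) (x y : R) : (x + y) ^+ 4 <= 8 * x ^+ 4 + 8 * y ^+ 4.
Proof.
rewrite (_ : (x + y) ^+ 4 = ((x + y) ^+ 2) ^+ 2); last by rewrite -exprM.
have h := sqr_add_le x y; have h2 := sqr_add_le (2 * x ^+ 2) (2 * y ^+ 2).
apply: (@le_trans _ _ ((2 * x ^+ 2 + 2 * y ^+ 2) ^+ 2)).
  by rewrite lerXn2r ?nnegrE ?sqr_ge0//; have := sqr_ge0 x; have := sqr_ge0 y; lra.
by apply: (le_trans h2); rewrite (_ : 2 * _ + _ = 8 * x ^+ 4 + 8 * y ^+ 4) //; ring.
Qed.

Section regression_moments.
Context d (X : measurableType d) (R : realType) (P : probability X R).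
Context dY (Y : measurableType dY) (nu : probability Y R) (xi : Y -> R) (I : finType).
Context (psi : I -> X -> R) (g : X -> R) (B G mu4 : R).
Context (mxi : measurable_fun setT xi) (xi4 : L1 nu (fun y => xi y ^+ 4))
  (xi_mean : \int[nu]_y xi y = 0) (xi_var : \int[nu]_y (xi y ^+ 2) = 1)
  (hmu4 : \int[nu]_y (xi y ^+ 4) <= mu4).
Context (mpsi : forall i, measurable_fun setT (psi i))
  (psi_orth : forall i j, \int[P]_t (psi i t * psi j t) = (i == j)%:R)
  (B1 : 1 <= B) (psiB : forall t, sqnorm psi t <= B).
Context (mg : measurable_fun setT g) (g4 : L1 P (fun t => g t ^+ 4))
  (hG : \int[P]_t (g t ^+ 4) <= G).

Definition signal i : R := \int[P]_t (g t * psi i t).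
(** To be used with [g] equal to the regression function minus a frozen value of the pilot; the pair
    sum of the kernel built on [score] is then the U-statistic up to its scale. *)
Definition score i (z : X * Y) : R := (g z.1 + xi z.2) * psi i z.1.
Definition cscore i z : R := score i z - signal i.

Local Notation PQ := (P \x nu)%E.

Let G0 : 0 <= G.
Proof. by apply: le_trans hG; apply: Rint_ge0 => t; exact: exprn_even_ge0. Qed.

Let B0 : 0 <= B. Proof. exact: le_trans B1. Qed.

Let nuX k : (k <= 4)%N -> L1 nu (fun y => xi y ^+ k).
Proof. exact: (L1_pow_le4 mxi xi4). Qed.

Let nuX1 : L1 nu xi. Proof. exact: (nuX (isT : 1 <= 4)%N). Qed.

Let gX k : (k <= 4)%N -> L1 P (fun t => g t ^+ k).
Proof. exact: (L1_pow_le4 mg g4). Qed.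

Let g1 : L1 P g. Proof. exact: (gX (isT : 1 <= 4)%N). Qed.

Lemma psi_bounded i t : `|psi i t| <= B.
Proof using B1 psiB.
have h : `|psi i t| ^+ 2 <= B.
  rewrite real_normK ?num_real//; apply: le_trans (psiB t).
  by rewrite /sqnorm (bigD1 i)//= lerDl; apply: sumr_ge0 => j _; exact: sqr_ge0.
by rewrite -(@ler_pXn2r _ 2)// ?nnegrE//; apply: (le_trans h); rewrite expr2 ler_peMl.
Qed.

Let psi2 i : L1 P (fun t => psi i t ^+ 2).
Proof.
apply: (@L1_bounded _ _ _ _ _ (B ^+ 2)); first by mfun.
by move=> t; rewrite normrX lerXn2r ?nnegrE// psi_bounded.
Qed.

Section bounded_factors.
Context (a b : X -> R) (ca cb : R) (ma : measurable_fun setT a) (mb : measurable_fun setT b)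
  (ba : forall t, `|a t| <= ca) (bb : forall t, `|b t| <= cb).

Lemma L1_score1 : L1 PQ (fun z => (g z.1 + xi z.2) * a z.1).
Proof.
rewrite (_ : (fun z : X * Y => _) =
  (fun z => g z.1 * a z.1 + a z.1 * xi z.2)); last by apply/funext => z; ring.
apply: L1D; first by apply: (L1_fst nu (a := fun t => g t * a t)); exact: (L1_Mbounded g1 ma ba).
by apply: L1_prodM => //; exact: (L1_bounded P ma ba).
Qed.

Lemma int_score1 : \int[PQ]_z ((g z.1 + xi z.2) * a z.1) = \int[P]_t (g t * a t).
Proof.
have La := L1_bounded P ma ba; have Lga := L1_Mbounded g1 ma ba.
rewrite (eq_Rint (fun z => g z.1 * a z.1 + a z.1 * xi z.2)); last by move=> z; ring.
rewrite RintD; [|exact: (L1_fst nu Lga)|exact: L1_prodM].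
by rewrite (Rint_fst nu Lga) (Rint_prodM La nuX1) xi_mean mulr0 addr0.
Qed.

Let mab : measurable_fun setT (fun t => a t * b t). Proof. by mfun. Qed.
Let bab t : `|a t * b t| <= ca * cb. Proof. by rewrite normrM ler_pM. Qed.

Let score2E (z : X * Y) : (g z.1 + xi z.2) ^+ 2 * (a z.1 * b z.1) =
  g z.1 ^+ 2 * (a z.1 * b z.1) + 2 * ((g z.1 * (a z.1 * b z.1)) * xi z.2) +
  (a z.1 * b z.1) * xi z.2 ^+ 2.
Proof. by ring. Qed.

Let Lab : L1 P (fun t => a t * b t). Proof. exact: (L1_bounded P mab bab). Qed.
Let Lgab : L1 P (fun t => g t * (a t * b t)). Proof. exact: (L1_Mbounded g1 mab bab). Qed.
Let Lg2ab : L1 P (fun t => g t ^+ 2 * (a t * b t)).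
Proof. exact: (L1_Mbounded (gX (isT : 2 <= 4)%N) mab bab). Qed.
Let L1_1 := L1_fst nu Lg2ab.
Let L1_2 := L1_prodM Lgab nuX1.
Let L1_3 := L1_prodM Lab (nuX (isT : 2 <= 4)%N).

Lemma L1_score2 : L1 PQ (fun z => (g z.1 + xi z.2) ^+ 2 * (a z.1 * b z.1)).
Proof.
under [X in L1 _ X]eq_fun do rewrite score2E.
by apply: L1D; [apply: L1D; [exact: L1_1|exact: (L1Z 2 L1_2)]|exact: L1_3].
Qed.

Lemma int_score2 : \int[PQ]_z ((g z.1 + xi z.2) ^+ 2 * (a z.1 * b z.1)) =
  \int[P]_t (g t ^+ 2 * (a t * b t)) + \int[P]_t (a t * b t).
Proof.
rewrite (eq_Rint _ score2E).
rewrite RintD; [|by apply: L1D; [exact: L1_1|exact: (L1Z 2 L1_2)]|exact: L1_3].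
rewrite RintD; [|exact: L1_1|exact: (L1Z 2 L1_2)].
rewrite (RintZ _ L1_2) (Rint_fst nu Lg2ab) (Rint_prodM Lgab nuX1) xi_mean.
by rewrite (Rint_prodM Lab (nuX (isT : 2 <= 4)%N)) xi_var !mulr0 addr0 mulr1.
Qed.

End bounded_factors.

Lemma measurable_score i : measurable_fun setT (score i).
Proof.
apply: measurable_funM; last exact: (measurableT_comp (mpsi i) measurable_fst).
by apply: measurable_funD; [exact: (measurableT_comp mg measurable_fst)
  |exact: (measurableT_comp mxi measurable_snd)].
Qed.

Lemma measurable_cscore i : measurable_fun setT (cscore i).
Proof. by apply: measurable_funB => //; exact: measurable_score. Qed.

Lemma cscore_mean i : \int[PQ]_z cscore i z = 0.
Proof.
have h := L1_score1 (mpsi i) (psi_bounded i).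
rewrite /cscore RintB; [|exact: h|exact: L1_cst].
by rewrite (int_score1 (mpsi i) (psi_bounded i)) Rint_cst subrr.
Qed.

Lemma ip_bounded (b : I -> R) t : `|ip psi b t| <= (\sum_i `|b i|) * B.
Proof.
rewrite /ip mulr_suml; apply: (le_trans (ler_norm_sum _ _ _)).
by apply: ler_sum => i _; rewrite normrM ler_wpM2l// psi_bounded.
Qed.

Lemma ip_signal (b : I -> R) : \int[P]_t (g t * ip psi b t) = \sum_i b i * signal i.
Proof.
have L i : L1 P (fun t => g t * psi i t) := L1_Mbounded g1 (mpsi i) (psi_bounded i).
rewrite (eq_Rint (fun t => \sum_i b i * (g t * psi i t))); last first.
  by move=> t; rewrite /ip mulr_sumr; apply: eq_bigr => i _; ring.
rewrite Rintegral_sum; last by move=> i; exact: L1Z.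
by apply: eq_bigr => i _; rewrite (RintZ _ (L i)).
Qed.

Lemma int_g2_le : \int[P]_t (g t ^+ 2) <= Num.sqrt G.
Proof.
have h : (\int[P]_t (g t ^+ 2)) ^+ 2 <= G.
  apply: le_trans hG.
  have := @Rint_cauchy_schwarz _ _ _ P (fun t => g t ^+ 2) (fun=> 1).
  under eq_Rintegral do rewrite mulr1.
  under [X in _ -> _ -> _ -> _ -> _ <= X * _]eq_Rintegral do rewrite -exprM.
  under [X in _ -> _ -> _ -> _ -> _ <= _ * X]eq_Rintegral do rewrite expr1n.
  rewrite Rint_cst mulr1; apply; [by mfun|exact: measurable_cst| |].
    by under [X in L1 _ X]eq_fun do rewrite -exprM.
  by under [X in L1 _ X]eq_fun do rewrite expr1n; exact: L1_cst.
rewrite -(ler_sqrt _ G0) sqrtr_sqr ger0_norm in h => //.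
by apply: Rint_ge0 => t; exact: sqr_ge0.
Qed.

Lemma sum_signal2_le : \sum_i signal i ^+ 2 <= Num.sqrt G.
Proof.
by apply: le_trans int_g2_le; apply: bessel => //; exact: (gX (isT : 2 <= 4)%N).
Qed.

(** Bound on the largest eigenvalue of the covariance of the scores: the noise contributes 1 by
    orthonormality, the signal sqrt (G B) by Cauchy-Schwarz and the pointwise bound [B]. *)
Definition score_lam : R := 1 + Num.sqrt (G * B).

Lemma ip_cscoreE b z : ip cscore b z = (g z.1 + xi z.2) * ip psi b z.1 - \sum_i b i * signal i.
Proof.
rewrite /ip mulr_sumr -sumrB; apply: eq_bigr => i _; rewrite /cscore /score; ring.
Qed.

Lemma int_ip_cscore2 b : \int[PQ]_z (ip cscore b z ^+ 2) <= score_lam * n2 b.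
Proof.
have mv : measurable_fun setT (ip psi b) by exact: measurable_ip.
have bv := ip_bounded b.
set c := \sum_i b i * signal i.
have L2 := L1_score2 mv mv bv bv; have Lone := L1_score1 mv bv.
have E2 := int_score2 mv mv bv bv; have Eone := int_score1 mv bv.
rewrite (eq_Rint (fun z => ((g z.1 + xi z.2) ^+ 2 * (ip psi b z.1 * ip psi b z.1)
  - (2 * c) * ((g z.1 + xi z.2) * ip psi b z.1)) + c ^+ 2)); last first.
  by move=> z; rewrite ip_cscoreE -/c; ring.
rewrite RintD; [|apply: L1B; [exact: L2|exact: (L1Z _ Lone)]|exact: L1_cst].
rewrite RintB; [|exact: L2|exact: (L1Z _ Lone)].
rewrite (RintZ _ Lone) Rint_cst E2 Eone ip_signal -/c.
have e2 : \int[P]_t (ip psi b t * ip psi b t) = n2 b.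
  by rewrite -(int_ip_sqr mpsi psi2 psi_orth); apply: eq_Rint => t; rewrite expr2.
rewrite e2.
have n20 : 0 <= n2 b by exact: n2_ge0.
have mv2 : measurable_fun setT (fun t => ip psi b t ^+ 2) by mfun.
have Lv4 : L1 P (fun t => (ip psi b t ^+ 2) ^+ 2).
  apply: (@L1_bounded _ _ _ _ _ ((((\sum_i `|b i|) * B) ^+ 2) ^+ 2)); first by mfun.
  move=> t; rewrite !normrX; apply: lerXn2r; rewrite ?nnegrE ?sqr_ge0//.
  by rewrite lerXn2r ?nnegrE// (le_trans _ (bv t)).
have h4 : \int[P]_t ((ip psi b t ^+ 2) ^+ 2) <= B * n2 b ^+ 2.
  have Lv2 := L1_ip_sqr mpsi psi2 b.
  apply: (@le_trans _ _ (\int[P]_t (n2 b * B * ip psi b t ^+ 2))).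
    apply: le_Rint => //; first exact: L1Z.
    move=> t; rewrite expr2 ler_wpM2r ?sqr_ge0//; apply: (le_trans (ip_sqr_le _ _ _)).
    by rewrite ler_wpM2l.
  by rewrite (RintZ _ Lv2) int_ip_sqr// le_eqVlt; apply/orP; left; apply/eqP; ring.
have Lg4 : L1 P (fun t => (g t ^+ 2) ^+ 2).
  by under [X in L1 _ X]eq_fun do rewrite -exprM.
have h5 : \int[P]_t (g t ^+ 2 * ip psi b t ^+ 2) <= Num.sqrt (G * B) * n2 b.
  rewrite -(@ler_pXn2r _ 2)// ?nnegrE; last first.
  - by rewrite mulr_ge0// sqrtr_ge0.
  - by apply: Rint_ge0 => t; rewrite mulr_ge0// sqr_ge0.
  rewrite exprMn sqr_sqrtr ?mulr_ge0// -mulrA.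
  have mg2 : measurable_fun setT (fun t => g t ^+ 2) by mfun.
  apply: (le_trans (Rint_cauchy_schwarz mg2 mv2 Lg4 Lv4)).
  apply: ler_pM => //.
  - by apply: Rint_ge0 => t; exact: sqr_ge0.
  - by apply: Rint_ge0 => t; exact: sqr_ge0.
  - by rewrite (eq_Rint (fun t => g t ^+ 4))// => t; rewrite -exprM.
rewrite /score_lam mulrDl mul1r.
under eq_Rintegral do rewrite -expr2.
by have := sqr_ge0 c; lra.
Qed.

(** The squared norm of the centred scores is at most 2 B (g + xi)^2 plus twice the squared norm of
    the signal. Squaring gives 8 B^2 (g + xi)^4 + 8 G, and the fourth moment of g + xi is at most 8
    (G + mu4). *)
Definition score_kap : R := 64 * B ^+ 2 * (G + mu4) + 8 * G.

Lemma score_pow4 : L1 PQ (fun z => (g z.1 + xi z.2) ^+ 4) /\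
  \int[PQ]_z ((g z.1 + xi z.2) ^+ 4) <= 8 * (G + mu4).
Proof.
have La := L1_fst nu g4; have Lb := L1_prodM (L1_cst P 1) xi4.
have Lc : L1 PQ (fun z => 8 * g z.1 ^+ 4 + 8 * (1 * xi z.2 ^+ 4)).
  by apply: L1D; [exact: (L1Z _ La)|exact: (L1Z _ Lb)].
have hle (z : X * Y) :
    (g z.1 + xi z.2) ^+ 4 <= 8 * g z.1 ^+ 4 + 8 * (1 * xi z.2 ^+ 4).
  by rewrite mul1r; exact: pow4_add_le.
have Ld : L1 PQ (fun z => (g z.1 + xi z.2) ^+ 4).
  apply: (L1_le _ Lc); last by move=> z; rewrite ger0_norm ?exprn_even_ge0.
  apply: measurable_funX; apply: measurable_funD; last exact: (measurableT_comp mxi measurable_snd).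
  exact: (measurableT_comp mg measurable_fst).
split=> //; apply: (le_trans (le_Rint Ld Lc hle)).
rewrite RintD; [|exact: (L1Z _ La)|exact: (L1Z _ Lb)].
rewrite (RintZ _ La) (RintZ _ Lb) (Rint_fst nu g4) (Rint_prodM (L1_cst P 1) xi4) Rint_cst.
by move: hG hmu4; lra.
Qed.

Lemma cscore_sqnorm2 : L1 PQ (fun z => sqnorm cscore z ^+ 2) /\
  \int[PQ]_z (sqnorm cscore z ^+ 2) <= score_kap.
Proof.
have [L4 h4] := score_pow4.
set th2 := \sum_i signal i ^+ 2.
have th20 : 0 <= th2 by apply: sumr_ge0 => i _; exact: sqr_ge0.
have th4 : th2 ^+ 2 <= G.
  by rewrite -[leRHS]sqr_sqrtr// lerXn2r ?nnegrE ?sqrtr_ge0// sum_signal2_le.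
have hle z : sqnorm cscore z <= 2 * (B * (g z.1 + xi z.2) ^+ 2) + 2 * th2.
  apply: (@le_trans _ _ (\sum_i (2 * ((g z.1 + xi z.2) ^+ 2 * psi i z.1 ^+ 2) + 2 * signal i ^+ 2))).
    apply: ler_sum => i _; rewrite /cscore /score.
    apply: (le_trans (sqr_add_le _ _)).
    by rewrite sqrrN exprMn.
  rewrite big_split/= -!mulr_sumr lerD2r ler_wpM2l//.
  by rewrite mulrC; apply: ler_wpM2r; [exact: sqr_ge0|exact: psiB].
have hle2 z : sqnorm cscore z ^+ 2 <= 8 * B ^+ 2 * (g z.1 + xi z.2) ^+ 4 + 8 * G.
  apply: (@le_trans _ _ ((2 * (B * (g z.1 + xi z.2) ^+ 2) + 2 * th2) ^+ 2)).
    by rewrite lerXn2r ?nnegrE ?sqnorm_ge0// addr_ge0// mulr_ge0// mulr_ge0// sqr_ge0.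
  apply: (le_trans (sqr_add_le _ _)).
  apply: lerD; first by rewrite le_eqVlt; apply/orP; left; apply/eqP; ring.
  by rewrite exprMn; move: th4; lra.
have Lr : L1 PQ (fun z => 8 * B ^+ 2 * (g z.1 + xi z.2) ^+ 4 + 8 * G).
  by apply: L1D; [exact: (L1Z _ L4)|exact: L1_cst].
have Ls : L1 PQ (fun z => sqnorm cscore z ^+ 2).
  apply: (L1_le _ Lr); last by move=> z; rewrite ger0_norm ?sqr_ge0.
  apply: measurable_funX; apply: measurable_sum => i; apply: measurable_funX.
  exact: measurable_cscore.
split=> //; apply: (le_trans (le_Rint Ls Lr hle2)).
rewrite RintD; [|exact: (L1Z _ L4)|exact: L1_cst].
rewrite (RintZ _ L4) Rint_cst /score_kap lerD2r.
rewrite (_ : 64 * B ^+ 2 * (G + mu4) = 8 * B ^+ 2 * (8 * (G + mu4))); last by ring.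
by rewrite ler_wpM2l// mulr_ge0// sqr_ge0.
Qed.

Let gam i j := \int[P]_t (g t ^+ 2 * (psi i t * psi j t)).

Lemma cov_cscore i j : cov PQ cscore i j = (i == j)%:R + (gam i j - signal i * signal j).
Proof.
have mi := mpsi i; have mj := mpsi j; have bi := psi_bounded i; have bj := psi_bounded j.
have L2 := L1_score2 mi mj bi bj; have Li := L1_score1 mi bi; have Lj := L1_score1 mj bj.
rewrite /cov (eq_Rint (fun z => (((g z.1 + xi z.2) ^+ 2 * (psi i z.1 * psi j z.1)
  - signal j * ((g z.1 + xi z.2) * psi i z.1)) - signal i * ((g z.1 + xi z.2) * psi j z.1))
  + signal i * signal j)); last by move=> z; rewrite /cscore /score; ring.
have L3 := L1B L2 (L1Z (signal j) Li).
have L4 := L1B L3 (L1Z (signal i) Lj).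
rewrite (RintD L4 (L1_cst _ _)) (RintB L3 (L1Z _ Lj)) (RintB L2 (L1Z _ Li)).
rewrite (RintZ _ Li) (RintZ _ Lj) Rint_cst (int_score2 mi mj bi bj) (int_score1 mi bi) (int_score1 mj bj) psi_orth -/(signal i) -/(signal j) -/(gam i j).
by ring.
Qed.

Lemma sum_gam_diag : \sum_i gam i i <= B * Num.sqrt G.
Proof.
have Lg2 := gX (isT : 2 <= 4)%N.
have L i : L1 P (fun t => g t ^+ 2 * (psi i t * psi i t)).
  apply: (L1_Mbounded (c := B ^+ 2) Lg2); first by mfun.
  by move=> t; rewrite normrM expr2 ler_pM ?psi_bounded.
rewrite /gam -Rintegral_sum//.
apply: (@le_trans _ _ (\int[P]_t (B * g t ^+ 2))); last first.
  by rewrite (RintZ _ Lg2) ler_wpM2l// int_g2_le.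
apply: le_Rint; [exact: L1_sum|exact: L1Z|move=> t].
rewrite -mulr_sumr mulrC ler_wpM2r ?sqr_ge0//.
by apply: le_trans (psiB t); rewrite /sqnorm; under eq_bigr do rewrite -expr2.
Qed.

(** For fixed i, the row of [gam] lists the coefficients of g^2 psi_i, so Bessel applies row by row;
    summing psi_i^2 over i costs only [B]. *)
Lemma sum_gam2 : \sum_i \sum_j gam i j ^+ 2 <= B * G.
Proof.
have L i : L1 P (fun t => g t ^+ 4 * psi i t ^+ 2).
  apply: (L1_Mbounded (c := B ^+ 2) g4); first by mfun.
  by move=> t; rewrite normrX lerXn2r ?nnegrE ?psi_bounded.
have L' i : L1 P (fun t => (g t ^+ 2 * psi i t) ^+ 2).
  under [X in L1 _ X]eq_fun do rewrite exprMn -exprM; exact: L.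
apply: (@le_trans _ _ (\sum_i \int[P]_t (g t ^+ 4 * psi i t ^+ 2))).
  apply: ler_sum => i _; rewrite (eq_Rint (fun t => (g t ^+ 2 * psi i t) ^+ 2)); last first.
    by move=> t; rewrite exprMn -exprM.
  rewrite /gam; under eq_bigr => j _ do under eq_Rintegral do rewrite mulrA.
  by apply: bessel => //; mfun.
rewrite -Rintegral_sum//; apply: (@le_trans _ _ (\int[P]_t (B * g t ^+ 4))); last first.
  by rewrite (RintZ _ g4) ler_wpM2l.
apply: le_Rint; [exact: L1_sum|exact: L1Z|move=> t].
by rewrite -mulr_sumr mulrC ler_wpM2r ?exprn_even_ge0// psiB.
Qed.

(** The covariance of the scores is the identity, due to the unit noise, plus a matrix that vanishes
    with the fourth moment G of the residual signal. The identity alone would give exactly sum w^2 =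
    1. *)
Lemma hs2_cscore (w : I -> R) (om : R) : \sum_i w i ^+ 2 = 1 ->
  (forall i, `|w i| <= om) ->
  `|hs2 PQ w cscore - 1| <= 4 * (om ^+ 2 * B) * (Num.sqrt G + G).
Proof.
move=> w1 hw; pose r i j := gam i j - signal i * signal j.
have sG : 0 <= Num.sqrt G by exact: sqrtr_ge0.
have hsum : hs2 PQ w cscore - 1 =
    2 * (\sum_i w i ^+ 2 * r i i) + \sum_i \sum_j w i * w j * r i j ^+ 2.
  rewrite /hs2 -[X in _ - X]w1 [in RHS]mulr_sumr -sumrB -big_split /=; apply: eq_bigr => i _.
  rewrite (bigD1 i)//= [in RHS](bigD1 i)//= cov_cscore eqxx -/(r i i).
  rewrite (eq_bigr (fun j => w i * w j * r i j ^+ 2)) /=; last first.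
    by move=> j ji; rewrite cov_cscore eq_sym (negbTE ji) add0r.
  by move: (\sum_(j | j != i) _) (r i i) => S x; ring.
have ww i j : `|w i * w j| <= om ^+ 2 by rewrite normrM expr2 ler_pM.
have th := sum_signal2_le.
have gd0 i : 0 <= gam i i.
  by apply: Rint_ge0 => t; rewrite mulr_ge0 ?sqr_ge0// -expr2 sqr_ge0.
have om2 : 0 <= om ^+ 2 by exact: sqr_ge0.
have h1 : `|\sum_i w i ^+ 2 * r i i| <= om ^+ 2 * ((B + 1) * Num.sqrt G).
  apply: (le_trans (ler_norm_sum _ _ _)).
  apply: (@le_trans _ _ (\sum_i om ^+ 2 * (gam i i + signal i ^+ 2))).
    apply: ler_sum => i _; rewrite normrM; apply: ler_pM => //; first by rewrite expr2.
    rewrite /r -expr2; apply: (le_trans (ler_normB _ _)).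
    by rewrite !ger0_norm ?sqr_ge0.
  rewrite -mulr_sumr ler_wpM2l// big_split /=.
  by rewrite mulrDl mul1r; apply: lerD => //; exact: sum_gam_diag.
have h2 : `|\sum_i \sum_j w i * w j * r i j ^+ 2| <= om ^+ 2 * (2 * (B * G) + 2 * G).
  apply: (le_trans (ler_norm_sum _ _ _)).
  apply: (@le_trans _ _ (\sum_i \sum_j om ^+ 2 * (2 * gam i j ^+ 2 + 2 * (signal i ^+ 2 * signal j ^+ 2)))).
    apply: ler_sum => i _; apply: (le_trans (ler_norm_sum _ _ _)); apply: ler_sum => j _.
    rewrite normrM; apply: ler_pM => //; rewrite ger0_norm ?sqr_ge0// /r.
    by apply: (le_trans (sqr_add_le _ _)); rewrite sqrrN exprMn.
  under eq_bigr do rewrite -mulr_sumr big_split /= -!mulr_sumr.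
  rewrite -mulr_sumr big_split /= -!mulr_sumr ler_wpM2l//.
  apply: lerD; rewrite ler_wpM2l//; first exact: sum_gam2.
  rewrite -mulr_suml -expr2 -[leRHS]sqr_sqrtr// lerXn2r ?nnegrE//.
  by apply: sumr_ge0 => i _; exact: sqr_ge0.
rewrite hsum; apply: (le_trans (ler_normD _ _)); rewrite normrM (ger0_norm (ler0n _ _)).
have h3 : om ^+ 2 * ((B + 1) * Num.sqrt G) <= 2 * (om ^+ 2 * B) * Num.sqrt G.
  rewrite (_ : 2 * _ * _ = om ^+ 2 * ((B + B) * Num.sqrt G)); last by ring.
  by rewrite ler_wpM2l// ler_wpM2r// lerD2l.
have h4 : om ^+ 2 * (2 * (B * G) + 2 * G) <= 4 * (om ^+ 2 * B) * G.
  rewrite (_ : 4 * _ * _ = om ^+ 2 * (2 * (B * G) + 2 * (B * G))); last by ring.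
  by rewrite ler_wpM2l// lerD2l ler_wpM2l// ler_peMl.
by rewrite mulrDr; move: h1 h2 h3 h4; lra.
Qed.

End regression_moments.

(** * The test for a fixed signal *)

Lemma score_lam_sqr_le (R : rcfType) (B G : R) : 0 <= G -> 0 <= B ->
  (1 + Num.sqrt (G * B)) ^+ 2 <= 2 + 2 * (G * B).
Proof.
move=> G0 B0; apply: (le_trans (sqr_add_le _ _)).
by rewrite sqr_sqrtr ?mulr_ge0// expr1n mulr1.
Qed.

(** Reduces the five hypotheses of the normal approximation to smallness of G, om^2 and B / m, with
    a threshold that depends on the design only through [b0]. *)
Lemma small_design (R : realType) (et b0 mu4 g4 : R) :
  0 < et <= 1 -> 0 <= b0 -> 0 <= mu4 -> 0 <= g4 ->
  exists2 de : R, 0 < de <= 1 & forall om B G m : R,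
    0 <= om <= 1 -> 1 <= B -> om ^+ 2 * B <= b0 -> 0 <= G <= de -> om ^+ 2 <= de ->
    B <= de * m ->
  [/\ 4 * (om ^+ 2 * B) * (Num.sqrt G + G) <= et ^+ 2,
      score_lam B G ^+ 2 * om ^+ 2 <= et ^+ 2,
      score_lam B G ^+ 2 * om ^+ 4 * score_kap B G mu4 <= et ^+ 2 * m,
      om ^+ 4 * score_kap B G mu4 ^+ 2 <= et ^+ 2 * m ^+ 2 & g4 <= et ^+ 2 * m].
Proof.
move=> /andP[et0 et1] b00 mu40 g40.
have e20 : 0 < et ^+ 2 by rewrite exprn_gt0.
have e21 : et ^+ 2 <= 1 by rewrite exprn_ile1// ltW.
set e2 := et ^+ 2 in e20 e21 *.
have [K1 K1E] : exists K1, K1 = 64 * b0 ^+ 2 * (1 + mu4) + 8 by eexists.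
have [K2 K2E] : exists K2, K2 = 64 * (1 + mu4) + 8 by eexists.
have b2 : 0 <= b0 ^+ 2 by exact: sqr_ge0.
have b2m : 0 <= b0 ^+ 2 * mu4 by rewrite mulr_ge0.
have K10 : 8 <= K1 by rewrite K1E; nra.
have K20 : 8 <= K2 by rewrite K2E; lra.
have K120 : 0 <= K1 * K2 by rewrite mulr_ge0//; lra.
(* [K1] bounds om^4 [score_kap] and [K2] bounds [score_kap] / B^2; M dominates every constant met in
   the five bounds. The threshold will be x^2 rather than x = et^2 / M, because G also enters
   through its square root. *)
have [M ME] : exists M, M = 8 * (1 + b0) + 4 * K1 + K1 * K2 + g4 by eexists.
have M1 : 1 <= M by lra.
have M0 : 0 < M by lra.
have [x xE] : exists x, x = e2 / M by eexists.
have x0 : 0 < x by rewrite xE divr_gt0.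
have xM c : 0 <= c -> c <= M -> c * x <= e2.
  by move=> c0 cM; rewrite xE mulrA ler_pdivrMr// mulrC ler_pM2l.
have x1 : x <= 1 by rewrite xE ler_pdivrMr//; lra.
have xx : x ^+ 2 <= x by rewrite expr2 ler_piMr// ltW.
have dM c : 0 <= c -> c <= M -> c * x ^+ 2 <= e2.
  by move=> c0 cM; apply: le_trans (xM c c0 cM); rewrite ler_wpM2l.
exists (x ^+ 2); first by rewrite exprn_gt0//=; exact: le_trans x1.
move=> om B G m /andP[om0 om1] B1 omB /andP[G0 Gd] omd Bm.
have d0 : 0 <= x ^+ 2 by exact: sqr_ge0.
have G1 : G <= 1 by apply: (le_trans Gd); apply: le_trans x1.
have B0 : 0 <= B by exact: le_trans B1.
have m0 : 0 <= m.
  rewrite leNgt; apply/negP => mneg; have : x ^+ 2 * m <= 0 by rewrite mulr_ge0_le0// ltW.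
  lra.
have sG : Num.sqrt G <= x by rewrite -(ger0_norm (ltW x0)) -sqrtr_sqr ler_wsqrtr.
have omB0 : 0 <= om ^+ 2 * B by rewrite mulr_ge0// sqr_ge0.
have lam2 := score_lam_sqr_le G0 B0.
have lamp : 0 <= score_lam B G ^+ 2 by exact: sqr_ge0.
have om20 : 0 <= om ^+ 2 by exact: sqr_ge0.
have om21 : om ^+ 2 <= 1 by rewrite exprn_ile1.
have om40 : 0 <= om ^+ 4 by rewrite exprn_ge0.
have om41 : om ^+ 4 <= 1 by rewrite exprn_ile1.
have kap0 : 0 <= score_kap B G mu4.
  by rewrite /score_kap addr_ge0 ?mulr_ge0 ?sqr_ge0//; lra.
have h3 : om ^+ 4 * score_kap B G mu4 <= K1.
  rewrite /score_kap K1E.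
  rewrite (_ : _ * _ = 64 * ((om ^+ 2 * B) ^+ 2 * (G + mu4)) + 8 * (om ^+ 4 * G)); last by ring.
  apply: lerD; last by rewrite ler_piMr// mulr_ile1.
  rewrite -mulrA ler_wpM2l//; apply: ler_pM; [exact: sqr_ge0|by rewrite addr_ge0| |by rewrite lerD2r].
  by rewrite lerXn2r ?nnegrE.
have h4 : score_kap B G mu4 <= K2 * B ^+ 2.
  have B2 : 1 <= B ^+ 2 by rewrite exprn_ege1.
  rewrite /score_kap K2E [leRHS]mulrDl; apply: lerD.
    rewrite (_ : _ * _ * _ = (64 * (G + mu4)) * B ^+ 2); last by ring.
    by rewrite ler_wpM2r ?sqr_ge0//; lra.
  by rewrite ler_wpM2l//; exact: le_trans B2.
have Bm2 : B ^+ 2 <= x ^+ 2 * m ^+ 2.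
  apply: (@le_trans _ _ ((x ^+ 2 * m) ^+ 2)); first by rewrite lerXn2r// nnegrE mulr_ge0.
  rewrite (_ : (x ^+ 2 * m) ^+ 2 = x ^+ 2 * (x ^+ 2 * m ^+ 2)); last by ring.
  by apply: ler_piMl; [rewrite mulr_ge0// sqr_ge0|exact: le_trans x1].
split.
- apply: (@le_trans _ _ (4 * b0 * (x + x))).
    apply: ler_pM; [by rewrite mulr_ge0|by rewrite addr_ge0// sqrtr_ge0|by rewrite ler_wpM2l|].
    by apply: lerD => //; exact: le_trans xx.
  rewrite (_ : 4 * b0 * (x + x) = (8 * b0) * x); last by ring.
  by apply: xM; lra.
- apply: (@le_trans _ _ ((2 + 2 * (G * B)) * om ^+ 2)); first by rewrite ler_wpM2r.
  rewrite (_ : (2 + _) * _ = 2 * om ^+ 2 + 2 * (G * (om ^+ 2 * B))); last by ring.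
  apply: (@le_trans _ _ ((2 * (1 + b0)) * x ^+ 2)); last by apply: dM; lra.
  rewrite (_ : 2 * (1 + b0) * x ^+ 2 = 2 * x ^+ 2 + 2 * (x ^+ 2 * b0)); last by ring.
  by apply: lerD; rewrite ler_wpM2l//; exact: ler_pM.
- rewrite -mulrA; apply: (@le_trans _ _ ((4 * B) * K1)).
    apply: ler_pM => //; first by rewrite mulr_ge0.
    apply: (le_trans lam2); have : G * B <= B by rewrite ler_piMl.
    by move: B1; lra.
  apply: (@le_trans _ _ ((4 * K1) * x ^+ 2 * m)).
    rewrite (_ : 4 * B * K1 = (4 * K1) * B); last by ring.
    by rewrite -[leRHS]mulrA ler_wpM2l//; lra.
  by rewrite ler_wpM2r//; apply: dM; lra.
- rewrite expr2 mulrA.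
  apply: (@le_trans _ _ (K1 * (K2 * (x ^+ 2 * m ^+ 2)))).
    apply: ler_pM => //; first by rewrite mulr_ge0.
    by apply: (le_trans h4); rewrite ler_wpM2l//; lra.
  rewrite (_ : K1 * _ = (K1 * K2 * x ^+ 2) * m ^+ 2); last by ring.
  by rewrite ler_wpM2r ?sqr_ge0//; apply: dM => //; lra.
- apply: (@le_trans _ _ (g4 * x ^+ 2 * m)).
    by rewrite -mulrA ler_peMr//; exact: le_trans Bm.
  by rewrite ler_wpM2r//; apply: dM => //; lra.
Qed.

Section regression_test.
Context d (X : measurableType d) (R : realType) (P : probability X R).
Context dY (Y : measurableType dY) (nu : probability Y R) (xi : Y -> R).
Context (mxi : measurable_fun setT xi) (xi4 : L1 nu (fun y => xi y ^+ 4))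
  (xi_mean : \int[nu]_y xi y = 0) (xi_var : \int[nu]_y (xi y ^+ 2) = 1).
Local Notation PQ := (P \x nu)%E.

(** [om] decreases and [B] grows with the number of active indices; the bound [b0] on om^2 B is what
    stays fixed along the sequence. *)
Record regression_design (I : finType) (psi : I -> X -> R) (g : X -> R) (w : I -> R)
    (om B G b0 : R) : Prop := RegressionDesign {
  rd_mpsi : forall i, measurable_fun setT (psi i) ;
  rd_orth : forall i j, \int[P]_t (psi i t * psi j t) = (i == j)%:R ;
  rd_B1 : 1 <= B ;
  rd_psiB : forall t, sqnorm psi t <= B ;
  rd_mg : measurable_fun setT g ;
  rd_g4 : L1 P (fun t => g t ^+ 4) ;
  rd_G : \int[P]_t (g t ^+ 4) <= G ;
  rd_w1 : \sum_i w i ^+ 2 = 1 ;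
  rd_om : 0 <= om <= 1 ;
  rd_w : forall i, 0 <= w i <= om ;
  rd_b0 : om ^+ 2 * B <= b0 }.

Definition scale (m : nat) : R := Num.sqrt (2 / (m%:R * (m%:R - 1))).

Definition test_stat (I : finType) (psi : I -> X -> R) (g : X -> R) (w : I -> R) m
    (D : m.-tuple (X * Y)) : R :=
  scale m * pairsum (ker w (score xi psi g)) D.

Definition drift_mean (I : finType) (psi : I -> X -> R) (g : X -> R) (w : I -> R) m : R :=
  scale m * (m%:R * (m%:R - 1) / 2) * \sum_i w i * signal P psi g i ^+ 2.

Lemma scale_ge0 m : 0 <= scale m. Proof. exact: sqrtr_ge0. Qed.

Lemma scale_sqr m : (2 <= m)%N -> scale m ^+ 2 = 2 / (m%:R * (m%:R - 1)).
Proof.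
move=> m2; rewrite sqr_sqrtr// divr_ge0// mulr_ge0// subr_ge0.
by rewrite ler1n; exact: leq_trans m2.
Qed.

Lemma scoreE (I : finType) (psi : I -> X -> R) (g : X -> R) :
  score xi psi g = fun i z => cscore P xi psi g i z + signal P psi g i.
Proof. by apply/funext => i; apply/funext => z; rewrite /cscore subrK. Qed.

Section design.
Context (I : finType) (psi : I -> X -> R) (g : X -> R) (w : I -> R) (om B G b0 : R).
Context (rd : regression_design psi g w om B G b0) (m : nat) (m2 : (2 <= m)%N).

Let me := measurable_cscore P mxi (rd_mpsi rd) (rd_mg rd).
Let e_mean := cscore_mean mxi xi4 xi_mean (rd_mpsi rd) (rd_B1 rd) (rd_psiB rd) (rd_mg rd) (rd_g4 rd).
Let sq2 := cscore_sqnorm2 mxi xi4 (lexx _) (rd_mpsi rd) (rd_orth rd) (rd_B1 rd) (rd_psiB rd) (rd_mg rd)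
  (rd_g4 rd) (rd_G rd).
Let hlam := int_ip_cscore2 mxi xi4 xi_mean xi_var (rd_mpsi rd) (rd_orth rd) (rd_B1 rd) (rd_psiB rd)
  (rd_mg rd) (rd_g4 rd) (rd_G rd).
Let lam0 : 0 <= score_lam B G. Proof. by rewrite addr_ge0// sqrtr_ge0. Qed.
Let om0 : 0 <= om. Proof. by have /andP[] := rd_om rd. Qed.
Let om1 : om <= 1. Proof. by have /andP[] := rd_om rd. Qed.
Let hom i : `|w i| <= om. Proof. by have /andP[? ?] := rd_w rd i; rewrite ger0_norm. Qed.
Let hhs := hs2_cscore mxi xi4 xi_mean xi_var (rd_mpsi rd) (rd_orth rd) (rd_B1 rd) (rd_psiB rd)
  (rd_mg rd) (rd_g4 rd) (rd_G rd) (rd_w1 rd) hom.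
Let G0 : 0 <= G.
Proof. by apply: le_trans (rd_G rd); apply: Rint_ge0 => t; exact: exprn_even_ge0. Qed.
Let B0 : 0 <= B. Proof. by apply: le_trans (rd_B1 rd). Qed.

Lemma drift_mean_ge0 : 0 <= drift_mean psi g w m.
Proof. exact: (hoeffding_mean_ge0 (signal P psi g) (rd_w rd) m2 (scale_ge0 m)). Qed.

Lemma design_hs2 : `|hs2 PQ w (cscore P xi psi g) - 1| <=
  4 * (om ^+ 2 * B) * (Num.sqrt G + G).
Proof. exact: hhs. Qed.

Lemma test_far (Gm z H L : R) : 0 <= b0 -> G <= Gm -> z < drift_mean psi g w m ->
  H = 1 + 4 * b0 * (Num.sqrt Gm + Gm) -> L = 3 + 2 * (Gm * b0) ->
  (iid_law PQ m [set D | (test_stat psi g w D <= z)%R] <=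
   (2 * (H + 3 * L * drift_mean psi g w m) / (drift_mean psi g w m - z) ^+ 2)%:E)%E.
Proof.
move=> b00 hG zmu HE LE.
have := hoeffding_chebyshev me sq2.1 e_mean lam0 om0 hlam (rd_w rd) m2 (scale_ge0 m)
  (scale_sqr m2) (th := signal P psi g) zmu.
rewrite -scoreE => h; apply: (le_trans h); rewrite lee_fin ler_wpM2r//.
  by rewrite invr_ge0 sqr_ge0.
have mu0 := drift_mean_ge0.
have hH : hs2 PQ w (cscore P xi psi g) <= H.
  have h1 := le_trans (ler_norm _) design_hs2.
  have h2 : 4 * (om ^+ 2 * B) * (Num.sqrt G + G) <= 4 * b0 * (Num.sqrt Gm + Gm).
    apply: ler_pM.
    - by rewrite !mulr_ge0// sqr_ge0.
    - by rewrite addr_ge0// sqrtr_ge0.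
    - by rewrite ler_wpM2l// (rd_b0 rd).
    - by apply: lerD => //; exact: ler_wsqrtr.
  by rewrite HE; move: h1 h2; lra.
have hL : score_lam B G * om <= L.
  have h1 : (score_lam B G * om) ^+ 2 <= 2 + 2 * (Gm * b0).
    rewrite exprMn; apply: (@le_trans _ _ ((2 + 2 * (G * B)) * om ^+ 2)).
      by rewrite ler_wpM2r ?sqr_ge0//; exact: score_lam_sqr_le.
    rewrite (_ : _ * om ^+ 2 = 2 * om ^+ 2 + 2 * (G * (om ^+ 2 * B))); last by ring.
    apply: lerD; first by rewrite ler_piMr// exprn_ile1.
    rewrite ler_wpM2l//; apply: ler_pM => //; first by rewrite mulr_ge0// sqr_ge0.
    exact: rd_b0 rd.
  have := sqr_ge0 (score_lam B G * om - 1); rewrite LE.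
  have : 0 <= score_lam B G * om by rewrite mulr_ge0.
  by move: (score_lam B G * om) h1 => x; nra.
rewrite ler_wpM2l//; apply: lerD => //.
by rewrite -/(drift_mean psi g w m) ler_wpM2r// ler_wpM2l.
Qed.

Context (p ep et : R) (p01 : 0 < p < 1) (ep0 : 0 < ep).
Hypothesis (et_rate : 0 < et <= clt_rate ep).
Hypothesis (small : [/\ 4 * (om ^+ 2 * B) * (Num.sqrt G + G) <= et ^+ 2,
      score_lam B G ^+ 2 * om ^+ 2 <= et ^+ 2,
      score_lam B G ^+ 2 * om ^+ 4 * score_kap B G (\int[nu]_y (xi y ^+ 4)) <= et ^+ 2 * m%:R,
      om ^+ 4 * score_kap B G (\int[nu]_y (xi y ^+ 4)) ^+ 2 <= et ^+ 2 * m%:R ^+ 2 &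
      gauss4 R <= et ^+ 2 * m%:R]).

Let et2 : et ^+ 2 <= clt_rate ep ^+ 2.
Proof.
by have /andP[h0 h1] := et_rate; rewrite lerXn2r ?nnegrE// ltW// clt_rate_gt0.
Qed.

Lemma test_null : (forall i, signal P psi g i = 0) ->
  (iid_law PQ m [set D | (gauss_quantile p < test_stat psi g w D)%R] <= (1 - p + ep)%:E)%E.
Proof.
move=> s0; have [hb hl hD hW hg] := small.
have hm0 : 0 <= m%:R :> R by [].
have := hoeffding_upper_tail me sq2.1 sq2.2 e_mean lam0 om0 hlam (rd_w rd) m2 (scale_ge0 m)
  (scale_sqr m2) p01 ep0 (le_trans (le_trans design_hs2 hb) et2) (le_trans hl et2)
  (le_trans hD (ler_wpM2r hm0 et2)) (le_trans hW (ler_wpM2r (sqr_ge0 _) et2))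
  (le_trans hg (ler_wpM2r hm0 et2)) s0.
by rewrite -scoreE.
Qed.

Lemma test_near (B1 : R) : 2 * gauss_quantile p - clt_slack ep / 2 <= drift_mean psi g w m ->
  drift_mean psi g w m <= B1 -> 48 * et * B1 <= ep * clt_slack ep ^+ 2 ->
  (iid_law PQ m [set D | (test_stat psi g w D <= gauss_quantile p)%R] <= (1 - p + 2 * ep)%:E)%E.
Proof.
move=> hmu muB hB1; have [hb hl hD hW hg] := small.
have hm0 : 0 <= m%:R :> R by [].
have := hoeffding_lower_tail me sq2.1 sq2.2 e_mean lam0 om0 hlam (rd_w rd) m2 (scale_ge0 m)
  (scale_sqr m2) p01 ep0 (le_trans (le_trans design_hs2 hb) et2) (le_trans hl et2)
  (le_trans hD (ler_wpM2r hm0 et2)) (le_trans hW (ler_wpM2r (sqr_ge0 _) et2))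
  (le_trans hg (ler_wpM2r hm0 et2)) hmu.
rewrite -scoreE => h; apply: (le_trans h); rewrite lee_fin -/(drift_mean psi g w m).
have s0 := clt_slack_gt0 ep0.
have mu0 := drift_mean_ge0.
have /andP[et0 _] := et_rate.
have hle : score_lam B G * om <= et.
  rewrite -(@ler_pXn2r _ 2)// ?nnegrE ?exprMn//; last exact: ltW.
  by rewrite mulr_ge0.
have h2 : 3 * (score_lam B G * om) * drift_mean psi g w m / (clt_slack ep / 4) ^+ 2 <= ep.
  rewrite ler_pdivrMr; last by rewrite exprn_gt0// divr_gt0.
  apply: (@le_trans _ _ (3 * et * B1)).
    apply: ler_pM => //; first by rewrite mulr_ge0// mulr_ge0.
    by rewrite ler_wpM2l.
  rewrite (_ : ep * _ = (ep * clt_slack ep ^+ 2) / 16); last by field.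
  by rewrite ler_pdivlMr//; move: hB1; lra.
by move: h2; lra.
Qed.

End design.

(** The constants come before the design, which gives uniformity in the function, the pilot value
    and n. Beyond [B1] the fourth moment need only be bounded by [Gm]; up to [B1] it must be
    small. *)
Theorem regression_test (p ep b0 Gm : R) : 0 < p < 1 -> 0 < ep -> 0 <= b0 -> 0 <= Gm ->
  exists B1 de s : R, [/\ 0 < de, 0 < s &
  forall (I : finType) (psi : I -> X -> R) (g : X -> R) (w : I -> R) (om B G : R) (m : nat),
    regression_design psi g w om B G b0 -> (2 <= m)%N ->
    [/\ (G <= de -> om ^+ 2 <= de -> B <= de * m%:R -> (forall i, signal P psi g i = 0) ->
         (iid_law PQ m [set D | (gauss_quantile p < test_stat psi g w D)%R] <= (1 - p + ep)%:E)%E),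
        (G <= de -> om ^+ 2 <= de -> B <= de * m%:R ->
         2 * gauss_quantile p - s <= drift_mean psi g w m <= B1 ->
         (iid_law PQ m [set D | (test_stat psi g w D <= gauss_quantile p)%R] <= (1 - p + ep)%:E)%E) &
        (G <= Gm -> B1 < drift_mean psi g w m ->
         (iid_law PQ m [set D | (test_stat psi g w D <= gauss_quantile p)%R] <= ep%:E)%E)]].
Proof.
move=> p01 ep0 b00 Gm0; set z := gauss_quantile p.
have [H HE] : exists H, H = 1 + 4 * b0 * (Num.sqrt Gm + Gm) by eexists.
have [L LE] : exists L, L = 3 + 2 * (Gm * b0) by eexists.
(* Beyond this value mu - z >= mu / 2, mu >= 1 and 8 (H + 3 L) <= ep mu, so the Chebyshev bound 2 (H
   + 3 L mu) / (mu - z)^2 is at most ep. *)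
have [B1 B1E] : exists B1, B1 = 2 * `|z| + 1 + 8 * (H + 3 * L) / ep by eexists.
have sGm : 0 <= Num.sqrt Gm by exact: sqrtr_ge0.
have H1 : 1 <= H by rewrite HE lerDl mulr_ge0 ?mulr_ge0 ?addr_ge0.
have L1' : 3 <= L by rewrite LE lerDl mulr_ge0// mulr_ge0.
have q0 : 0 < 8 * (H + 3 * L) / ep by rewrite divr_gt0// mulr_gt0//; lra.
have z0 : 0 <= `|z| by [].
have B10 : 0 < B1 by lra.
have [ep2 ep2E] : exists ep2, ep2 = ep / 2 by eexists.
have ep20 : 0 < ep2 by rewrite ep2E divr_gt0.
have s0 := clt_slack_gt0 ep20.
have r0 := clt_rate_gt0 ep20.
(* The second entry controls the linear part for mu <= [B1]: its Chebyshev bound at level slack / 4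
   is 48 et B1 / slack^2. The budget ep is halved between this and the normal approximation. *)
pose et := Num.min (clt_rate ep2) (ep2 * clt_slack ep2 ^+ 2 / (48 * B1)).
have x0 : 0 < ep2 * clt_slack ep2 ^+ 2 / (48 * B1).
  by rewrite divr_gt0 ?mulr_gt0// exprn_gt0.
have et0 : 0 < et by rewrite lt_min r0 x0.
have et_r : et <= clt_rate ep2 by rewrite ge_min lexx.
have et1 : et <= 1 by apply: (le_trans et_r); rewrite ge_min lexx.
have etB : 48 * et * B1 <= ep2 * clt_slack ep2 ^+ 2.
  rewrite (_ : 48 * et * B1 = et * (48 * B1)); last by ring.
  by rewrite -ler_pdivlMr ?mulr_gt0// ge_min lexx orbT.
have mu40 : 0 <= \int[nu]_y (xi y ^+ 4).
  by apply: Rint_ge0 => y; exact: exprn_even_ge0.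
have eth : 0 < et <= 1 by rewrite et0.
have [de /andP[de0 de1] hde] := small_design eth b00 mu40 (gauss4_ge0 R).
exists B1, de, (clt_slack ep2 / 2); split=> //; first by rewrite divr_gt0.
move=> I psi g w om B G m rd m2.
have G0 : 0 <= G.
  by apply: le_trans (rd_G rd); apply: Rint_ge0 => t; exact: exprn_even_ge0.
have etr : 0 < et <= clt_rate ep2 by rewrite et0.
have hs hG ho hB := hde om B G m%:R (rd_om rd) (rd_B1 rd) (rd_b0 rd)
  (introT andP (conj G0 hG)) ho hB.
split.
- move=> hG ho hB s00; apply: (le_trans (test_null rd m2 p01 ep20 etr (hs hG ho hB) s00)).
  by rewrite lee_fin ep2E; lra.
- move=> hG ho hB /andP[h1 h2].
  apply: (le_trans (test_near rd m2 p01 ep20 etr (hs hG ho hB) h1 h2 etB)).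
  by rewrite lee_fin ep2E; lra.
move=> hG hmu; have := fun zmu => test_far rd m2 b00 hG (z := z) zmu HE LE.
move: (drift_mean psi g w m) hmu => mu hmu far.
have muz : 2 * `|z| + 1 + 8 * (H + 3 * L) / ep < mu by rewrite -B1E.
have zle : z <= `|z| by exact: ler_norm.
have zmu : z < mu by lra.
apply: (le_trans (far zmu)); rewrite lee_fin.
have h1 : mu / 2 <= mu - z by lra.
have mu1 : 1 <= mu by lra.
rewrite ler_pdivrMr; last by rewrite exprn_gt0// subr_gt0.
apply: (@le_trans _ _ (ep * (mu / 2) ^+ 2)); last first.
  by rewrite ler_wpM2l ?(ltW ep0)// lerXn2r ?nnegrE//; lra.
have h2 : 8 * (H + 3 * L) <= ep * mu by rewrite [leRHS]mulrC -ler_pdivrMr//; lra.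
have h3 : 2 * (H + 3 * L * mu) <= 2 * ((H + 3 * L) * mu).
  by rewrite ler_wpM2l// [leRHS]mulrDl lerD2r ler_peMr//; lra.
apply: (le_trans h3).
rewrite (_ : ep * (mu / 2) ^+ 2 = (ep * mu) * mu / 4); last by field.
by rewrite ler_pdivlMr// (_ : 2 * _ * 4 = (8 * (H + 3 * L)) * mu); [rewrite ler_wpM2r//; lra|ring].
Qed.

End regression_test.

(** * Splitting and mapping samples *)

Section iid_split.
Context d (T : measurableType d) (R : realType) (P : probability T R).
Local Open Scope ereal_scope.

Definition join m n (mn : (m <= n)%N) (p : m.-tuple T * (n - m).-tuple T) : n.-tuple T :=
  tcast (subnKC mn) [tuple of p.1 ++ p.2].

Lemma val_join m n (mn : (m <= n)%N) p : tval (join mn p) = p.1 ++ p.2.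
Proof. exact: val_tcast. Qed.

Lemma tnth_join_lt m n (mn : (m <= n)%N) p (i : 'I_n) (im : (i < m)%N) :
  tnth (join mn p) i = tnth p.1 (Ordinal im).
Proof.
set x := tnth p.1 (Ordinal im).
by rewrite (tnth_nth x (join mn p)) {2}/x (tnth_nth x p.1) val_join nth_cat size_tuple im.
Qed.

Lemma measurable_join m n (mn : (m <= n)%N) : measurable_fun setT (join mn).
Proof.
apply/measurable_fun_tnthP => i; have [im|im] := ltnP i m.
  rewrite (_ : _ \o _ = (fun p : m.-tuple T * (n - m).-tuple T => tnth p.1 (Ordinal im))).
    exact: (measurableT_comp (measurable_tnth (Ordinal im)) measurable_fst).
  by apply/funext => p /=; exact: tnth_join_lt.
have ik : (i - m < n - m)%N by rewrite ltn_sub2r// (leq_ltn_trans im).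
rewrite (_ : _ \o _ = (fun p : m.-tuple T * (n - m).-tuple T => tnth p.2 (Ordinal ik))).
  exact: (measurableT_comp (measurable_tnth (Ordinal ik)) measurable_snd).
apply/funext => p /=; set x := tnth p.2 (Ordinal ik).
by rewrite (tnth_nth x (join mn p)) {2}/x (tnth_nth x p.2) val_join nth_cat size_tuple ltnNge im.
Qed.

Lemma measurable_cat m k : measurable_fun setT
  (fun p : m.-tuple T * k.-tuple T => [tuple of p.1 ++ p.2]).
Proof.
have := @measurable_join m (m + k) (leq_addr k m).
have e : ((m + k) - m)%N = k by rewrite addnC addnK.
move: (leq_addr k m); rewrite /join => h.
move: (subnKC h); rewrite e => e' /=.
rewrite (_ : (fun p : m.-tuple T * k.-tuple T => tcast e' _) =
   (fun p => [tuple of p.1 ++ p.2]))//.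
by apply/funext => p; apply: val_inj; rewrite /= val_tcast.
Qed.

(* Functions on [seq T] avoid casts between tuple types. *)
Lemma integral_iid_cat m k (f : seq T -> \bar R) :
  (forall j, measurable_fun setT (fun D : j.-tuple T => f D)) -> (forall s, 0 <= f s) ->
  \int[iid_law P (m + k)]_D f D = \int[iid_law P k]_D' \int[iid_law P m]_D f (D ++ D').
Proof.
move=> mf f0; elim: m f mf f0 => [|m ih] f mf f0.
  apply: eq_integral => D _; rewrite integral_iid_law0//.
  rewrite (_ : (fun D' : 0.-tuple T => f (D' ++ D)) = (fun=> f D)); first exact: measurable_cst.
  by apply/funext => D'; rewrite tuple0.
have mF j : measurable_fun setT (fun D : j.-tuple T => \int[P]_z f (z :: D)).
  apply: (@measurable_fun_fubini_tonelli_G _ _ _ _ _ P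
    (fun p : T * j.-tuple T => f (p.1 :: p.2))) => [|p]; last exact: f0.
  exact: (measurable_fun_cons (mf j.+1)).
rewrite (integral_iid_law P (mf (m + k).+1) (fun D => f0 D)).
rewrite (ih (fun s => \int[P]_z f (z :: s)))//; last by move=> s; exact: integral_ge0.
apply: eq_integral => D' _.
rewrite (integral_iid_law P (f := fun D : m.+1.-tuple T => f (D ++ D')))//.
pose g (D : m.+1.-tuple T) := (D, D').
have mg : measurable_fun setT g.
  by apply: measurable_fun_pair; [exact: measurable_id|exact: measurable_cst].
exact: (measurableT_comp (measurableT_comp (mf (m.+1 + k)%N) (@measurable_cat m.+1 k)) mg).
Qed.

Lemma integral_iid_join m n (mn : (m <= n)%N) (g : n.-tuple T -> \bar R) :
  measurable_fun setT g -> (forall D, 0 <= g D) ->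
  \int[iid_law P n]_D g D =
  \int[iid_law P (n - m)]_D' \int[iid_law P m]_D g (join mn (D, D')).
Proof.
move=> mg g0.
(* Extension by 0 to sequences of other lengths, so that the version for [seq T] applies. *)
pose f (s : seq T) : \bar R := if insub s is Some D then g D else 0.
have fE (D : n.-tuple T) : f D = g D by rewrite /f valK.
have mf j : measurable_fun setT (fun D : j.-tuple T => f D).
  have [jn|jn] := eqVneq j n.
    by subst j; rewrite (_ : (fun D : n.-tuple T => f D) = g)//; apply/funext => D; exact: fE.
  rewrite (_ : (fun D : j.-tuple T => f D) = fun=> 0); first exact: measurable_cst.
  by apply/funext => D; rewrite /f insubF// size_tuple (negbTE jn).
have f0 s : 0 <= f s by rewrite /f; case: insubP.
transitivity (\int[iid_law P n]_D f D); first by apply: eq_integral => D _; rewrite fE.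
transitivity (\int[iid_law P (m + (n - m))]_D f D); first by rewrite subnKC.
rewrite integral_iid_cat//; apply: eq_integral => D' _; apply: eq_integral => D _.
by rewrite -fE val_join.
Qed.

Lemma measurable_xjoin m n (mn : (m <= n)%N) (A : set (n.-tuple T)) (D' : (n - m).-tuple T) :
  measurable A -> measurable [set D : m.-tuple T | A (join mn (D, D'))].
Proof.
move=> mA; rewrite -[X in measurable X]setTI.
have h : measurable_fun setT (fun D : m.-tuple T => (D, D')).
  by apply: measurable_fun_pair; [exact: measurable_id|exact: measurable_cst].
exact: (measurableT_comp (@measurable_join m n mn) h measurableT mA).
Qed.

Lemma iid_law_split_le m n (mn : (m <= n)%N) (A : set (n.-tuple T))
    (Bad : set ((n - m).-tuple T)) (b b' : R) :
  measurable A -> measurable Bad -> (0 <= b)%R ->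
  (forall D', ~ Bad D' -> iid_law P m [set D | A (join mn (D, D'))] <= b%:E) ->
  iid_law P (n - m) Bad <= b'%:E ->
  iid_law P n A <= (b + b')%:E.
Proof.
move=> mA mB b0 hb hb'.
rewrite -[A in iid_law P n A]setIT -integral_indic// (integral_iid_join mn); last 2 first.
- by apply/measurable_EFinP; exact: measurable_indic.
- by move=> D; rewrite lee_fin.
rewrite EFinD -(integral_cstP (iid_law P (n - m)) b).
apply: (@le_trans _ _ (\int[iid_law P (n - m)]_D' (b%:E + (\1_Bad D')%:E))); last first.
  rewrite ge0_integralD//; last by apply/measurable_EFinP; exact: measurable_indic.
  by rewrite integral_indic// setIT; apply: leeD.
apply: ge0_le_integral => //.
- by move=> D' _; apply: integral_ge0 => D _; rewrite lee_fin.
- apply: (@measurable_fun_fubini_tonelli_G _ _ _ _ _ (iid_law P m)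
    (fun p : m.-tuple T * (n - m).-tuple T => (\1_A (join mn p))%:E)).
    apply/measurable_EFinP; apply: measurableT_comp (@measurable_join m n mn).
    exact: measurable_indic.
  by move=> p; rewrite lee_fin.
- by apply: emeasurable_funD => //; apply/measurable_EFinP; exact: measurable_indic.
move=> D' _.
rewrite (_ : (\int[_]_D _) = iid_law P m [set D | A (join mn (D, D'))]); last first.
  rewrite -[X in iid_law P m X]setIT -integral_indic//; last exact: measurable_xjoin.
have [BD|BD] := pselect (Bad D').
  rewrite indicE mem_set//; apply: (@le_trans _ _ 1).
    exact: (probability_le1 (iid_law P m) (measurable_xjoin mn D' mA)).
  by rewrite -EFinD lee_fin lerDr.
by rewrite indicE memNset// adde0; exact: hb.
Qed.

End iid_split.

Section iid_map.
Context d d' (T : measurableType d) (T' : measurableType d') (R : realType).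
Context (P : probability T' R) (X : {mfun T' >-> T}) (N : set T').
Context (mN : measurable N) (N0 : P N = 0%E).
Local Open Scope ereal_scope.

(** The two integrands need only agree on samples that avoid the null set N. In the application N
    consists of the sites outside the cube, where the truncated atoms differ from the basis
    functions. *)
Lemma integral_iid_map m (f : seq T -> \bar R) (f' : seq T' -> \bar R) :
  (forall j, measurable_fun setT (fun D : j.-tuple T => f D)) -> (forall s, 0 <= f s) ->
  (forall j, measurable_fun setT (fun D : j.-tuple T' => f' D)) -> (forall s, 0 <= f' s) ->
  (forall s, {in s, forall z, ~ N z} -> f (map X s) = f' s) ->
  \int[iid_law (distribution P X) m]_D f D = \int[iid_law P m]_D f' D.
Proof.
elim: m f f' => [|m ih] f f' mf f0 mf' f0' hff'.
  by rewrite !integral_iid_law0//= -(hff' [::]).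
have mX : measurable_fun setT X by exact: measurable_funPT.
have mF j : measurable_fun setT (fun D : j.-tuple T => \int[distribution P X]_z f (z :: D)).
  apply: (@measurable_fun_fubini_tonelli_G _ _ _ _ _ (distribution P X)
    (fun p : T * j.-tuple T => f (p.1 :: p.2))) => [|p]; last exact: f0.
  exact: (measurable_fun_cons (mf j.+1)).
have mF' j : measurable_fun setT (fun D : j.-tuple T' => \int[P]_z f' (z :: D)).
  apply: (@measurable_fun_fubini_tonelli_G _ _ _ _ _ P
    (fun p : T' * j.-tuple T' => f' (p.1 :: p.2))) => [|p]; last exact: f0'.
  exact: (measurable_fun_cons (mf' j.+1)).
rewrite (integral_iid_law _ (mf m.+1))// (integral_iid_law _ (mf' m.+1))//.
apply: (ih (fun s => \int[distribution P X]_z f (z :: s)) (fun s => \int[P]_z f' (z :: s))) => //.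
- by move=> s; exact: integral_ge0.
- by move=> s; exact: integral_ge0.
move=> s hs; have ms : measurable_fun setT (fun z => f (z :: map X s)).
  have h : measurable_fun setT (fun z : T => [tuple of z :: map_tuple X (in_tuple s)]).
    by apply: measurable_cons; [exact: measurable_id|exact: measurable_cst].
  exact: (measurableT_comp (mf (size s).+1) h).
have ms' : measurable_fun setT (fun z => f' (z :: s)).
  have h : measurable_fun setT (fun z : T' => [tuple of z :: in_tuple s]).
    by apply: measurable_cons; [exact: measurable_id|exact: measurable_cst].
  exact: (measurableT_comp (mf' (size s).+1) h).
rewrite ge0_integral_distribution//; apply: ge0_ae_eq_integral => //.
- exact: (measurableT_comp ms mX).
- by move=> z _; exact: f0.
exists N; split=> // z /= /not_implyP[_ hz]; apply: contrapT => Nz; apply: hz.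
rewrite -(hff' (z :: s))// => y; rewrite inE => /predU1P[->//|]; exact: hs.
Qed.

Lemma iid_law_map m (A : set (m.-tuple T)) (A' : set (m.-tuple T')) :
  measurable A -> measurable A' ->
  (forall D : m.-tuple T', (forall i, ~ N (tnth D i)) -> A [tuple of map X D] = A' D) ->
  iid_law (distribution P X) m A = iid_law P m A'.
Proof.
move=> mA mA' hA.
pose f (s : seq T) : \bar R := if insub s is Some D then (\1_A (D : m.-tuple T))%:E else 0.
pose f' (s : seq T') : \bar R := if insub s is Some D then (\1_A' (D : m.-tuple T'))%:E else 0.
have fE (D : m.-tuple T) : f D = (\1_A D)%:E by rewrite /f valK.
have fE' (D : m.-tuple T') : f' D = (\1_A' D)%:E by rewrite /f' valK.
have mf j : measurable_fun setT (fun D : j.-tuple T => f D).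
  have [jn|jn] := eqVneq j m.
    subst j; rewrite (_ : (fun D : m.-tuple T => f D) = EFin \o \1_A).
      by apply/measurable_EFinP; exact: measurable_indic.
    by apply/funext => D; exact: fE.
  rewrite (_ : (fun D : j.-tuple T => f D) = fun=> 0); first exact: measurable_cst.
  by apply/funext => D; rewrite /f insubF// size_tuple (negbTE jn).
have mf' j : measurable_fun setT (fun D : j.-tuple T' => f' D).
  have [jn|jn] := eqVneq j m.
    subst j; rewrite (_ : (fun D : m.-tuple T' => f' D) = EFin \o \1_A').
      by apply/measurable_EFinP; exact: measurable_indic.
    by apply/funext => D; exact: fE'.
  rewrite (_ : (fun D : j.-tuple T' => f' D) = fun=> 0); first exact: measurable_cst.
  by apply/funext => D; rewrite /f' insubF// size_tuple (negbTE jn).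
have f0 s : 0 <= f s by rewrite /f; case: insubP => // *; rewrite lee_fin.
have f0' s : 0 <= f' s by rewrite /f'; case: insubP => // *; rewrite lee_fin.
rewrite -[A in LHS]setIT -[A' in RHS]setIT -!integral_indic//.
transitivity (\int[iid_law (distribution P X) m]_D f D).
  by apply: eq_integral => D _; rewrite fE.
transitivity (\int[iid_law P m]_D f' D); last by apply: eq_integral => D _; rewrite fE'.
apply: integral_iid_map => // s hs.
have [sm|sm] := eqVneq (size s) m; last first.
  by rewrite /f /f' !insubF// ?size_map (negbTE sm).
pose D : m.-tuple T' := Tuple (introT eqP sm).
have hAD : A [tuple of map X D] = A' D by apply: hA => i; apply: hs; exact: mem_tnth.
rewrite -[s]/(tval D) fE' (fE [tuple of map X D]) !indicE.
rewrite (_ : (_ \in A) = (D \in A'))//.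
by apply/idP/idP; rewrite !inE hAD.
Qed.

End iid_map.

(** * The unit cube *)

Section iid_null.
Context d (T : measurableType d) (R : realType) (P : probability T R) (N : set T).
Context (mN : measurable N) (N0 : P N = 0%E).

Lemma measurable_tnth_preimage n (i : 'I_n) : measurable [set D : n.-tuple T | N (tnth D i)].
Proof. by rewrite -[X in measurable X]setTI; apply: (measurable_tnth i). Qed.

Lemma measurable_exists_tnth n : measurable [set D : n.-tuple T | exists i, N (tnth D i)].
Proof.
rewrite (_ : [set D : n.-tuple T | _] = \bigcup_(i in [set: 'I_n]) [set D | N (tnth D i)]).
  by apply: fin_bigcup_measurable => // i _; exact: measurable_tnth_preimage.
by apply/seteqP; split=> [D [i Ni]|D [i _ Ni]]; exists i.
Qed.

Lemma iid_law_exists_null n : iid_law P n [set D | exists i, N (tnth D i)] = 0%E.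
Proof.
elim: n => [|n ih].
  rewrite (_ : [set D : 0.-tuple T | _] = set0) ?measure0//.
  by apply/seteqP; split=> D // [[]].
have mA : measurable [set D : n.-tuple T | exists i, N (tnth D i)] by exact: measurable_exists_tnth.
apply/eqP; rewrite -measure_le0.
apply: (@le_trans _ _ ((P \x iid_law P n)%E ((N `*` setT) `|` (setT `*` [set D | exists i, N (tnth D i)])))).
  rewrite [leLHS]/=; apply: le_measure; rewrite ?inE.
  - rewrite -[X in measurable X]setTI; apply: measurable_cons_tuple => //.
    exact: measurable_exists_tnth.
  - by apply: measurableU; exact: measurableX.
  - move=> [z D] [i] /=; case: (unliftP ord0 i) => [j|] ->.
      by rewrite tnthS => h; right; split=> //; exists j.
    by rewrite tnth0 => h; left.
apply: (le_trans (measureU2 _ _ _)); [exact: measurableX|exact: measurableX|].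
have e1 : (P \x iid_law P n)%E (N `*` setT) = 0%E.
  by apply: (eq_trans (product_measure1E P (iid_law P n) mN measurableT)); rewrite [X in (X * _)%E]N0 mul0e.
have e2 : (P \x iid_law P n)%E (setT `*` [set D | exists i, N (tnth D i)]) = 0%E.
  by apply: (eq_trans (product_measure1E P (iid_law P n) measurableT mA)); rewrite [X in (_ * X)%E]ih mule0.
by rewrite [X in (X + _ <= _)%E]e1 [X in (_ + X <= _)%E]e2 adde0.
Qed.

End iid_null.

Section cube.
Context (R : realType) (d : nat).
Local Notation U := (unif_cube R d).

Lemma unif_itvC : uniform_prob (@ltr01 R) (~` `[0, 1]) = 0%E.
Proof.
by rewrite /uniform_prob integral_uniform_pdf setICl integral_set0.
Qed.

Let cubeE : ~` cube R d = [set t | exists i, (~` `[0, 1]) (tnth t i)].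
Proof.
apply/seteqP; split=> t /=.
  by move=> /existsNP[i h]; exists i; rewrite /= in_itv.
by move=> [i h] ct; apply: h; rewrite /= in_itv; exact: ct.
Qed.

Lemma measurable_cube : measurable (cube R d).
Proof.
rewrite -[cube R d]setCK; apply: measurableC; rewrite cubeE.
by apply: measurable_exists_tnth; exact: measurableC.
Qed.

Lemma unif_cubeC : U (~` cube R d) = 0%E.
Proof.
by rewrite cubeE; apply: iid_law_exists_null; [exact: measurableC|exact: unif_itvC].
Qed.

End cube.

Lemma poweR_natr (R : realType) (x : \bar R) n : (0 <= x)%E ->
  (x `^ n.+1%:R = x ^+ n.+1)%E.
Proof.
case: x => [r||] // r0; first by rewrite poweR_EFin powR_mulrn// EFin_expe.
have -> : (+oo ^+ n.+1 = +oo :> \bar R)%E.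
  by elim: n => [//|n ih]; rewrite expeS ih mulyy.
by rewrite poweRyr// pnatr_eq0.
Qed.

Section cube_norm.
Context (R : realType) (d : nat).
Local Notation U := (unif_cube R d).
Implicit Types g h : site R d -> R.

Lemma cube_norm_powR (p : R) g : p != 0 ->
  (cube_norm p g `^ p = \int[U]_t (`|g t| `^ p)%:E)%E.
Proof. by move=> p0; rewrite /cube_norm poweR_Lnorm. Qed.

Lemma cube_normX k g : ~~ odd k.+1 ->
  (cube_norm k.+1%:R g ^+ k.+1 = \int[U]_t (g t ^+ k.+1)%:E)%E.
Proof.
move=> ke; rewrite -poweR_natr ?Lnorm_ge0// cube_norm_powR ?pnatr_eq0//.
apply: eq_integral => t _; rewrite powR_mulrn//.
by rewrite -normrX ger0_norm// exprn_even_ge0//= orbC ke.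
Qed.

Lemma in_L2E g : in_L2 g -> measurable_fun setT g /\ L1 U (fun t => g t ^+ 2).
Proof.
move=> Lg; split; last exact: Lfun2_integrable_sqr.
by move: Lg; rewrite /in_L2 inE => /andP[]; rewrite inE.
Qed.

Lemma in_L2I g : measurable_fun setT g -> L1 U (fun t => g t ^+ 2) -> in_L2 g.
Proof.
move=> mg Lg; rewrite /in_L2 inE; apply/andP; split; rewrite inE//=.
rewrite /finite_norm.
have h := @cube_normX 1 g isT.
rewrite (EFin_Rintegral Lg) in h.
move: h; rewrite /cube_norm; case: (Lnorm _ _ _) (Lnorm_ge0 U (2%:R)%:E (EFin \o g)) => [r _ _||] //.
  by rewrite ltry.
Qed.

Lemma cube_norm2_lt g (e : R) : measurable_fun setT g -> 0 <= e -> (cube_norm 2 g < e%:E)%E ->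
  L1 U (fun t => g t ^+ 2) /\ \int[U]_t (g t ^+ 2) <= e ^+ 2.
Proof.
move=> mg e0 h; apply: ge0_Rintegral_le; [by mfun|by move=> t; exact: sqr_ge0|].
rewrite -(@cube_normX 1)//; move: h; rewrite /cube_norm.
case: (Lnorm _ _ _) (Lnorm_ge0 U (2%:R)%:E (EFin \o g)) => [r|//|//].
rewrite lee_fin lte_fin => r0 re; rewrite -EFin_expe lee_fin.
by rewrite lerXn2r ?nnegrE// ltW.
Qed.

End cube_norm.

(** * Orthogonal projections *)

Section hilbert.
Context (R : realType) (d : nat) (L : countType) (phi : L -> site R d -> R).
Local Notation U := (unif_cube R d).
Implicit Types (f g h u v : site R d -> R) (A : set L) (F : {fset L}) (a : L -> R).

Lemma in_L2_measurable u : in_L2 u -> measurable_fun setT u.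
Proof. by case/in_L2E. Qed.

Lemma in_L2_sqr u : in_L2 u -> L1 U (fun t => u t ^+ 2).
Proof. by case/in_L2E. Qed.

Lemma in_L2D u v : in_L2 u -> in_L2 v -> in_L2 (fun t => u t + v t).
Proof.
move=> /in_L2E[mu Lu] /in_L2E[mv Lv]; apply: in_L2I; first by mfun.
apply: (L1_le _ (L1D (L1Z 2 Lu) (L1Z 2 Lv))); first by mfun.
by move=> t; rewrite ger0_norm ?sqr_ge0//; exact: sqr_add_le.
Qed.

Lemma in_L2Z (c : R) u : in_L2 u -> in_L2 (fun t => c * u t).
Proof.
move=> /in_L2E[mu Lu]; apply: in_L2I; first by mfun.
by under [X in L1 _ X]eq_fun do rewrite exprMn; exact: L1Z.
Qed.

Lemma in_L2B u v : in_L2 u -> in_L2 v -> in_L2 (u \- v).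
Proof.
move=> Lu Lv; have := in_L2D Lu (in_L2Z (-1) Lv).
by under [X in in_L2 X]eq_fun do rewrite mulN1r.
Qed.

Lemma in_L2_cst (c : R) : in_L2 (fun _ : site R d => c).
Proof. by apply: in_L2I => //; exact: L1_cst. Qed.

Lemma L1_dot u v : in_L2 u -> in_L2 v -> L1 U (fun t => u t * v t).
Proof. by move=> /in_L2E[mu Lu] /in_L2E[mv Lv]; exact: L1M_sqr. Qed.

Lemma dotC u v : dot u v = dot v u.
Proof. by apply: eq_Rint => t; rewrite mulrC. Qed.

Lemma dotBl u v h : in_L2 u -> in_L2 v -> in_L2 h -> dot (u \- v) h = dot u h - dot v h.
Proof.
move=> Lu Lv Lh; rewrite /dot -RintB; [|exact: L1_dot|exact: L1_dot].
by apply: eq_Rint => t /=; rewrite mulrBl.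
Qed.

Lemma dot_sqr_le u v (e : R) : in_L2 u -> in_L2 v -> \int[U]_t (v t ^+ 2) <= e ->
  dot u v ^+ 2 <= \int[U]_t (u t ^+ 2) * e.
Proof.
move=> /in_L2E[mu Lu] /in_L2E[mv Lv] h; apply: (le_trans (Rint_cauchy_schwarz mu mv Lu Lv)).
by rewrite ler_wpM2l//; apply: Rint_ge0 => t; exact: sqr_ge0.
Qed.

Context (phi_L2 : forall l, in_L2 (phi l)).

Lemma in_L2_lincomb a F : in_L2 (lincomb phi a F).
Proof.
rewrite /lincomb; elim: (enum_fset F) => [|l s ih].
  by under [X in in_L2 X]eq_fun do rewrite big_nil; exact: in_L2_cst.
under [X in in_L2 X]eq_fun do rewrite big_cons.
by apply: in_L2D => //; exact: in_L2Z.
Qed.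

Lemma dot_lincomb u a F : in_L2 u -> dot u (lincomb phi a F) = \sum_(l <- F) a l * dot u (phi l).
Proof.
move=> Lu; have L1u l : L1 U (fun t => u t * phi l t) by exact: L1_dot.
rewrite /dot (eq_Rint (fun t => \sum_(l <- F) a l * (u t * phi l t))); last first.
  by move=> t; rewrite /lincomb mulr_sumr; apply: eq_bigr => l _; ring.
rewrite Rintegral_sum; last by move=> l; exact: L1Z.
by apply: eq_bigr => l _; rewrite (RintZ _ (L1u l)).
Qed.

Lemma dot_closed_span A u v : in_L2 u -> closed_span phi A v ->
  (forall l, A l -> dot u (phi l) = 0) -> dot u v = 0.
Proof.
move=> Lu [Lv hv] hu; apply/eqP; rewrite -sqrf_eq0 eq_le sqr_ge0 andbT.
set K := \int[U]_t (u t ^+ 2).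
have K0 : 0 <= K by apply: Rint_ge0 => t; exact: sqr_ge0.
apply/ler_addgt0Pl => e e0; rewrite addr0.
(* K + 1 in place of K, since u may vanish almost everywhere. *)
have Ke : 0 < e / (K + 1) by rewrite divr_gt0// ltr_wpDl.
have s0 : 0 < Num.sqrt (e / (K + 1)) by rewrite sqrtr_gt0.
have [F [a [FA hF]]] := hv _ s0.
have Ll := in_L2_lincomb a F.
have Lr := in_L2B Lv Ll.
have [_ h2] := cube_norm2_lt (in_L2_measurable Lr) (ltW s0) hF.
rewrite sqr_sqrtr ?(ltW Ke)// in h2.
have -> : dot u v = dot u (v \- lincomb phi a F).
  rewrite dotC -[LHS]subr0 -[X in _ - X](_ : dot (lincomb phi a F) u = 0); last first.
    rewrite dotC dot_lincomb// big_seq big1// => l lF.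
    by rewrite hu ?mulr0//; exact: FA.
  by rewrite -dotBl// dotC.
apply: (le_trans (dot_sqr_le Lu Lr h2)).
rewrite mulrA ler_pdivrMr; last by rewrite ltr_wpDl.
by rewrite mulrC ler_wpM2l ?(ltW e0)// lerDl.
Qed.

Lemma closed_span_phi A l : A l -> closed_span phi A (phi l).
Proof.
move=> Al; split=> // e e0; exists [fset l]%fset, (fun=> 1); split.
  by move=> k; rewrite inE => /eqP ->.
rewrite (_ : _ \- _ = fun=> 0); last first.
  by apply/funext => t /=; rewrite /lincomb big_seq_fset1 mul1r subrr.
by rewrite /cube_norm (_ : _ \o _ = cst 0%E)// Lnorm0 ?lte_fin.
Qed.

Context (phi_orth : forall k l, dot (phi k) (phi l) = (k == l)%:R).

Lemma dot_closed_spanC A h l : closed_span phi (~` A) h -> A l -> dot h (phi l) = 0.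
Proof.
move=> hh Al; rewrite dotC; apply: dot_closed_span hh _ => // k Ak.
by rewrite phi_orth; case: eqP => // lk; case: Ak; rewrite -lk.
Qed.

(** The half of Parseval that needs membership in the closed span: for a combination with
    coefficients a, the squared distance to u is at least the squared norm of u minus the sum of
    squared coefficients of u, and it can be made arbitrarily small. *)
Lemma parseval_le A u (b : R) : closed_span phi A u ->
  (forall F, (forall l, l \in F -> A l) -> \sum_(l <- F) dot u (phi l) ^+ 2 <= b) ->
  \int[U]_t (u t ^+ 2) <= b.
Proof.
move=> [Lu hu] hb; apply/ler_addgt0Pl => e e0.
have s0 : 0 < Num.sqrt e by rewrite sqrtr_gt0.
have [F [a [FA hF]]] := hu _ s0.
have Ll := in_L2_lincomb a F; have Lr := in_L2B Lu Ll.
have [_ h2] := cube_norm2_lt (in_L2_measurable Lr) (ltW s0) hF.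
rewrite sqr_sqrtr ?(ltW e0)// in h2.
have e1 : \int[U]_t ((u \- lincomb phi a F) t ^+ 2) =
    \int[U]_t (u t ^+ 2) - 2 * dot u (lincomb phi a F) + dot (lincomb phi a F) (lincomb phi a F).
  have L1' := in_L2_sqr Lu; have L2' := L1_dot Lu Ll; have L3' := L1_dot Ll Ll.
  rewrite /dot -(RintZ _ L2') -RintB//; last exact: L1Z.
  rewrite -RintD//; last by apply: L1B => //; exact: L1Z.
  by apply: eq_Rint => t /=; ring.
have e2 : dot (lincomb phi a F) (lincomb phi a F) = \sum_(l <- F) a l ^+ 2.
  rewrite dot_lincomb// big_seq [RHS]big_seq; apply: eq_bigr => l lF.
  rewrite dotC dot_lincomb// (bigD1_seq l)//=.
  by rewrite phi_orth eqxx mulr1 big1 ?addr0// => k kl; rewrite phi_orth eq_sym (negbTE kl) mulr0.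
rewrite e1 dot_lincomb// e2 in h2.
have h3 : 2 * (\sum_(l <- F) a l * dot u (phi l)) - \sum_(l <- F) a l ^+ 2 <=
   \sum_(l <- F) dot u (phi l) ^+ 2.
  rewrite mulr_sumr -sumrB; apply: ler_sum => l _.
  have := sqr_ge0 (a l - dot u (phi l)); move: (a l) (dot u (phi l)) => x y; nra.
have := hb F FA; lra.
Qed.

Context (phi_centered : forall l, centered (phi l))
  (phi_complete : forall g, in_L2 g -> centered g -> closed_span phi setT g).

Lemma dot1 u : dot (fun=> 1) u = \int[U]_t u t.
Proof. by apply: eq_Rint => t; rewrite mul1r. Qed.

Lemma closed_span_centered A g : closed_span phi A g -> centered g.
Proof.
move=> hg; rewrite /centered -dot1; apply: dot_closed_span hg _; first exact: in_L2_cst.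
by move=> l _; rewrite dot1; exact: phi_centered.
Qed.

Section projections.
Context (S : set L) (f g u : site R d -> R) (f_L2 : in_L2 f) (f_cent : centered f).
Context (g_proj : is_projection phi (~` S) f g) (u_proj : is_projection phi S f u).

Lemma coef_projection l : S l -> coef phi f l = dot u (phi l).
Proof.
move=> Sl; have [[Lu _] hu] := u_proj.
have := hu _ (closed_span_phi Sl); rewrite dotBl// => /eqP; rewrite subr_eq0 => /eqP.
by [].
Qed.

(** The remainder f - u - g is orthogonal to each basis function and centred, so completeness puts
    it in the closed span of functions orthogonal to it. *)
Lemma projection_sum : \int[U]_t ((f t - (u t + g t)) ^+ 2) = 0.
Proof.
have [su hu] := u_proj; have [sg hg] := g_proj; have [Lu _] := su; have [Lg _] := sg.
pose r := (f \- u) \- g.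
have Lfu := in_L2B f_L2 Lu; have Lr : in_L2 r by exact: in_L2B.
have cr : centered r.
  have mf := L1_sqr (in_L2_measurable f_L2) (in_L2_sqr f_L2).
  have mu := L1_sqr (in_L2_measurable Lu) (in_L2_sqr Lu).
  have mg := L1_sqr (in_L2_measurable Lg) (in_L2_sqr Lg).
  rewrite /centered RintB//; last exact: L1B.
  by rewrite RintB// f_cent (closed_span_centered su) (closed_span_centered sg) !subrr.
have orth l : dot r (phi l) = 0.
  have [Sl|Sl] := pselect (S l).
    rewrite dotBl// hu; last exact: closed_span_phi.
    by rewrite (dot_closed_spanC sg Sl) subrr.
  have -> : r = (f \- g) \- u by apply/funext => t; rewrite /r /=; ring.
  rewrite dotBl//; last exact: in_L2B.
  rewrite hg ?sub0r; last exact: closed_span_phi.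
  by rewrite (@dot_closed_spanC (~` S)) ?oppr0// setCK.
have := dot_closed_span Lr (phi_complete Lr cr) (fun l _ => orth l).
by move=> h; rewrite -[RHS]h; apply: eq_Rint => t; rewrite /r /=; ring.
Qed.

Lemma signal_coef h l : closed_span phi (~` S) h -> S l -> dot (f \- h) (phi l) = coef phi f l.
Proof.
by move=> hh Sl; have [Lh _] := hh; rewrite dotBl// (dot_closed_spanC hh Sl) subr0.
Qed.

Lemma residual_ae h : in_L2 h ->
  {ae U, forall t, f t - h t = u t + (g t - h t)}.
Proof.
move=> Lh; have [[Lu _] _] := u_proj; have [[Lg _] _] := g_proj.
have Lr : in_L2 (fun t => f t - (u t + g t)).
  by have := in_L2B f_L2 (in_L2D Lu Lg).
have L2 := in_L2_sqr Lr.
have h0 : (\int[U]_t `|((f t - (u t + g t)) ^+ 2)%:E| = 0)%E.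
  rewrite -[RHS]/(0%:E) -projection_sum -EFin_Rintegral//.
  by apply: eq_integral => t _; rewrite gee0_abs// lee_fin sqr_ge0.
have := (ae_eq_integral_abs U measurableT (measurable_int U L2)).1 h0.
apply: filterS => t /(_ I) [] /eqP; rewrite sqrf_eq0 subr_eq0 => /eqP ->; ring.
Qed.

End projections.

End hilbert.

(** * Fourth moments and weights *)

Section fourth_moment.
Context d (T : measurableType d) (R : realType) (P : probability T R).

(** Split at M: above it x^4 = x^(4 - p) x^p, and the exponent 4 - p is negative. *)
Lemma pow4_truncate (p M x : R) : 4 < p -> 0 < M -> 0 <= x ->
  x ^+ 4 <= M ^+ 2 * x ^+ 2 + M `^ (4 - p) * x `^ p.
Proof.
move=> p4 M0 x0; have [xM|Mx] := leP x M.
  have h : x ^+ 4 <= M ^+ 2 * x ^+ 2.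
    rewrite (_ : x ^+ 4 = x ^+ 2 * x ^+ 2); last by ring.
    by rewrite ler_wpM2r ?sqr_ge0// lerXn2r ?nnegrE// ltW.
  by apply: (le_trans h); rewrite lerDl mulr_ge0// powR_ge0.
apply: (@le_trans _ _ (M `^ (4 - p) * x `^ p)); last by rewrite lerDr mulr_ge0// sqr_ge0.
have x0' : 0 < x by exact: lt_trans Mx.
have -> : x ^+ 4 = x `^ ((4 - p) + p) by rewrite subrK powR_mulrn.
rewrite powRD; last by rewrite (gt_eqF x0') implybT.
rewrite ler_wpM2r ?powR_ge0//.
rewrite (_ : 4 - p = - (p - 4)); last by ring.
rewrite !powRN lef_pV2 ?posrE ?powR_gt0//.
by rewrite ge0_ler_powR ?nnegrE ?subr_ge0 ?(ltW p4)// ltW.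
Qed.

Context (p : R) (p4 : 4 < p).

Section bound.
Context (u : T -> R) (K : R) (mu : measurable_fun setT u) (u2 : L1 P (fun t => u t ^+ 2)).
Context (hK : (\int[P]_t (`|u t| `^ p)%:E <= K%:E)%E).

Let mup : measurable_fun setT (fun t => `|u t| `^ p).
Proof.
by apply: (measurableT_comp (@measurable_powR R p)); exact: measurableT_comp.
Qed.

Let up : L1 P (fun t => `|u t| `^ p) /\ \int[P]_t (`|u t| `^ p) <= K.
Proof. by apply: ge0_Rintegral_le => // t; exact: powR_ge0. Qed.

Lemma int_pow4_le (M : R) : 0 < M -> L1 P (fun t => u t ^+ 4) /\
  \int[P]_t (u t ^+ 4) <= M ^+ 2 * \int[P]_t (u t ^+ 2) + M `^ (4 - p) * K.
Proof.
move=> M0; have [Lp hp] := up.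
have hle t : u t ^+ 4 <= M ^+ 2 * u t ^+ 2 + M `^ (4 - p) * (`|u t| `^ p).
  rewrite -(ger0_norm (exprn_even_ge0 (u t) (isT : ~~ odd 4))) normrX.
  rewrite -[u t ^+ 2](real_normK (num_real (u t))).
  exact: pow4_truncate.
have Lr := L1D (L1Z (M ^+ 2) u2) (L1Z (M `^ (4 - p)) Lp).
have L4 : L1 P (fun t => u t ^+ 4).
  by apply: (L1_le _ Lr); [mfun|move=> t; rewrite ger0_norm// exprn_even_ge0].
split=> //; apply: (le_trans (le_Rint L4 Lr hle)).
rewrite RintD; [|exact: L1Z|exact: L1Z].
by rewrite (RintZ _ u2) (RintZ _ Lp) lerD2l ler_wpM2l// powR_ge0.
Qed.

End bound.

(** Smallness in L_2 with a common L_p bound gives smallness in L_4, uniformly in u: M is first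
    taken so large that the tail costs at most et / 2, then the L_2 threshold absorbs M^2. *)
Lemma int_pow4_small (K et : R) : 0 <= K -> 0 < et ->
  exists2 de : R, 0 < de & forall u : T -> R, measurable_fun setT u ->
    L1 P (fun t => u t ^+ 2) -> (\int[P]_t (`|u t| `^ p)%:E <= K%:E)%E ->
    \int[P]_t (u t ^+ 2) <= de -> \int[P]_t (u t ^+ 4) <= et.
Proof.
move=> K0 et0; pose y := et / (2 * (K + 1)).
have K1 : 0 < K + 1 by rewrite ltr_wpDl.
have y0 : 0 < y by rewrite divr_gt0// mulr_gt0.
pose M := y `^ (4 - p)^-1.
have M0 : 0 < M by rewrite powR_gt0.
have My : M `^ (4 - p) = y.
  by rewrite /M -powRrM mulVf ?powRr1 ?(ltW y0)// subr_eq0 lt_eqF.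
have M2 : 0 < M ^+ 2 by rewrite exprn_gt0.
exists (et / (2 * M ^+ 2)); first by rewrite divr_gt0// mulr_gt0.
move=> u mu u2 hK hu; apply: (le_trans (int_pow4_le mu u2 hK M0).2).
rewrite My [leRHS](splitr et); apply: lerD.
  apply: (@le_trans _ _ (M ^+ 2 * (et / (2 * M ^+ 2)))); first by rewrite ler_wpM2l// ltW.
  by rewrite le_eqVlt; apply/orP; left; apply/eqP; field; rewrite gt_eqF.
have yE : y * (2 * (K + 1)) = et by rewrite /y mulfVK// gt_eqF// mulr_gt0.
by rewrite ler_pdivlMr// -yE; have := mulr_ge0 (ltW y0) K0; lra.
Qed.

End fourth_moment.

Section weights_theory.
Context (R : realType) (L : countType) (c q : L -> R) (T : R).
Context (c0 : forall l, 0 <= c l) (q0 : forall l, 0 <= q l) (T0 : 0 < T)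
  (finA : finite_set (active c q T)).
Local Notation A := (fset_set (active c q T)).
Local Notation gap := (gap c q T).

Lemma in_active l : (l \in A) = (l \in active c q T).
Proof. exact: in_fset_set. Qed.

Lemma gap_ge0 l : 0 <= gap l. Proof. by rewrite /Defs.gap le_max lexx orbT. Qed.

Lemma gap_active l : l \in A -> gap l = T * q l - c l /\ 0 < gap l.
Proof.
rewrite in_active inE => -[_ h]; rewrite /Defs.gap max_l ?subr_ge0 ?(ltW h)//.
by rewrite subr_gt0.
Qed.

Lemma gap_notin l : l \notin A -> gap l = 0.
Proof.
rewrite in_active notin_setE => h; rewrite /Defs.gap max_r// subr_le0 leNgt; apply/negP => h1.
apply: h; split=> //; apply/negP => /eqP ql; move: h1; rewrite ql mulr0 ltNge.
by rewrite c0.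
Qed.

Lemma gap_le l : gap l <= T * q l.
Proof. by rewrite /Defs.gap ge_max gerBl c0 mulr_ge0// ltW. Qed.

Lemma gap_lb l : T * q l - c l <= gap l.
Proof. by rewrite /Defs.gap le_max lexx. Qed.

Lemma fsum_active (F : L -> R) : (forall l, l \notin A -> F l = 0) ->
  \sum_(l \in [set: L]) F l = \sum_(l <- A) F l.
Proof.
move=> hF; rewrite -(fsbig_finite _ _ finA).
apply/esym/fsbig_widen => // l [_ nl]; apply: hF.
by rewrite in_active notin_setE.
Qed.

Lemma sum_gap2E : sum_gap2 c q T = \sum_(l <- A) gap l ^+ 2.
Proof. by apply: fsum_active => l /gap_notin ->; rewrite expr0n. Qed.

Lemma sum_c_gapE : sum_c_gap c q T = \sum_(l <- A) c l * gap l.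
Proof. by apply: fsum_active => l /gap_notin ->; rewrite mulr0. Qed.

Lemma sum_q_gapE : sum_q_gap c q T = \sum_(l <- A) q l * gap l.
Proof. by apply: fsum_active => l /gap_notin ->; rewrite mulr0. Qed.

(** Consequently T times the squared critical radius is [sum_gap2] / [sum_c_gap] + 1; the 1 is what
    the ellipsoid constraint takes back in [sum_gap_ge]. *)
Lemma sum_q_c_gap : T * sum_q_gap c q T = sum_gap2 c q T + sum_c_gap c q T.
Proof.
rewrite sum_q_gapE sum_gap2E sum_c_gapE mulr_sumr -big_split /=.
apply: eq_big_seq => l lA; have [-> _] := gap_active lA; ring.
Qed.

Lemma sum_gap2_gt0 : (0 < card_active c q T)%N -> 0 < sum_gap2 c q T.
Proof.
rewrite /card_active cardfs_gt0 => /fset0Pn[l lA].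
rewrite sum_gap2E (bigD1_seq l)//= ltr_wpDr//.
  by apply: sumr_ge0 => k _; exact: sqr_ge0.
by rewrite exprn_gt0//; have [] := gap_active lA.
Qed.

Lemma sum_weight2 : (0 < card_active c q T)%N -> \sum_(l <- A) weight c q T l ^+ 2 = 1.
Proof.
move=> /sum_gap2_gt0 g0; rewrite /weight.
under eq_bigr do rewrite exprMn exprVn sqr_sqrtr ?(ltW g0)//.
by rewrite -mulr_suml -sum_gap2E divff// gt_eqF.
Qed.

Lemma weight_ge0 l : 0 <= weight c q T l.
Proof. by rewrite /weight divr_ge0 ?gap_ge0 ?sqrtr_ge0. Qed.

(** Condition C1 keeps the weights flat. After multiplication by T^2 its right side is C times
    [sum_gap2], while each squared gap is at most T^2 times the maximum of q^2. *)
Lemma weight_sqr_le (C : R) l : (0 < card_active c q T)%N ->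
  (card_active c q T)%:R * sup [set q l ^+ 2 | l in active c q T] <=
    C * \sum_(l \in active c q T) (q l - c l / T) ^+ 2 ->
  l \in A -> weight c q T l ^+ 2 <= C / (card_active c q T)%:R.
Proof.
move=> N0 hC lA; have g0 := sum_gap2_gt0 N0.
set N := card_active c q T in N0 hC *.
have NR : 0 < N%:R :> R by rewrite ltr0n.
set s := sup _ in hC.
have ls : q l ^+ 2 <= s.
  apply: ub_le_sup; last by exists l => //; rewrite in_active inE in lA.
  exists (\sum_(k <- A) q k ^+ 2) => _ [k Ak <-].
  have kA : k \in A by rewrite in_active inE.
  rewrite (bigD1_seq k kA (fset_uniq A))/= lerDl.
  by apply: sumr_ge0 => i _; exact: sqr_ge0.
rewrite /weight exprMn exprVn sqr_sqrtr ?(ltW g0)// ler_pdivrMr// mulrAC ler_pdivlMr//.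
have hS : T ^+ 2 * \sum_(l \in active c q T) (q l - c l / T) ^+ 2 = sum_gap2 c q T.
  rewrite sum_gap2E (fsbig_finite _ _ finA)/= mulr_sumr.
  apply: eq_big_seq => k kA; have [-> _] := gap_active kA.
  by rewrite -exprMn; congr (_ ^+ 2); field; rewrite gt_eqF.
apply: (@le_trans _ _ (T ^+ 2 * (N%:R * s))).
  rewrite mulrC [leRHS]mulrCA; apply: ler_wpM2l; first exact: ltW.
  apply: (@le_trans _ _ ((T * q l) ^+ 2)).
    apply: lerXn2r; rewrite ?nnegrE ?gap_ge0 ?gap_le//.
    by rewrite mulr_ge0// ltW.
  by rewrite exprMn ler_wpM2l// sqr_ge0.
apply: (@le_trans _ _ (T ^+ 2 * (C * \sum_(l \in active c q T) (q l - c l / T) ^+ 2))).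
  by rewrite ler_wpM2l// sqr_ge0.
by rewrite mulrCA hS.
Qed.

Context (th : L -> R) (hc : forall F : {fset L}, \sum_(l <- F) c l * th l ^+ 2 <= 1).

Lemma sum_gap_fset (F : {fset L}) :
  \sum_(l <- F) gap l * th l ^+ 2 <= \sum_(l <- A) gap l * th l ^+ 2.
Proof.
have f0 l : 0 <= gap l * th l ^+ 2 by rewrite mulr_ge0 ?gap_ge0 ?sqr_ge0.
have h l : l \notin A -> gap l * th l ^+ 2 = 0 by move=> /gap_notin ->; rewrite mul0r.
rewrite -(@big_fset_incl _ _ _ _ (F `&` A)%fset F) /=; last 2 first.
- exact: fsubsetIl.
- by move=> l lF; rewrite inE lF/=; exact: h.
pose g l := if l \in F then gap l * th l ^+ 2 else 0.
rewrite (eq_big_seq g) /=; last by move=> l; rewrite inE /g => /andP[->].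
rewrite (@big_fset_incl _ _ _ _ (F `&` A)%fset A) /=; last 2 first.
- exact: fsubsetIr.
- by move=> l lA; rewrite inE lA andbT /g => /negbTE ->.
by apply: ler_sum => l _; rewrite /g; case: ifP.
Qed.

(** On active indices T q = gap + c, so the coefficients are controlled by the weighted sum and the
    ellipsoid; on the others T q <= c and the ellipsoid suffices. Two lower bounds for q are kept
    apart because C2 concerns the active minimum and C5 the infimum over S_F. *)
Lemma sum_coef2_le (F : {fset L}) (qa qi : R) : 0 < qa -> 0 < qi ->
  (forall l, l \in F -> supp q l) ->
  (forall l, l \in A -> qa <= q l) -> (forall l, supp q l -> qi <= q l) ->
  \sum_(l <- F) th l ^+ 2 <= (\sum_(l <- A) gap l * th l ^+ 2) / (T * qa) + ((T * qa)^-1 + (T * qi)^-1).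
Proof.
move=> qa0 qi0 FS hqa hqi.
have Ta : 0 < T * qa by rewrite mulr_gt0.
have Ti : 0 < T * qi by rewrite mulr_gt0.
have Ta' : 0 <= (T * qa)^-1 by rewrite invr_ge0 ltW.
have Ti' : 0 <= (T * qi)^-1 by rewrite invr_ge0 ltW.
apply: (@le_trans _ _ (\sum_(l <- F) ((gap l * th l ^+ 2) / (T * qa) +
    (c l * th l ^+ 2) * ((T * qa)^-1 + (T * qi)^-1)))).
  rewrite !big_seq; apply: ler_sum => l lF.
  have t0 : 0 <= th l ^+ 2 by exact: sqr_ge0.
  have ct : 0 <= c l * th l ^+ 2 by rewrite mulr_ge0.
  have gt : 0 <= gap l * th l ^+ 2 by rewrite mulr_ge0// gap_ge0.
  have [lA|lA] := boolP (l \in A).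
    have [gE _] := gap_active lA.
    have h : th l ^+ 2 <= (gap l * th l ^+ 2 + c l * th l ^+ 2) / (T * qa).
      rewrite ler_pdivlMr// -mulrDl gE subrK mulrC ler_wpM2r// ler_wpM2l ?(ltW T0)//.
      exact: hqa.
    by apply: (le_trans h); rewrite mulrDl lerD2l ler_wpM2l// lerDl.
  have h : th l ^+ 2 <= c l * th l ^+ 2 * (T * qi)^-1.
    rewrite ler_pdivlMr// mulrC ler_wpM2r//.
    have : T * q l - c l <= 0 by rewrite -(gap_notin lA) gap_lb.
    rewrite subr_le0; apply: le_trans; rewrite ler_wpM2l ?(ltW T0)//.
    by apply: hqi; exact: FS.
  apply: (le_trans h); rewrite mulrDr addrA lerDr addr_ge0//; exact: mulr_ge0.
rewrite big_split/= -!mulr_suml; apply: lerD.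
  by rewrite ler_wpM2r// sum_gap_fset.
by rewrite ler_piMl// addr_ge0.
Qed.

Lemma quad_le : (\esum_(l in [set: L]) (q l * th l ^+ 2)%:E <=
  ((\sum_(l <- A) gap l * th l ^+ 2 + 1) / T)%:E)%E.
Proof.
rewrite /esum; apply: ge_ereal_sup => _ [X [finX _] <-].
rewrite fsumEFin// (fsbig_finite _ _ finX)/= lee_fin ler_pdivlMr//.
apply: (@le_trans _ _ (\sum_(l <- fset_set X) (gap l * th l ^+ 2 + c l * th l ^+ 2))).
  rewrite mulr_suml; apply: ler_sum => l _; rewrite -mulrDl mulrAC.
  by rewrite ler_wpM2r ?sqr_ge0// mulrC -lerBlDr gap_lb.
by rewrite big_split/=; apply: lerD; [exact: sum_gap_fset|exact: hc].
Qed.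

(** [quad_le] gives T Q <= weighted sum + 1, and T times the squared radius exceeds the claimed
    ratio by the same 1. *)
Lemma sum_gap_ge : 0 < sum_c_gap c q T ->
  (((crit_radius c q T) ^+ 2)%:E <= `|\esum_(l in [set: L]) (q l * th l ^+ 2)%:E|)%E ->
  sum_gap2 c q T / sum_c_gap c q T <= \sum_(l <- A) gap l * th l ^+ 2.
Proof.
move=> sc0 h; have := le_trans h.
rewrite gee0_abs; last by apply: esum_ge0 => l _; rewrite lee_fin mulr_ge0// sqr_ge0.
move=> /(_ _ quad_le); rewrite lee_fin /crit_radius sqr_sqrtr; last first.
  rewrite divr_ge0 ?(ltW sc0)// sum_q_gapE.
  by apply: sumr_ge0 => l _; rewrite mulr_ge0// gap_ge0.
rewrite ler_pdivlMr// mulrC mulrA sum_q_c_gap mulrDl divff ?gt_eqF//.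
by rewrite lerD2r.
Qed.

End weights_theory.

(** * The U-statistic of the data *)

Section pairsum_theory.
Context (T : Type) (R : realType).
Implicit Types (H : T -> T -> R) (s : seq T).

Lemma pairsum_nth H s x0 : pairsum H s =
  \sum_(i < size s) \sum_(j < size s | (i < j)%N) H (nth x0 s i) (nth x0 s j).
Proof.
elim: s => [|z s ih]; first by rewrite big_ord0.
rewrite [RHS]big_ord_recl/= [X in _ = X + _]big_mkcond [X in _ = X + _]big_ord_recl/= add0r ih.
congr (_ + _).
  by rewrite (big_nth x0) big_mkord.
apply: eq_bigr => i _; rewrite [RHS]big_mkcond big_ord_recl/= add0r -big_mkcond/=.
exact: eq_bigl.
Qed.

Lemma sum_pairs_restrict m n (F : nat -> nat -> R) : (m <= n)%N ->
  \sum_(i < n) \sum_(j < n | (i < j < m)%N) F i j =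
  \sum_(i < m) \sum_(j < m | (i < j)%N) F i j.
Proof.
move=> mn; rewrite (bigID (fun i : 'I_n => (i < m)%N))/= [X in _ + X]big1 ?addr0; last first.
  move=> i; rewrite -leqNgt => mi; apply: big_pred0 => j; apply/negbTE/negP => /andP[ij jm].
  by have := leq_trans (ltn_trans ij jm) mi; rewrite ltnn.
rewrite [RHS](big_ord_widen n (fun i => \sum_(j < m | (i < j)%N) F i j) mn).
apply: eq_bigr => i im.
by rewrite (big_ord_widen_cond n (fun j => (i < j)%N) (F i) mn).
Qed.

Lemma eq_pairsum_in (T' : eqType) (H' : T' -> T' -> R) (H : T -> T -> R) (X : T' -> T) (s : seq T') :
  {in s &, forall z z', H (X z) (X z') = H' z z'} -> pairsum H (map X s) = pairsum H' s.
Proof.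
elim: s => //= z s ih h; congr (_ + _).
  rewrite big_map; apply: eq_big_seq => z' z's.
  by apply: h; rewrite inE ?eqxx ?z's ?orbT.
by apply: ih => y y' ys y's; apply: h; rewrite inE ?ys ?y's orbT.
Qed.

End pairsum_theory.

Section ae_integral.
Context d (T : measurableType d) (R : realType) (P : probability T R).

Lemma ae_eq_Rint (F F' : T -> R) : measurable_fun setT F -> measurable_fun setT F' ->
  {ae P, forall t, F t = F' t} -> \int[P]_t F t = \int[P]_t F' t.
Proof.
move=> mF mF' h; rewrite /Rintegral; congr fine; apply: ae_eq_integral => //.
- exact/measurable_EFinP.
- exact/measurable_EFinP.
- by apply: filterS h => t -> _.
Qed.

End ae_integral.

Section regression_data.
Context (R : realType) (d : nat) (L : countType) (phi : L -> site R d -> R) (c q : L -> R).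
Context (phi_basis : centered_basis phi) (c0 : forall l, 0 <= c l) (q0 : forall l, 0 <= q l).
Context (T : R) (T0 : 0 < T) (finA : finite_set (active c q T)).
Local Notation U := (unif_cube R d).
Local Notation A := (fset_set (active c q T)).
Local Notation S := (supp q).

Let phi_L2 l : in_L2 (phi l). Proof. by have [h _ _] := phi_basis; have [] := h l. Qed.
Let phi_cent l : centered (phi l). Proof. by have [h _ _] := phi_basis; have [] := h l. Qed.
Let phi_orth k l : dot (phi k) (phi l) = (k == l)%:R. Proof. by have [_ h _] := phi_basis. Qed.
Let phi_compl g : in_L2 g -> centered g -> closed_span phi setT g.
Proof. by have [_ _ h] := phi_basis; exact: h. Qed.
Let mphi l : measurable_fun setT (phi l). Proof. exact: in_L2_measurable. Qed.

(* Condition C3 bounds the basis on the cube only, and uniform sites lie there almost surely. *)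
Definition atom (i : A) (t : site R d) : R := phi (val i) t * \1_(cube R d) t.
Definition atom_weight (i : A) : R := weight c q T (val i).

Lemma measurable_atom i : measurable_fun setT (atom i).
Proof.
by apply: measurable_funM => //; apply: measurable_indic; exact: measurable_cube.
Qed.

Lemma atom_cube i t : cube R d t -> atom i t = phi (val i) t.
Proof. by move=> ct; rewrite /atom indicE mem_set// mulr1. Qed.

Lemma ae_cube (Q : site R d -> Prop) : (forall t, cube R d t -> Q t) -> {ae U, forall t, Q t}.
Proof.
move=> h; exists (~` cube R d); split.
- by apply: measurableC; exact: measurable_cube.
- exact: unif_cubeC.
- by move=> t /= nQ ct; apply: nQ; exact: h.
Qed.

Lemma atom_orth i j : \int[U]_t (atom i t * atom j t) = (i == j)%:R.
Proof.
rewrite -val_eqE -phi_orth; apply: ae_eq_Rint.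
- by apply: measurable_funM; exact: measurable_atom.
- by mfun.
- by apply: ae_cube => t ct; rewrite !atom_cube.
Qed.

Lemma atom_sqnorm (b : R) :
  (sup_ge0 [set (\sum_(l \in active c q T) phi l t ^+ 2)%:E | t in cube R d] <= b%:E)%E ->
  forall t, sqnorm atom t <= b.
Proof.
move=> hb t; have b0 : 0 <= b.
  by rewrite -lee_fin; apply: le_trans hb; apply: ereal_sup_ubound; left.
have [ct|ct] := pselect (cube R d t); last first.
  rewrite /sqnorm big1// => i _.
  by rewrite /atom indicE memNset// mulr0 expr0n.
rewrite /sqnorm; under eq_bigr do rewrite atom_cube//.
rewrite -(big_seq_fsetE _ _ xpredT (fun l => phi l t ^+ 2))/= -(fsbig_finite _ _ finA).
rewrite -lee_fin; apply: le_trans hb; apply: ereal_sup_ubound; right.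
by exists t.
Qed.

Section fixed_function.
Context (f : site R d -> R) (mf : measurable_fun setT f) (f_L2 : in_L2 f) (f_cent : centered f).
Context (g u : site R d -> R) (g_proj : is_projection phi (~` S) f g)
  (u_proj : is_projection phi S f u).
Context (h : site R d -> R) (hh : closed_span phi (~` S) h).

Let Lu : in_L2 u. Proof. by have [[]] := u_proj. Qed.
Let Lg : in_L2 g. Proof. by have [[]] := g_proj. Qed.
Let Lh : in_L2 h. Proof. by have [] := hh. Qed.
Let mu : measurable_fun setT u. Proof. exact: in_L2_measurable. Qed.
Let mg : measurable_fun setT g. Proof. exact: in_L2_measurable. Qed.
Let mh : measurable_fun setT h. Proof. exact: in_L2_measurable. Qed.

Lemma residual_pow4 (a b : R) : L1 U (fun t => u t ^+ 4) -> \int[U]_t (u t ^+ 4) <= a ->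
  (\int[U]_t ((g t - h t) ^+ 4)%:E <= b%:E)%E ->
  L1 U (fun t => (f \- h) t ^+ 4) /\ \int[U]_t ((f \- h) t ^+ 4) <= 8 * a + 8 * b.
Proof.
move=> u4 ha hb.
have ev (x : R) : 0 <= x ^+ 4 by exact: exprn_even_ge0.
have [v4 hv] : L1 U (fun t => (g t - h t) ^+ 4) /\ \int[U]_t ((g t - h t) ^+ 4) <= b.
  by apply: ge0_Rintegral_le => //; mfun.
have Ls := L1D (L1Z 8 u4) (L1Z 8 v4).
apply: ge0_Rintegral_le => //; first by mfun.
rewrite (@ge0_ae_eq_integral _ _ _ U setT _ (fun t => ((u t + (g t - h t)) ^+ 4)%:E))//; first last.
- have hae := residual_ae phi_L2 phi_orth phi_cent phi_compl f_L2 f_cent g_proj u_proj Lh.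
  by apply: filterS hae => t ht _; congr ((_ ^+ 4)%:E); exact: ht.
- by move=> t _; rewrite lee_fin.
- by move=> t _; rewrite lee_fin.
- by apply/measurable_EFinP; mfun.
- by apply/measurable_EFinP; mfun.
apply: (@le_trans _ _ (\int[U]_t (8 * u t ^+ 4 + 8 * (g t - h t) ^+ 4)%:E)%E).
  apply: ge0_le_integral => //.
  - by move=> t _; rewrite lee_fin.
  - by apply/measurable_EFinP; mfun.
  - by apply/measurable_EFinP; mfun.
  - by move=> t _; rewrite lee_fin pow4_add_le.
rewrite EFin_Rintegral// lee_fin RintD; [|exact: L1Z|exact: L1Z].
by rewrite (RintZ _ u4) (RintZ _ v4) lerD// ler_wpM2l.
Qed.

Lemma signal_atom i : signal U atom (f \- h) i = coef phi f (val i).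
Proof.
have Si : S (val i).
  have : val i \in A by exact: fsvalP.
  by rewrite in_active// inE => -[].
rewrite -(signal_coef phi_L2 phi_orth f_L2 hh Si); apply: ae_eq_Rint.
- by apply: measurable_funM; [mfun|exact: measurable_atom].
- by apply: measurable_funM => //; mfun.
- by apply: ae_cube => t ct; rewrite atom_cube.
Qed.

(** om^2 = C / N comes from C1 and B = C3 N + 1 from C3, the 1 ensuring B >= 1. Then om^2 B = C C3 +
    C / N, whence the last constant. *)
Lemma data_design (C C3 G : R) : (0 < card_active c q T)%N -> 0 < C -> 0 < C3 ->
  (card_active c q T)%:R * sup [set q l ^+ 2 | l in active c q T] <=
    C * \sum_(l \in active c q T) (q l - c l / T) ^+ 2 ->
  (sup_ge0 [set (\sum_(l \in active c q T) phi l t ^+ 2)%:E | t in cube R d] <=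
    (C3 * (card_active c q T)%:R)%:E)%E ->
  C <= (card_active c q T)%:R ->
  L1 U (fun t => (f \- h) t ^+ 4) -> \int[U]_t ((f \- h) t ^+ 4) <= G ->
  regression_design U atom (f \- h) atom_weight (Num.sqrt (C / (card_active c q T)%:R))
    (C3 * (card_active c q T)%:R + 1) G (C * C3 + C).
Proof.
move=> N0 C0 C30 hC1 hC3 CN L4 hG; set N := card_active c q T in N0 hC1 hC3 CN *.
have NR : 0 < N%:R :> R by rewrite ltr0n.
have N1 : 1 <= N%:R :> R by rewrite ler1n.
have CN0 : 0 <= C / N%:R by rewrite divr_ge0 ?(ltW C0).
have w0 i : 0 <= atom_weight i by exact: weight_ge0.
split => //.
- exact: measurable_atom.
- exact: atom_orth.
- by rewrite lerDr mulr_ge0// ltW.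
- by move=> t; apply: (le_trans (atom_sqnorm hC3 t)); rewrite lerDl.
- by mfun.
- by rewrite -(sum_weight2 c0 finA N0) (big_seq_fsetE _ _ xpredT (fun l => weight c q T l ^+ 2)).
- rewrite sqrtr_ge0/= -[leRHS]sqrtr1 ler_wsqrtr// ler_pdivrMr// mul1r//.
- move=> i; rewrite w0/= -(ger0_norm (w0 i)) -sqrtr_sqr ler_wsqrtr//.
  by apply: (weight_sqr_le c0 q0 T0 finA) => //; exact: fsvalP.
rewrite sqr_sqrtr// mulrDr mulr1; apply: lerD.
  by rewrite mulrA mulrAC mulfVK// gt_eqF.
by rewrite ler_pdivrMr// ler_peMr// ltW.
Qed.

End fixed_function.

Lemma kernel_active (w : L -> R) (x y : site R d) : (forall l, l \notin A -> w l = 0) ->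
  \sum_(l \in S) w l * phi l x * phi l y =
  \sum_(i : A) w (val i) * (phi (val i) x * phi (val i) y).
Proof.
move=> hw; rewrite -(big_seq_fsetE _ _ xpredT (fun l => w l * (phi l x * phi l y))) /=.
rewrite -(fsbig_finite _ _ finA); apply/esym.
rewrite (@fsbig_widen _ _ _ _ (active c q T) S); first by apply: eq_fsbigr => l _; rewrite mulrA.
- by move=> l [].
- move=> l [_ nl] /=; rewrite hw ?mul0r//.
  by rewrite in_active// notin_setE.
Qed.

Lemma UstatE n m (mn : (m <= n)%N) (h : site R d -> R) (D : n.-tuple (obs R d)) :
  Ustat m phi S (weight c q T) h D =
  scale R m * pairsum (ker atom_weight (fun (i : A) (z : obs R d) => (z.1 - h z.2) * phi (val i) z.2))
    (take m D).
Proof.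
have hw l : l \notin A -> weight c q T l = 0.
  by move=> lA; rewrite /weight (gap_notin c0 finA lA) mul0r.
rewrite /Ustat -/(scale R m); congr (_ * _).
(* The default entry for [nth] is taken from the sample, so the empty sample is treated apart. *)
case: n mn D => [|n] mn D.
  by move: mn; rewrite leqn0 => /eqP ->; rewrite take0 big_ord0.
pose x0 := tnth D ord0; pose H := ker atom_weight (fun (i : A) (z : obs R d) => (z.1 - h z.2) * phi (val i) z.2).
rewrite (pairsum_nth _ _ x0) size_takel ?size_tuple//.
rewrite -(sum_pairs_restrict (fun i j => H (nth x0 (take m D) i) (nth x0 (take m D) j)) mn).
apply: eq_bigr => i _; apply: eq_bigr => j /andP[ij jm].
rewrite !nth_take ?(ltn_trans ij)// -!tnth_nth /residual kernel_active//.
rewrite /H /ker /ip mulr_sumr; apply: eq_bigr => k _; rewrite /atom_weight; ring.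
Qed.

End regression_data.

(** * The pilot estimator *)

Section pilot_split.
Context (R : realType) (d : nat) (L : countType) (nu : probability (measurableTypeR R) R).
Context (phi : L -> site R d -> R) (c q : L -> R).
Context (phi_basis : centered_basis phi) (c0 : forall l, 0 <= c l).
Context (T : R) (finA : finite_set (active c q T)).
Local Notation U := (unif_cube R d).
Local Notation A := (fset_set (active c q T)).
Local Notation S := (supp q).
Local Notation w := (atom_weight (c := c) (q := q) (T := T)).
Local Notation psi := (atom phi (c := c) (q := q) (T := T)).

Context (n : nat).
Local Notation m := (main_size R n).
Local Notation k := (n - main_size R n)%N.
Context (pilot : k.-tuple (obs R d) -> site R d -> R) (pilotP : is_pilot phi (~` S) pilot).
Context (f : regfun R d) (g : site R d -> R) (Lg : in_L2 g).
Local Notation Q := (distribution (U \x nu)%E (observe f)).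

Let mn : (m <= n)%N. Proof. exact: leq_subr. Qed.
Let mphi l : measurable_fun setT (phi l).
Proof. by have [h _ _] := phi_basis; have [Ll _] := h l; exact: in_L2_measurable. Qed.
Let mpilot : measurable_fun setT (fun p : k.-tuple (obs R d) * site R d => pilot p.1 p.2).
Proof. by have [] := pilotP. Qed.
Let mf : measurable_fun setT (f : site R d -> R). Proof. exact: (@measurable_funPT _ _ _ _ f). Qed.

Lemma measurable_last_obs : measurable_fun setT (@last_obs R d n).
Proof.
apply/measurable_fun_tnthP => i.
have ik : (m + i < n)%N by rewrite -[ltnRHS](subnKC mn) ltn_add2l.
rewrite (_ : _ \o _ = (fun D : n.-tuple (obs R d) => tnth D (Ordinal ik))).
  exact: measurable_tnth.
apply/funext => D /=; set x := tnth D (Ordinal ik).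
by rewrite (tnth_nth x (last_obs D)) {2}/x (tnth_nth x D) /= nth_drop.
Qed.

Lemma measurable_pilot D : measurable_fun setT (pilot D).
Proof. by have [_ h] := pilotP; have [Lh _] := h D; exact: in_L2_measurable. Qed.

Definition pilot_stat (D : n.-tuple (obs R d)) : R :=
  Ustat m phi S (weight c q T) (pilot (last_obs D)) D.

Definition pilot_loss (D : k.-tuple (obs R d)) : \bar R :=
  (\int[U]_t ((g t - pilot D t) ^+ 4)%:E)%E.

Let mloss2 : measurable_fun setT (fun p : k.-tuple (obs R d) * site R d =>
  ((g p.2 - pilot p.1 p.2) ^+ 4)%:E).
Proof.
apply/measurable_EFinP; apply: measurable_funX; apply: measurable_funB => //.
exact: (measurableT_comp (in_L2_measurable Lg) measurable_snd).
Qed.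

Let loss2_ge0 p : (0 <= ((g p.2 - pilot p.1 p.2) ^+ 4)%:E)%E.
Proof. by rewrite lee_fin exprn_even_ge0. Qed.

Lemma measurable_pilot_loss : measurable_fun setT pilot_loss.
Proof. exact: (measurable_fun_fubini_tonelli_F _ mloss2 loss2_ge0). Qed.

Lemma pilot_loss_ge0 D : (0 <= pilot_loss D)%E.
Proof. by apply: integral_ge0 => t _; rewrite lee_fin exprn_even_ge0. Qed.

Lemma last_obs_join (D : m.-tuple (obs R d)) (D' : k.-tuple (obs R d)) :
  last_obs (join mn (D, D')) = D'.
Proof. by apply: val_inj; rewrite /= val_join drop_size_cat// size_tuple. Qed.

Lemma int_pilot_loss :
  (\int[data_law nu f n]_D cube_norm 4 (g \- pilot (last_obs D)) ^+ 4)%E =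
  (\int[iid_law Q k]_D pilot_loss D)%E.
Proof.
have cE D : (cube_norm 4 (g \- pilot D) ^+ 4)%E = pilot_loss D.
  by rewrite (@cube_normX _ _ 3).
under eq_integral do rewrite cE.
rewrite /data_law (integral_iid_join Q mn (g := fun D => pilot_loss (last_obs D))); last 2 first.
- exact: (measurableT_comp measurable_pilot_loss measurable_last_obs).
- by move=> D; exact: pilot_loss_ge0.
apply: eq_integral => D' _; under eq_integral do rewrite last_obs_join.
by rewrite integral_cst// [X in (_ * X)%E](probability_setT (iid_law Q m)) mule1.
Qed.

Lemma pilot_markov (et b : R) : 0 < et ->
  (\int[data_law nu f n]_D cube_norm 4 (g \- pilot (last_obs D)) ^+ 4 <= (et * b)%:E)%E ->
  (iid_law Q k [set D | (et%:E <= pilot_loss D)%E] <= b%:E)%E.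
Proof.
move=> et0; rewrite int_pilot_loss => hb.
have := le_integral_abse (iid_law Q k) measurableT measurable_pilot_loss et0.
rewrite setTI (eq_integral pilot_loss); last first.
  by move=> D _; rewrite gee0_abs// pilot_loss_ge0.
rewrite (_ : [set D | (et%:E <= `|pilot_loss D|)%E] = [set D | (et%:E <= pilot_loss D)%E]); last first.
  by apply/seteqP; split=> D /=; rewrite gee0_abs ?pilot_loss_ge0.
move=> h; rewrite -(@lee_pmul2l _ et%:E)// -EFinM.
exact: le_trans hb.
Qed.

Local Notation stat h := (test_stat (idfun : measurableTypeR R -> R) psi ((f : site R d -> R) \- h) w).

(** With the pilot sample frozen, the law of the observations is pulled back to pairs of site and
    noise, where the residual reads (f - h) + noise and the scores appear. The predicate [p] lets
    one proof serve both error events. *)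
Lemma data_transfer (p : R -> bool) (D' : k.-tuple (obs R d)) : measurable [set x | p x] ->
  iid_law Q m [set D | p (pilot_stat (join mn (D, D')))] =
  iid_law (U \x nu)%E m [set D | p (stat (pilot D') D)].
Proof.
move=> mp; set h := pilot D'.
pose E (i : A) (z : obs R d) := (z.1 - h z.2) * phi (val i) z.2.
have mE i : measurable_fun setT (E i).
  apply: measurable_funM; last exact: (measurableT_comp (mphi _) measurable_snd).
  by apply: measurable_funB => //; exact: (measurableT_comp (measurable_pilot D') measurable_snd).
have sE (D : m.-tuple (obs R d)) : pilot_stat (join mn (D, D')) = scale R m * pairsum (ker w E) D.
  by rewrite /pilot_stat last_obs_join (UstatE phi c0 finA mn) val_join take_size_cat ?size_tuple.
have mfh : measurable_fun setT ((f : site R d -> R) \- h).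
  by apply: measurable_funB; [exact: mf|exact: measurable_pilot].
have mS i : measurable_fun setT (score (idfun : measurableTypeR R -> R) psi ((f : site R d -> R) \- h) i).
  by apply: measurable_score; [exact: measurable_id|exact: (measurable_atom phi_basis)|exact: mfh].
pose N : set (site R d * measurableTypeR R) := (~` cube R d) `*` setT.
have mN : measurable N by apply: measurableX => //; apply: measurableC; exact: measurable_cube.
have N0 : (U \x nu)%E N = 0%E.
  have mC : measurable (~` cube R d) by apply: measurableC; exact: measurable_cube.
  have h0 := product_measure1E U nu mC measurableT.
  by apply: (eq_trans h0); rewrite [X in (X * _)%E](unif_cubeC R d) mul0e.
apply: (iid_law_map mN N0).
- rewrite (_ : [set D | _] = (fun D : m.-tuple (obs R d) => scale R m * pairsum (ker w E) D) @^-1` [set x | p x]).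
    rewrite -[X in measurable X]setTI.
    have mV : measurable_fun setT (fun D : m.-tuple (obs R d) => scale R m * pairsum (ker w E) D).
      by apply: measurable_funM => //; exact: mseq_pairsum.
    exact: mV.
  by apply/seteqP; split=> D /=; rewrite sE.
- rewrite -[X in measurable X]setTI.
  have mV : measurable_fun setT (fun D : m.-tuple (site R d * measurableTypeR R) => stat h D).
    by apply: measurable_funM => //; exact: mseq_pairsum.
  exact: (mV measurableT [set x | p x] mp).
move=> D hD /=; rewrite sE /test_stat; congr (is_true (p (_ * _))).
apply: eq_pairsum_in => z z' zD z'D.
have hz y : y \in D -> cube R d y.1.
  move=> /tnthP[i ->]; apply: contrapT => h'; apply: (hD i).
  by split.
rewrite /ker /ip; apply: eq_bigr => i _; rewrite /E /score /=.
by rewrite (atom_cube phi i (hz z zD)) (atom_cube phi i (hz z' z'D)); ring.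
Qed.

Lemma measurable_pilot_stat : measurable_fun setT pilot_stat.
Proof.
rewrite (_ : pilot_stat = fun D => scale R m * pairsum (ker w (fun (i : A) (z : obs R d) =>
  (z.1 - pilot (last_obs D) z.2) * phi (val i) z.2)) (take m D)); last first.
  by apply/funext => D; rewrite /pilot_stat (UstatE phi c0 finA mn).
apply: measurable_funM => //.
rewrite (_ : (fun D => _) = fun D : n.-tuple (obs R d) => \sum_(i < n) \sum_(j < n | (i < j < m)%N)
   \sum_(l : A) w l * (residual (pilot (last_obs D)) D i * phi (val l) (tnth D i).2) *
     (residual (pilot (last_obs D)) D j * phi (val l) (tnth D j).2)).
  have msite i : measurable_fun setT (fun D : n.-tuple (obs R d) => (tnth D i).2).
    exact: (measurableT_comp measurable_snd (measurable_tnth i)).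
  have mres i : measurable_fun setT (fun D : n.-tuple (obs R d) =>
      residual (pilot (last_obs D)) D i).
    apply: measurable_funB.
      exact: (measurableT_comp measurable_fst (measurable_tnth i)).
    have h : measurable_fun setT (fun D : n.-tuple (obs R d) => (last_obs D, (tnth D i).2)).
      by apply: measurable_fun_pair => //; exact: measurable_last_obs.
    exact: (measurableT_comp mpilot h).
  have mpt l i : measurable_fun setT (fun D : n.-tuple (obs R d) => phi l (tnth D i).2).
    exact: (measurableT_comp (mphi l) (msite i)).
  apply: measurable_sum => i; under eq_fun do rewrite big_mkcond.
  apply: measurable_sum => j; case: (_ && _) => //.
  apply: measurable_sum => l.
  apply: measurable_funM; first apply: measurable_funM; first exact: measurable_cst.
    by apply: measurable_funM; [exact: mres|exact: mpt].
  by apply: measurable_funM; [exact: mres|exact: mpt].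
apply/funext => D; set H := ker _ _.
pose x0 : obs R d := (0 : R, [tuple (0 : R) | i < d]).
rewrite (pairsum_nth _ _ x0) size_takel ?size_tuple//.
rewrite -(sum_pairs_restrict (fun i j => H (nth x0 (take m D) i) (nth x0 (take m D) j)) mn).
apply: eq_bigr => i _; apply: eq_bigr => j /andP[ij jm].
by rewrite !nth_take ?(ltn_trans ij)// -!tnth_nth.
Qed.

Lemma pilot_split_le (p : R -> bool) (et b b' : R) : measurable [set x | p x] ->
  0 < et -> 0 <= b ->
  (forall h, closed_span phi (~` S) h -> (\int[U]_t ((g t - h t) ^+ 4)%:E <= et%:E)%E ->
    (iid_law (U \x nu) m [set D | p (stat h D)] <= b%:E)%E) ->
  (\int[data_law nu f n]_D cube_norm 4 (g \- pilot (last_obs D)) ^+ 4 <= (et * b')%:E)%E ->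
  (data_law nu f n [set D | p (pilot_stat D)] <= (b + b')%:E)%E.
Proof.
move=> mp et0 b0 hb hloss.
apply: (@iid_law_split_le _ _ _ Q m n mn _ [set D | (et%:E <= pilot_loss D)%E] b b') => //.
- rewrite -[X in measurable X]setTI.
  exact: (measurable_pilot_stat measurableT (Y := [set x | p x]) mp).
- rewrite -[X in measurable X]setTI; apply: emeasurable_fun_c_infty => //.
  exact: measurable_pilot_loss.
- move=> D' /negP; rewrite -ltNge => good.
  rewrite data_transfer//; apply: hb; last exact: ltW.
  by have [_ h] := pilotP; exact: h.
- exact: pilot_markov.
Qed.

End pilot_split.

(** * Errors at a single function *)

Section esum_coef.
Context (R : realType) (L : countType) (a : L -> R).

Lemma esum_fset_le (b : \bar R) (F : {fset L}) :
  (\esum_(l in [set: L]) (a l)%:E <= b)%E -> ((\sum_(l <- F) a l)%:E <= b)%E.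
Proof.
move=> h; apply: le_trans h; apply: esum_ge; exists [set` F] => //.
by rewrite -sumEFin fsbig_finite//= set_fsetK.
Qed.

Lemma esum_eq0_term l : (forall l, 0 <= a l) -> (\esum_(l in [set: L]) (a l)%:E = 0)%E -> a l = 0.
Proof.
move=> a0 h; have h0 : (\esum_(l in [set: L]) (a l)%:E <= 0)%E by rewrite h.
have := esum_fset_le [fset l]%fset h0; rewrite big_seq_fset1 lee_fin => h1.
by apply/eqP; rewrite eq_le h1 a0.
Qed.

End esum_coef.

Lemma scale_halfE (R : realType) m : (2 <= m)%N ->
  scale R m * (m%:R * (m%:R - 1) / 2) = Num.sqrt (m%:R * (m%:R - 1) / 2).
Proof.
move=> m2; have mp : 0 < m%:R :> R by rewrite ltr0n; case: m m2.
have m1 : 0 < m%:R - 1 :> R by rewrite subr_gt0 ltr1n.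
have x0 : 0 < m%:R * (m%:R - 1) / 2 :> R by rewrite divr_gt0// mulr_gt0.
rewrite /scale (_ : 2 / _ = (m%:R * (m%:R - 1) / 2)^-1); last by rewrite invf_div.
rewrite sqrtrV ?(ltW x0)// -{2}(sqr_sqrtr (ltW x0)) expr2 mulrA mulVf ?mul1r//.
by rewrite gt_eqF// sqrtr_gt0.
Qed.

Section single_function.
Context (R : realType) (d : nat) (L : countType) (nu : probability (measurableTypeR R) R).
Context (phi : L -> site R d -> R) (c q : L -> R).
Context (phi_basis : centered_basis phi) (c0 : forall l, 0 <= c l) (q0 : forall l, 0 <= q l).
Context (T : R) (T0 : 0 < T) (finA : finite_set (active c q T)).
Local Notation U := (unif_cube R d).
Local Notation A := (fset_set (active c q T)).
Local Notation S := (supp q).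
Local Notation N := (card_active c q T).
Context (n : nat) (pilot : (n - main_size R n).-tuple (obs R d) -> site R d -> R)
  (pilotP : is_pilot phi (~` S) pilot).
Local Notation m := (main_size R n).
Context (m2 : (2 <= m)%N) (N0 : (0 < N)%N).
Context (f : regfun R d) (fE : ellipsoid phi c f) (g u : site R d -> R)
  (g_proj : is_projection phi (~` S) f g) (u_proj : is_projection phi S f u).
Local Notation th := (coef phi f).
Local Notation w := (atom_weight (c := c) (q := q) (T := T)).
Local Notation psi := (atom phi (c := c) (q := q) (T := T)).
Local Notation s := (Num.sqrt (m%:R * (m%:R - 1) / 2 : R)).

Let f_L2 : in_L2 f. Proof. by case: fE. Qed.
Let f_cent : centered f. Proof. by case: fE. Qed.
Let mf : measurable_fun setT (f : site R d -> R). Proof. exact: in_L2_measurable. Qed.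
Let phi_L2 l : in_L2 (phi l). Proof. by have [h _ _] := phi_basis; have [] := h l. Qed.
Let phi_orth k l : dot (phi k) (phi l) = (k == l)%:R. Proof. by have [_ h _] := phi_basis. Qed.
Let Lu : in_L2 u. Proof. by have [[]] := u_proj. Qed.
Let Lg : in_L2 g. Proof. by have [[]] := g_proj. Qed.

Lemma ellipsoid_fsum (F : {fset L}) : \sum_(l <- F) c l * th l ^+ 2 <= 1.
Proof. by case: fE => _ _ _ h; rewrite -lee_fin; exact: esum_fset_le. Qed.

Definition mean_shift : R := s / Num.sqrt (sum_gap2 c q T) * \sum_(l <- A) gap c q T l * th l ^+ 2.

Let s0 : 0 < s.
Proof.
by rewrite sqrtr_gt0 divr_gt0// mulr_gt0 ?ltr0n ?subr_gt0 ?ltr1n//; exact: leq_trans m2.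
Qed.

Let g20 : 0 < sum_gap2 c q T. Proof. exact: sum_gap2_gt0. Qed.
Let sg20 : 0 < Num.sqrt (sum_gap2 c q T). Proof. by rewrite sqrtr_gt0. Qed.

Lemma drift_meanE h : closed_span phi (~` S) h ->
  drift_mean U psi ((f : site R d -> R) \- h) w m = mean_shift.
Proof.
move=> hh; rewrite /drift_mean /mean_shift scale_halfE// -[RHS]mulrA; congr (_ * _).
under eq_bigr do rewrite signal_atom//.
rewrite -(big_seq_fsetE _ _ xpredT (fun l => weight c q T l * th l ^+ 2))/= mulr_sumr.
by apply: eq_bigr => l _; rewrite /weight mulrAC mulrC.
Qed.

Lemma mean_shift_ge0 : 0 <= mean_shift.
Proof.
rewrite /mean_shift; apply: mulr_ge0; first by rewrite divr_ge0 ?sqrtr_ge0.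
by apply: sumr_ge0 => l _; rewrite mulr_ge0 ?gap_ge0 ?sqr_ge0.
Qed.

(** A bounded mean of the statistic forces a small projection on S_F: the weighted sum of squared
    coefficients is the mean shift times sqrt(sum_gap2) / s, and [sum_coef2_le] converts it into an
    L_2 bound. *)
Lemma energy_le (qa qi et : R) : 0 < qa -> 0 < qi ->
  (forall l, l \in A -> qa <= q l) -> (forall l, S l -> qi <= q l) ->
  Num.sqrt (sum_gap2 c q T) / s / (T * qa) <= et -> (T * qa)^-1 + (T * qi)^-1 <= et ->
  \int[U]_t (u t ^+ 2) <= et * (1 + mean_shift).
Proof.
move=> qa0 qi0 hqa hqi h1 h2; have [su _] := u_proj.
apply: (parseval_le phi_L2 phi_orth su) => F FS.
rewrite (eq_big_seq (fun l => th l ^+ 2)); last first.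
  by move=> l lF; rewrite (coef_projection phi_L2 f_L2 u_proj (FS l lF)).
have hF := sum_coef2_le c0 T0 finA ellipsoid_fsum qa0 qi0 FS hqa hqi.
apply: (le_trans hF); rewrite mulrDr mulr1 addrC; apply: lerD => //.
have -> : \sum_(l <- A) gap c q T l * th l ^+ 2 = mean_shift * (Num.sqrt (sum_gap2 c q T) / s).
  by rewrite /mean_shift; field; rewrite !gt_eqF.
by rewrite -mulrA mulrC ler_wpM2r// mean_shift_ge0.
Qed.

Lemma mean_shift_alt (z e : R) :
  ((crit_radius c q T ^+ 2)%:E <= `|quad phi q f|)%E ->
  Num.sqrt (m%:R * (m%:R - 1) / 2 * sum_gap2 c q T) = sum_c_gap c q T * (2 * z + e) ->
  2 * z + e <= mean_shift.
Proof.
move=> hq hT; have x0 : 0 <= m%:R * (m%:R - 1) / 2 :> R.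
  by rewrite divr_ge0// mulr_ge0// subr_ge0 ler1n; exact: leq_trans m2.
rewrite sqrtrM// in hT.
have sc_ge0 : 0 <= sum_c_gap c q T.
  by rewrite (sum_c_gapE c0 finA); apply: sumr_ge0 => l _; rewrite mulr_ge0 ?gap_ge0.
(* Otherwise the equation defining T would equate a positive square root with 0. *)
have sc0 : 0 < sum_c_gap c q T.
  rewrite lt_neqAle sc_ge0 andbT; apply/negP => /eqP h.
  move: hT; rewrite -h mul0r => /eqP; rewrite mulf_eq0 !gt_eqF//.
have h := sum_gap_ge c0 q0 T0 finA ellipsoid_fsum sc0 hq.
have -> : 2 * z + e = s / Num.sqrt (sum_gap2 c q T) * (sum_gap2 c q T / sum_c_gap c q T).
  have -> : 2 * z + e = s * Num.sqrt (sum_gap2 c q T) / sum_c_gap c q T.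
    by rewrite hT mulrAC divff ?mul1r// gt_eqF.
  rewrite -[X in _ = _ / _ * (X / _)](sqr_sqrtr (ltW g20)); move: (Num.sqrt (sum_gap2 c q T)) sg20 => y y0.
  by field; rewrite !gt_eqF.
by rewrite /mean_shift ler_wpM2l// divr_ge0// ltW.
Qed.

Lemma mean_shift_null : quad phi q f = 0%E -> mean_shift = 0 /\ forall l, S l -> th l = 0.
Proof.
move=> h; have hS l : S l -> th l = 0.
  move=> Sl; have := esum_eq0_term (a := fun l => q l * th l ^+ 2) l _ h.
  move=> /(_ _) h'; have : q l * th l ^+ 2 = 0 by apply: h' => k; rewrite mulr_ge0 ?sqr_ge0.
  by move/eqP; rewrite mulf_eq0 sqrf_eq0 => /orP[/eqP ql|/eqP //]; move: Sl; rewrite /supp /= ql eqxx.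
split=> //; rewrite /mean_shift big_seq big1 ?mulr0// => l lA.
by rewrite hS ?expr0n ?mulr0//; move: lA; rewrite in_active// inE => -[].
Qed.

Context (mxi4 : L1 nu (fun y => y ^+ 4)).
Context (C C3 et p ep B1 de sl Gm : R) (C_gt0 : 0 < C) (C3_gt0 : 0 < C3) (et0 : 0 < et) (ep0 : 0 < ep)
  (p01 : 0 < p < 1).
Context (hreg : forall (I : finType) (psi : I -> site R d -> R) (g : site R d -> R) (w : I -> R)
    (om B G : R) (m : nat),
    regression_design U psi g w om B G (C * C3 + C) -> (2 <= m)%N ->
    [/\ (G <= de -> om ^+ 2 <= de -> B <= de * m%:R -> (forall i, signal U psi g i = 0) ->
         (iid_law (U \x nu) m [set D | (gauss_quantile p < test_stat (idfun : measurableTypeR R -> R) psi g w D)%R] <= (1 - p + ep)%:E)%E),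
        (G <= de -> om ^+ 2 <= de -> B <= de * m%:R ->
         2 * gauss_quantile p - sl <= drift_mean U psi g w m <= B1 ->
         (iid_law (U \x nu) m [set D | (test_stat (idfun : measurableTypeR R -> R) psi g w D <= gauss_quantile p)%R] <= (1 - p + ep)%:E)%E) &
        (G <= Gm -> B1 < drift_mean U psi g w m ->
         (iid_law (U \x nu) m [set D | (test_stat (idfun : measurableTypeR R -> R) psi g w D <= gauss_quantile p)%R] <= ep%:E)%E)]).
Context (hC1 : N%:R * sup [set q l ^+ 2 | l in active c q T] <=
    C * \sum_(l \in active c q T) (q l - c l / T) ^+ 2)
  (hC3 : (sup_ge0 [set (\sum_(l \in active c q T) phi l t ^+ 2)%:E | t in cube R d] <=
    (C3 * N%:R)%:E)%E)
  (CN : C <= N%:R) (CNde : C / N%:R <= de) (Bde : C3 * N%:R + 1 <= de * m%:R).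
Context (hloss : (\int[data_law nu f n]_D cube_norm 4 (g \- pilot (last_obs D)) ^+ 4 <= (et * ep)%:E)%E).
Context (u4 : L1 U (fun t => u t ^+ 4)).

Let om2 : Num.sqrt (C / N%:R) ^+ 2 <= de.
Proof. by rewrite sqr_sqrtr// divr_ge0// ltW. Qed.

Let p1 : 0 <= 1 - p. Proof. by have /andP[_ h] := p01; rewrite subr_ge0 ltW. Qed.

Let design h (a : R) : closed_span phi (~` S) h -> \int[U]_t (u t ^+ 4) <= a ->
  (\int[U]_t ((g t - h t) ^+ 4)%:E <= et%:E)%E ->
  regression_design U psi ((f : site R d -> R) \- h) w (Num.sqrt (C / N%:R)) (C3 * N%:R + 1)
    (8 * a + 8 * et) (C * C3 + C).
Proof.
move=> hh ha hl.
have [L4 h4] := residual_pow4 phi_basis mf f_L2 f_cent g_proj u_proj hh u4 ha hl.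
exact: (data_design phi_basis c0 q0 T0 finA mf hh N0 C_gt0 C3_gt0 hC1 hC3 CN L4 h4).
Qed.

Lemma type1_error : quad phi q f = 0%E -> 8 * \int[U]_t (u t ^+ 4) + 8 * et <= de ->
  (data_law nu f n [set D | (gauss_quantile p < pilot_stat phi c q T pilot D)%R] <=
   (1 - p + 2 * ep)%:E)%E.
Proof.
move=> /mean_shift_null[_ th0] hde.
rewrite (_ : 1 - p + 2 * ep = 1 - p + ep + ep); last by ring.
apply: (pilot_split_le phi_basis c0 finA pilotP Lg (p := fun x => gauss_quantile p < x) _ et0 _ _ hloss).
- rewrite (_ : [set x | _] = `]gauss_quantile p, +oo[%classic)//.
  by apply/seteqP; split=> x /=; rewrite in_itv/= andbT.
- by rewrite addr_ge0// ltW.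
move=> h hh hl; have [h1 _ _] := hreg (design hh (lexx _) hl) m2.
apply: h1 => // i; rewrite signal_atom// th0//.
by have : val i \in A by [exact: fsvalP]; rewrite in_active// inE => -[].
Qed.

(** The mean shift is the same for every pilot value, so the choice between the normal approximation
    and Chebyshev can be made after conditioning on the pilot. *)
Lemma type2_error : (2 * gauss_quantile p - sl <= mean_shift) ->
  (mean_shift <= B1 -> 8 * \int[U]_t (u t ^+ 4) + 8 * et <= de) ->
  8 * \int[U]_t (u t ^+ 4) + 8 * et <= Gm ->
  (data_law nu f n [set D | (~~ (gauss_quantile p < pilot_stat phi c q T pilot D))%R] <=
   (1 - p + 2 * ep)%:E)%E.
Proof.
move=> hmu hde hGm.
rewrite (_ : 1 - p + 2 * ep = 1 - p + ep + ep); last by ring.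
apply: (pilot_split_le phi_basis c0 finA pilotP Lg (p := fun x => ~~ (gauss_quantile p < x)) _ et0 _ _ hloss).
- rewrite (_ : [set x | _] = `]-oo, gauss_quantile p]%classic)//.
  by apply/seteqP; split=> x /=; rewrite in_itv/= -leNgt.
- by rewrite addr_ge0// ltW.
move=> h hh hl; have [_ h2 h3] := hreg (design hh (lexx _) hl) m2.
rewrite drift_meanE// in h2 h3.
under eq_set do rewrite -leNgt.
have [muB|muB] := leP mean_shift B1.
  by apply: h2 => //; [exact: hde|rewrite hmu].
by apply: (le_trans (h3 hGm muB)); rewrite lee_fin lerDr.
Qed.

End single_function.

(** * Suprema and noise moments *)

Section noise_moments.
Context (R : realType) (nu : probability (measurableTypeR R) R).
Context (nu_mean : ('E_nu[idfun] = 0)%E) (nu_var : ('V_nu[idfun] = 1)%E)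
  (nu_moment4 : ('E_nu[fun x : R => (x ^+ 4)%R] < +oo)%E).

Lemma noise_L1_pow4 : L1 nu (fun x => x ^+ 4).
Proof.
apply/integrableP; split.
  by apply/measurable_EFinP; apply: measurable_funX; exact: measurable_id.
under eq_integral => x _ do rewrite /= ger0_norm ?exprn_even_ge0//.
by move: nu_moment4; rewrite unlock.
Qed.

Lemma noise_mean : \int[nu]_x x = 0.
Proof. by move: nu_mean; rewrite unlock /Rintegral => ->. Qed.

Lemma noise_var : \int[nu]_x (x ^+ 2) = 1.
Proof.
move: nu_var; rewrite /variance unlock nu_mean /= unlock /Rintegral.
rewrite (_ : (\int[nu]_w _)%E = (\int[nu]_x (x ^+ 2)%:E)%E) => [->//|].
by apply: eq_integral => x _; rewrite -[LHS]/(((x - 0) * (x - 0))%R%:E) subr0 expr2.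
Qed.

End noise_moments.

Section sup_ge0.
Context (R : realType).
Implicit Types (E : set (\bar R)) (b : \bar R).

Lemma sup_ge0_le E b : (0 <= b)%E -> (forall x, E x -> (x <= b)%E) -> (sup_ge0 E <= b)%E.
Proof. by move=> b0 h; apply: ge_ereal_sup => x [->//|]; exact: h. Qed.

Lemma le_sup_ge0 E x : E x -> (x <= sup_ge0 E)%E.
Proof. by move=> Ex; apply: ereal_sup_ubound; right. Qed.

Lemma sup_ge0_ge0 E : (0 <= sup_ge0 E)%E.
Proof. by apply: ereal_sup_ubound; left. Qed.

End sup_ge0.

Lemma cube_norm_int_le (R : realType) (d : nat) (p M : R) (u : site R d -> R) : 0 < p -> 0 <= M ->
  (cube_norm p u <= M%:E)%E -> (\int[unif_cube R d]_t (`|u t| `^ p)%:E <= (M `^ p)%:E)%E.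
Proof.
move=> p0 M0 h; rewrite -cube_norm_powR ?gt_eqF//.
move: h; rewrite /cube_norm; case: (Lnorm _ _ _) (Lnorm_ge0 (unif_cube R d) p%:E (EFin \o u)) => [r|//|//].
rewrite !lee_fin => r0 rM.
by rewrite ge0_ler_powR ?nnegrE// ltW.
Qed.

(** Truncation at M = 1 gives at most the second moment plus K, and u^2 <= (1 + u^4) / 2 lets half
    of the fourth moment be absorbed on the left. *)
Lemma fourth_moment_le d (T : measurableType d) (R : realType) (P : probability T R) (p K : R)
    (u : T -> R) : 4 < p -> measurable_fun setT u -> L1 P (fun t => u t ^+ 2) ->
  (\int[P]_t (`|u t| `^ p)%:E <= K%:E)%E ->
  L1 P (fun t => u t ^+ 4) /\ \int[P]_t (u t ^+ 4) <= 1 + 2 * K.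
Proof.
move=> p4 mu u2 hK; have [u4 h4] := int_pow4_le p4 mu u2 hK ltr01; split=> //.
have h2 : \int[P]_t (u t ^+ 2) <= \int[P]_t (2^-1 * (1 + u t ^+ 4)).
  apply: le_Rint => //; first by apply: L1Z; apply: L1D => //; exact: L1_cst.
  move=> t; rewrite mulrC ler_pdivlMr//.
  have := sqr_ge0 (u t ^+ 2 - 1).
  rewrite (_ : (u t ^+ 2 - 1) ^+ 2 = 1 + u t ^+ 4 - u t ^+ 2 * 2); last by ring.
  by rewrite subr_ge0.
have L' := L1D (L1_cst P 1) u4.
rewrite (RintZ _ L') (RintD (L1_cst P 1) u4) Rint_cst in h2.
move: h4; rewrite powR1 expr1n !mul1r; lra.
Qed.

Lemma main_size_ge (R : realType) n : (4 <= n)%N -> (n <= 2 * main_size R n)%N.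
Proof.
move=> n4; rewrite /main_size; set k := Num.truncn _.
have h : k%:R <= Num.sqrt (n%:R : R) by rewrite truncn_le sqrtr_ge0.
have n0 : 0 <= n%:R :> R by [].
have n4' : 4 <= n%:R :> R by rewrite ler_nat.
have h2 : Num.sqrt (n%:R : R) <= n%:R / 2.
  rewrite -[leRHS]ger0_norm ?divr_ge0// -sqrtr_sqr ler_wsqrtr//.
  rewrite exprMn (_ : 2^-1 ^+ 2 = 4^-1); last by field.
  by rewrite ler_pdivlMr// expr2 ler_wpM2l.
have h3 : (2 * k <= n)%N.
  by rewrite -(ler_nat R) natrM; move: (le_trans h h2); rewrite ler_pdivlMr// mulrC.
have e : (2 * n = n + n)%N by rewrite mul2n addnn.
rewrite mulnBr e leq_subRL; first by rewrite leq_add2r.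
by rewrite (leq_trans h3)// leq_addr.
Qed.

(** * Uniform bounds *)

Lemma half_pairs_sqrt_ge (R : realType) (n m : nat) : (2 <= m)%N -> (n <= 2 * m)%N ->
  n%:R / 4 <= Num.sqrt (m%:R * (m%:R - 1) / 2 : R).
Proof.
move=> m2 nm.
have m2' : 2 <= m%:R :> R by rewrite ler_nat.
have nm' : n%:R <= 2 * m%:R :> R by rewrite -natrM ler_nat.
have n0 : 0 <= n%:R :> R by [].
rewrite -[leLHS]ger0_norm ?divr_ge0// -sqrtr_sqr ler_wsqrtr//.
have h : n%:R ^+ 2 <= (2 * m%:R) ^+ 2 :> R by rewrite lerXn2r ?nnegrE ?mulr_ge0.
move: h m2'; move: (m%:R : R) (n%:R : R) => x y h x2.
have : 0 <= x * (x - 2) by rewrite mulr_ge0//; lra.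
by move: h; rewrite !expr2; lra.
Qed.

(** Each gap is at most T q, so the factor T cancels and C2 remains; the 4 is the constant of
    [half_pairs_sqrt_ge]. *)
Lemma gap_ratio_le (R : realType) (L : countType) (c q : L -> R) (T e I : R) (n m : nat) :
  (forall l, 0 <= c l) -> (forall l, 0 <= q l) -> 0 < T -> finite_set (active c q T) ->
  (2 <= m)%N -> (0 < n <= 2 * m)%N -> 0 <= e -> 0 < I ->
  \sum_(l \in active c q T) q l ^+ 2 <= e ^+ 2 * (n%:R ^+ 2 * I) ->
  Num.sqrt (sum_gap2 c q T) / Num.sqrt (m%:R * (m%:R - 1) / 2) / (T * Num.sqrt I) <= 4 * e.
Proof.
move=> c0 q0 T0 finA m2 /andP[n0 nm] e0 I0 h.
have nR : 0 < n%:R :> R by rewrite ltr0n.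
have hs := half_pairs_sqrt_ge R m2 nm.
have sI : 0 < Num.sqrt I by rewrite sqrtr_gt0.
have n4 : 0 < n%:R / 4 :> R by rewrite divr_gt0.
have s0 := lt_le_trans n4 hs.
have hg : Num.sqrt (sum_gap2 c q T) <= T * (e * (n%:R * Num.sqrt I)).
  have b0 : 0 <= T * (e * (n%:R * Num.sqrt I)).
    by rewrite mulr_ge0 ?(ltW T0)// mulr_ge0// mulr_ge0// ltW.
  rewrite -[leRHS]ger0_norm// -sqrtr_sqr ler_wsqrtr//.
  rewrite !exprMn sqr_sqrtr ?(ltW I0)//.
  apply: (@le_trans _ _ (T ^+ 2 * \sum_(l \in active c q T) q l ^+ 2)); last first.
    by rewrite ler_wpM2l ?sqr_ge0.
  rewrite (sum_gap2E c0 finA) (fsbig_finite _ _ finA) mulr_sumr; apply: ler_sum => l _.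
  rewrite -exprMn; apply: lerXn2r; rewrite ?nnegrE ?gap_ge0 ?gap_le//.
  by rewrite mulr_ge0// ltW.
rewrite ler_pdivrMr ?mulr_gt0// ler_pdivrMr//; apply: (le_trans hg).
rewrite (_ : T * (e * _) = 4 * e * (T * Num.sqrt I) * (n%:R / 4)); last by field.
by rewrite ler_wpM2l// mulr_ge0 ?mulr_ge0// ltW.
Qed.

Lemma main_size_ge2 (R : realType) n : (4 <= n)%N -> (2 <= main_size R n)%N.
Proof.
move=> n4; have := leq_trans n4 (main_size_ge R n4).
by rewrite -[4%N]/(2 * 2)%N leq_pmul2l.
Qed.

Lemma coef_bounds (R : realType) (L : countType) (c q : L -> R) (T et : R) (n : nat) :
  (forall l, 0 <= c l) -> (forall l, 0 <= q l) -> 0 < T -> finite_set (active c q T) ->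
  (0 < card_active c q T)%N -> 0 < et ->
  2 / et <= T * inf [set q l | l in supp q] ->
  \sum_(l \in active c q T) q l ^+ 2 <=
    (et / 4) ^+ 2 * (n%:R ^+ 2 * inf [set q l ^+ 2 | l in active c q T]) ->
  (4 <= n)%N ->
  exists qa qi : R, [/\ 0 < qa, 0 < qi,
    (forall l, l \in fset_set (active c q T) -> qa <= q l),
    (forall l, supp q l -> qi <= q l) &
    Num.sqrt (sum_gap2 c q T) /
      Num.sqrt ((main_size R n)%:R * ((main_size R n)%:R - 1) / 2) / (T * qa) <= et /\
    (T * qa)^-1 + (T * qi)^-1 <= et].
Proof.
move=> c_ge0 q_ge0 T0 finA N0 et0; set qi := inf _ => hqi; set I := inf _ => hI n4.
have qi0 : 0 < qi.
  have h : 0 < T * qi by apply: lt_le_trans hqi; rewrite divr_gt0.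
  by rewrite pmulr_rgt0 in h.
have qiP l : supp q l -> qi <= q l.
  by move=> ql; apply: ge_inf; [exists 0 => _ [k _ <-]|exists l].
have [l0 Al0] : exists l, active c q T l.
  move: N0; rewrite /card_active cardfs_gt0 => /fset0Pn[l lA].
  by exists l; rewrite in_active// inE in lA.
have IP l : active c q T l -> I <= q l ^+ 2.
  by move=> Al; apply: ge_inf; [exists 0 => _ [k _ <-]; exact: sqr_ge0|exists l].
have qiI : qi ^+ 2 <= I.
  apply: lb_le_inf; first by exists (q l0 ^+ 2); exists l0.
  move=> _ [l [Sl _] <-]; rewrite lerXn2r ?nnegrE ?(ltW qi0)//; exact: qiP.
have I0 : 0 < I by apply: lt_le_trans qiI; rewrite exprn_gt0.
have qa0 : 0 < Num.sqrt I by rewrite sqrtr_gt0.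
have qaqi : qi <= Num.sqrt I by rewrite -(ger0_norm (ltW qi0)) -sqrtr_sqr ler_wsqrtr.
have mge := main_size_ge R n4.
have m2 : (2 <= main_size R n)%N by exact: main_size_ge2.
(* [I] is an infimum of squares over the active set, so its root bounds q from below there; it is
   positive because it dominates [qi], which the lower bound in [hqi] makes positive. *)
exists (Num.sqrt I), qi; split=> //.
- move=> l; rewrite in_active// inE => Al.
  by rewrite -(ger0_norm (q_ge0 l)) -sqrtr_sqr ler_wsqrtr// IP.
split.
  rewrite (_ : et = 4 * (et / 4)); last by field.
  apply: (gap_ratio_le (n := n)) => //; first by rewrite mge andbT (leq_trans _ n4).
  by rewrite divr_ge0// ltW.
have h : (T * qi)^-1 <= et / 2.
  by rewrite -(invrK (et / 2)) lef_pV2 ?posrE ?mulr_gt0 ?invr_gt0 ?divr_gt0// invf_div.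
have h' : (T * Num.sqrt I)^-1 <= (T * qi)^-1.
  by rewrite lef_pV2 ?posrE ?mulr_gt0// ler_wpM2l// ltW.
by rewrite (splitr et); apply: lerD => //; exact: le_trans h.
Qed.

(** Turns a bound for every positive e into a single o(1) sequence, the positive part of x - gamma.
    [fine] is harmless there since x is eventually finite. *)
Lemma near_le_cvg (R : realType) (x : nat -> \bar R) (gamma : R) : (forall n, (0 <= x n)%E) ->
  (forall e : R, 0 < e -> \forall n \near \oo, (x n <= (gamma + e)%:E)%E) ->
  exists2 eps : nat -> R, eps @ \oo --> (0 : R) &
    \forall n \near \oo, (x n <= (gamma + eps n)%:E)%E.
Proof.
move=> x0 h; pose eps n := Num.max 0 (fine (x n) - gamma).
have hfin n (e : R) : (x n <= (gamma + e)%:E)%E -> x n \is a fin_num.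
  by move=> hn; rewrite ge0_fin_numE//; apply: (le_lt_trans hn); rewrite ltry.
exists eps.
  apply/cvgrPdist_le => e e0; have := h e e0; apply: filterS => n hn.
  rewrite sub0r normrN ger0_norm ?le_max ?lexx// /eps ge_max (ltW e0)/= lerBlDl.
  by rewrite -lee_fin fineK//; exact: hfin hn.
have := h 1 ltr01; apply: filterS => n hn.
rewrite -(fineK (hfin _ _ hn)) lee_fin -lerBlDl /eps le_max lexx orbT//.
Qed.

Theorem theorem1 (R : realType) (d : nat) (L : countType)
    (nu : probability (measurableTypeR R) R)
    (phi : L -> site R d -> R) (c q : L -> R)
    (Sigma : set (regfun R d))
    (Pi PiS : regfun R d -> site R d -> R)
    (pilot : forall n : nat,
      (n - main_size R n).-tuple (obs R d) -> site R d -> R)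
    (gamma : R) (T : nat -> R)
    (* noise *)
    (nu_mean : ('E_nu[idfun] = 0)%E)
    (nu_var : ('V_nu[idfun] = 1)%E)
    (nu_moment4 : ('E_nu[fun x : R => (x ^+ 4)%R] < +oo)%E)
    (* basis, arrays and function class *)
    (phi_basis : centered_basis phi)
    (c_ge0 : forall l, 0 <= c l)
    (q_ge0 : forall l, 0 <= q l)
    (Sigma_sub : Sigma `<=` ellipsoid phi c)
    (Pi_proj : forall f, Sigma f -> is_projection phi (~` supp q) f (Pi f))
    (PiS_proj : forall f, Sigma f -> is_projection phi (supp q) f (PiS f))
    (pilot_est : forall n, is_pilot phi (~` supp q) (@pilot n))
    (active_fin : forall t : R, 0 < t -> finite_set (active c q t))
    (* level and cut-off sequence *)
    (gamma01 : 0 < gamma < 1)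
    (T_gt0 : forall n, 0 < T n)
    (T_eq : exists2 eps : nat -> R, eps @ \oo --> (0 : R) &
      \forall n \near \oo,
        let m := main_size R n in
        Num.sqrt (m%:R * (m%:R - 1) / 2 * sum_gap2 c q (T n)) =
        sum_c_gap c q (T n) * (2 * gauss_quantile (1 - gamma / 2) + eps n))
    (C1 : exists2 C : R, 0 < C & \forall n \near \oo,
      (card_active c q (T n))%:R * sup [set q l ^+ 2 | l in active c q (T n)] <=
      C * \sum_(l \in active c q (T n)) (q l - c l / T n) ^+ 2)
    (C2 : (fun n => \sum_(l \in active c q (T n)) q l ^+ 2) =o_\oo
      (fun n => n%:R ^+ 2 * inf [set q l ^+ 2 | l in active c q (T n)]))
    (C3 : exists2 C : R, 0 < C & \forall n \near \oo,
      (sup_ge0 [set (\sum_(l \in active c q (T n)) phi l t ^+ 2)%:E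
                 | t in cube R d] <=
       (C * (card_active c q (T n))%:R)%:E)%E)
    (C4_infty : card_active c q (T n) @[n --> \oo] --> \oo)
    (C4_small : (fun n => (card_active c q (T n))%:R : R) =o_\oo
      (fun n => n%:R : R))
    (C5 : T n * inf [set q l | l in supp q] @[n --> \oo] --> +oo)
    (C6 : sup_ge0 [set (\int[data_law nu f n]_D
              cube_norm 4 (Pi f \- pilot n (last_obs D)) ^+ 4)%E | f in Sigma]
            @[n --> \oo] --> 0%E)
    (C7 : exists2 p : R, 4 < p &
      (sup_ge0 [set cube_norm p (PiS f) | f in Sigma] < +oo)%E) :
  exists2 eps : nat -> R, eps @ \oo --> (0 : R) &
    \forall n \near \oo,
      (total_error nu (null_class phi q Sigma)
         (alt_class phi q Sigma (crit_radius c q (T n)))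
         (fun D : n.-tuple (obs R d) =>
            (gauss_quantile (1 - gamma / 2) <
             Ustat (main_size R n) phi (supp q) (weight c q (T n))
               (pilot n (last_obs D)) D)%R)
       <= (gamma + eps n)%:E)%E.
Proof.
apply: near_le_cvg => [n|e e0]; first by apply: adde_ge0; exact: sup_ge0_ge0.
have /andP[gam0 gam1] := gamma01.
have [p pE] : exists p, p = 1 - gamma / 2 by eexists.
(* Two errors, each spending ep on the test and ep on a bad pilot. *)
have [ep epE] : exists ep, ep = e / 4 by eexists.
have p01 : 0 < p < 1 by apply/andP; split; clear - pE gam0 gam1; lra.
have ep0 : 0 < ep by rewrite epE divr_gt0.
have [C C_gt0 hC1] := C1; have [C3' C3_gt0 hC3] := C3.
have [pp pp4 hpp] := C7.
have [M ME] : exists M, sup_ge0 [set cube_norm pp (PiS f) | f in Sigma] = M%:E.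
  by eexists; rewrite -[LHS]fineK// ge0_fin_numE// sup_ge0_ge0.
have M0 : 0 <= M by rewrite -lee_fin -ME sup_ge0_ge0.
have [K KE] : exists K, K = M `^ pp by eexists.
have K0 : 0 <= K by rewrite KE powR_ge0.
have hK f : Sigma f -> (\int[unif_cube R d]_t (`|PiS f t| `^ pp)%:E <= K%:E)%E.
  move=> Sf; rewrite KE; apply: cube_norm_int_le => //; first by rewrite (lt_trans _ pp4).
  by rewrite -ME; apply: le_sup_ge0; exists f.
(* Bound on the fourth moment of the residual signal over all of [Sigma]: 8 times that of the
   projection plus 8 times the pilot loss, which is at most [et] <= 1. *)
have [Gm GmE] : exists Gm, Gm = 8 * (1 + 2 * K) + 8 by eexists.
have Gm0 : 0 <= Gm by clear - GmE K0; lra.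
have b00 : 0 <= C * C3' + C by rewrite addr_ge0 ?mulr_ge0// ltW.
have mid : measurable_fun [set: measurableTypeR R] (idfun : measurableTypeR R -> R).
  exact: measurable_id.
have [B1 [de [sl [de0 sl0 hreg]]]] := regression_test (unif_cube R d) mid
  (noise_L1_pow4 nu_moment4) (noise_mean nu_mean) (noise_var nu_mean nu_var) p01 ep0 b00 Gm0.
(* The projection and the pilot loss each contribute at most 8 (de / 16) = de / 2 to the fourth
   moment. *)
have [et etE] : exists et, et = Num.min 1 (de / 16) by eexists.
have et0 : 0 < et by rewrite etE lt_min ltr01 divr_gt0.
have et1 : et <= 1 by rewrite etE ge_min lexx.
have etde : et <= de / 16 by rewrite etE ge_min lexx orbT.
have de16 : 0 < de / 16 by rewrite divr_gt0.
have [du du0 hdu] := int_pow4_small (unif_cube R d) pp4 K0 de16.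
have [eta etaE] : exists eta, eta = du / (1 + `|B1|) by eexists.
have B1n : 0 < 1 + `|B1| by rewrite ltr_wpDr.
have eta0 : 0 < eta by rewrite etaE divr_gt0.
(* The second alternative serves the null hypothesis, where the mean shift is 0 whatever the sign of
   [B1]. *)
have etale (x : R) : x <= B1 \/ x <= 0 -> eta * (1 + x) <= du.
  move=> hx; rewrite etaE mulrAC ler_pdivrMr// ler_wpM2l ?(ltW du0)// lerD2l.
  by case: hx => h; apply: (le_trans h); rewrite ?ler_norm.
have [eps eps0 hT] := T_eq.
(* Once N exceeds C + C / de, both C <= N and C / N <= de hold. *)
have xi0 : 0 <= C + C / de by rewrite addr_ge0 ?divr_ge0// ltW.
have e1 : 0 < de / (4 * C3') by rewrite divr_gt0// mulr_gt0.
have e2 : 0 < (eta / 4) ^+ 2 by rewrite exprn_gt0// divr_gt0.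
have eep : 0 < et * ep by rewrite mulr_gt0.
have hC2 := (eqoP _ _ _).1 C2 _ e2.
have hC4 := (eqoP _ _ _).1 C4_small _ e1.
have /cvgnyPge/(_ (Num.bound (C + C / de))) hC4' := C4_infty.
have /cvgryPge/(_ (2 / eta)) hC5 := C5.
have hC6 : \forall n \near \oo, (sup_ge0 [set (\int[data_law nu f n]_D
              cube_norm 4 (Pi f \- pilot n (last_obs D)) ^+ 4)%E | f in Sigma] <= (et * ep)%:E)%E.
  have /fine_cvgP[hfin /cvgrPdist_le/(_ _ eep)] := C6.
  apply: filterS2 hfin => n fn; rewrite sub0r normrN.
  by rewrite /= ger0_norm ?fine_ge0 ?sup_ge0_ge0// -lee_fin fineK.
have /cvgrPdist_le/(_ _ sl0) heps := eps0.
near=> n.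
have n4 : (4 <= n)%N by near: n; exact: nbhs_infty_ge.
(* Pays for the 1 in B = C3 N + 1. *)
have nde : (Num.bound (4 / de) <= n)%N by near: n; exact: nbhs_infty_ge.
have T0 := T_gt0 n; have finA := active_fin _ T0.
have mge := main_size_ge R n4.
have m2 : (2 <= main_size R n)%N by exact: main_size_ge2.
have Nb : (Num.bound (C + C / de) <= card_active c q (T n))%N by near: n.
have Nbig : C + C / de < (card_active c q (T n))%:R by apply: lt_le_trans (archi_boundP xi0) _; rewrite ler_nat.
have Cde0 : 0 < C / de by rewrite divr_gt0.
have N0 : (0 < card_active c q (T n))%N by rewrite -(ltr_nat R); apply: le_lt_trans Nbig.
have CN : C <= (card_active c q (T n))%:R by clear - Nbig Cde0; lra.
have NR : 0 < (card_active c q (T n))%:R :> R by rewrite ltr0n.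
have CNde : C / (card_active c q (T n))%:R <= de.
  rewrite ler_pdivrMr// mulrC -ler_pdivrMr//; clear - Nbig C_gt0; lra.
have mgeR : n%:R <= 2 * (main_size R n)%:R :> R by rewrite -natrM ler_nat.
have n0R : 0 <= n%:R :> R by [].
have Nn : (card_active c q (T n))%:R <= de / (4 * C3') * n%:R.
  have : `|(card_active c q (T n))%:R : R| <= de / (4 * C3') * `|n%:R : R| by near: n; exact: hC4.
  by rewrite !ger0_norm.
have Bde : C3' * (card_active c q (T n))%:R + 1 <= de * (main_size R n)%:R.
  have h1 : C3' * (card_active c q (T n))%:R <= de / 4 * n%:R.
    apply: (le_trans (ler_wpM2l (ltW C3_gt0) Nn)).
    by rewrite le_eqVlt; apply/orP; left; apply/eqP; field; rewrite gt_eqF.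
  have h2 : 1 <= de / 4 * n%:R.
    have h : 4 / de < n%:R.
      by apply: lt_le_trans (archi_boundP _) _; [rewrite divr_ge0// ltW|rewrite ler_nat].
    by rewrite ltr_pdivrMr// in h; clear - h; lra.
  have h3 : de * n%:R <= de * (2 * (main_size R n)%:R) by rewrite ler_wpM2l// ltW.
  by clear - h1 h2 h3 mgeR; lra.
have hC1n : (card_active c q (T n))%:R * sup [set q l ^+ 2 | l in active c q (T n)] <=
      C * \sum_(l \in active c q (T n)) (q l - c l / T n) ^+ 2 by near: n.
have hC3n : (sup_ge0 [set (\sum_(l \in active c q (T n)) phi l t ^+ 2)%:E | t in cube R d] <=
       (C3' * (card_active c q (T n))%:R)%:E)%E by near: n.
have hC5n : 2 / eta <= T n * inf [set q l | l in supp q] by near: n.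
have hC2n : \sum_(l \in active c q (T n)) q l ^+ 2 <=
    (eta / 4) ^+ 2 * (n%:R ^+ 2 * inf [set q l ^+ 2 | l in active c q (T n)]).
  have I0 : 0 <= inf [set q l ^+ 2 | l in active c q (T n)].
    have [/set0P/= ne|] := boolP ([set q l ^+ 2 | l in active c q (T n)] != set0).
      by apply: lb_le_inf => // _ [l _ <-]; exact: sqr_ge0.
    by move/negPn/eqP => ->; rewrite inf0.
  have h : `|\sum_(l \in active c q (T n)) q l ^+ 2| <= (eta / 4) ^+ 2 *
     `|n%:R ^+ 2 * inf [set q l ^+ 2 | l in active c q (T n)]| by near: n; exact: hC2.
  rewrite [X in _ <= _ * X]ger0_norm in h; last by rewrite mulr_ge0// sqr_ge0.
  by apply: le_trans h; exact: ler_norm.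
have hTn : Num.sqrt ((main_size R n)%:R * ((main_size R n)%:R - 1) / 2 * sum_gap2 c q (T n)) =
        sum_c_gap c q (T n) * (2 * gauss_quantile p + eps n) by rewrite pE; near: n.
have hepsn : `|eps n| <= sl by rewrite -normrN -sub0r; near: n.
have hC6n : (sup_ge0 [set (\int[data_law nu f n]_D
    cube_norm 4 (Pi f \- pilot n (last_obs D)) ^+ 4)%E | f in Sigma] <= (et * ep)%:E)%E by near: n.
have [qa [qi [qa0 qi0 hqa hqi [hr1 hr2]]]] := coef_bounds c_ge0 q_ge0 T0 finA N0 eta0 hC5n hC2n n4.
have hloss f : Sigma f -> (\int[data_law nu f n]_D
    cube_norm 4 (Pi f \- pilot n (last_obs D)) ^+ 4 <= (et * ep)%:E)%E.
  by move=> Sf; apply: le_trans hC6n; apply: le_sup_ge0; exists f.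
have hu f : Sigma f -> measurable_fun setT (PiS f) /\ L1 (unif_cube R d) (fun t => PiS f t ^+ 2).
  by move=> Sf; have [[Lu _] _] := PiS_proj f Sf; exact: in_L2E.
have hu4 f : Sigma f -> L1 (unif_cube R d) (fun t => PiS f t ^+ 4) /\
    \int[unif_cube R d]_t (PiS f t ^+ 4) <= 1 + 2 * K.
  by move=> Sf; have [mu u2] := hu f Sf; exact: (fourth_moment_le pp4 mu u2 (hK f Sf)).
have henergy f : Sigma f -> mean_shift phi c q (T n) n f <= B1 \/ mean_shift phi c q (T n) n f <= 0 ->
    8 * \int[unif_cube R d]_t (PiS f t ^+ 4) + 8 * et <= de.
  move=> Sf hms; have [mu u2] := hu f Sf.
  have h2 := energy_le phi_basis c_ge0 T0 finA m2 N0 (Sigma_sub _ Sf) (PiS_proj f Sf) qa0 qi0 hqa hqi hr1 hr2.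
  have h4 := hdu _ mu u2 (hK f Sf) (le_trans h2 (etale _ hms)).
  by clear - h4 etde; lra.
have Lg f : Sigma f -> in_L2 (Pi f) by move=> Sf; have [[]] := Pi_proj f Sf.
rewrite (_ : gamma + e = (1 - p + 2 * ep) + (1 - p + 2 * ep)); last by rewrite pE epE; field.
have b0 : (0 <= (1 - p + 2 * ep)%:E)%E by rewrite lee_fin; clear - p01 ep0; move: p01 => /andP[_]; lra.
rewrite -pE EFinD; apply: leeD; apply: sup_ge0_le => // _ [f [Sf hf] <-].
- have [u4 _] := hu4 f Sf.
  apply: (type1_error phi_basis c_ge0 q_ge0 T0 finA (pilot_est n) m2 N0 (Sigma_sub _ Sf) (Pi_proj f Sf)
    (PiS_proj f Sf) C_gt0 C3_gt0 et0 ep0 p01 hreg hC1n hC3n CN CNde Bde (hloss f Sf) u4 hf).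
  apply: henergy => //; right.
  by have [-> _] := mean_shift_null q_ge0 finA n hf.
have [u4 hu4f] := hu4 f Sf.
apply: (type2_error phi_basis c_ge0 q_ge0 T0 finA (pilot_est n) m2 N0 (Sigma_sub _ Sf) (Pi_proj f Sf)
    (PiS_proj f Sf) C_gt0 C3_gt0 et0 ep0 p01 hreg hC1n hC3n CN CNde Bde (hloss f Sf) u4).
(* The o(1) in the equation for T is at most [sl], the tolerance left by [regression_test]. *)
- have h := mean_shift_alt c_ge0 q_ge0 T0 finA m2 N0 (Sigma_sub _ Sf) hf hTn.
  apply: le_trans h; rewrite lerD2l lerNl; apply: le_trans hepsn.
  by rewrite -normrN ler_norm.
- by move=> h; apply: henergy => //; left.
by rewrite GmE; clear - hu4f et1; lra.
Unshelve. all: by end_near.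
Qed.
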